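(* Fix $M>0$. The attractor $X_M$ of the Nernst-Planck-Darcy (NPD) system has finite fractal dimension in $\mathcal{V}$, that is, there exists a finite real number $\tilde M>0$ depending on the body charge $\tilde\rho$ such that $$\limsup_{r\to0}\frac{\log N_{\mathcal{V}}(r)}{\log\left(\frac1r\right)}\le\tilde M,$$ where $N_{\mathcal{V}}(r)$ is the minimal number of balls in $\mathcal{V}$ of radii $r$ needed to cover $X_M$.
   Context: Let $\mathbb{T}^3=[0,2\pi]^3$ with periodic boundary conditions; $H^k=H^k(\mathbb{T}^3)$. Fix an integer $N\ge1$, a diffusivity $D>0$ (common to all species), real valences $z_1,\dots,z_N$ with $|z_1|=\dots=|z_N|$, and a smooth time-independent function $\tilde\rho:\mathbb{T}^3\to\mathbb{R}$ (the added body charge). The NPD system for $c_1,\dots,c_N$ is $$\partial_t c_i+u\cdot\nabla c_i-D\Delta c_i-z_iD\,\nabla\cdot(c_i\nabla\Phi)=0,\quad i=1,\dots,N,$$ $$\rho=\sum_{i=1}^N z_ic_i,\qquad -\Delta\Phi=\rho+\tilde\rho,\qquad u=-\mathbb{P}\big((\rho+\tilde\rho)\nabla\Phi\big),$$ with prescribed initial data, where $\mathbb{P}=I+\nabla(-\Delta)^{-1}\nabla\cdot$ is the Leray-Hodge projection and $\Phi=(-\Delta)^{-1}(\rho+\tilde\rho)$ is mean-free. $\mathcal{V}$ is the set of $(\xi_1,\dots,\xi_N)\in H^1\times\dots\times H^1$ such that each $\xi_i\ge0$ almost everywhere and $\int_{\mathbb{T}^3}\big(\sum_{i=1}^Nz_i\xi_i+\tilde\rho\big)dx=0$,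 equipped with the norm (metric) of $H^1\times\dots\times H^1$. $\mathcal{V}_M$ is the set of $(\xi_1,\dots,\xi_N)\in\mathcal{V}$ with $\int_{\mathbb{T}^3}\xi_i\,dx\le M$ for every $i$. For a function $f$, $\bar f=\frac1{|\mathbb{T}^3|}\int_{\mathbb{T}^3}f\,dx$. The solution map $\mathcal{S}(t):\mathcal{V}\to\mathcal{V}$, $t\ge0$, is $\mathcal{S}(t)(c_1(0),\dots,c_N(0))=(c_1(t),\dots,c_N(t))$, where $(c_1,\dots,c_N)$ is the unique global solution of the NPD system with these initial data that belongs to $L^\infty(0,T;H^1)\cap L^2(0,T;H^2)$ componentwise for every $T>0$ (equations in the sense of distributions). The attractor is $X_M=\bigcap_{t>0}\mathcal{S}(t)\mathcal{B}_M$, where $$\mathcal{B}_M=\Big\{(c_1,\dots,c_N)\in\mathcal{V}_M\cap(H^2\times\dots\times H^2):\ \sum_{i=1}^N\|c_i-\bar c_i\|_{H^2}\le R\Big\}$$ is an absorbing ball: $R>0$ and $\tilde T>0$ depend only on $\tilde\rho$ and $M$ and are such that $\mathcal{S}(t)\mathcal{B}_M\subset\mathcal{B}_M$ for all $t\ge\tilde T$, and for every $w_0\in\mathcal{V}_M$ there is $t_0>0$, depending on the $H^1$ norm of $w_0$, with $\mathcal{S}(t)w_0\in\mathcal{B}_M$ for all $t\ge t_0$ (such $R,\tilde T$ exist). *)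

(* Defs.v *)
From HB Require Import structures.
From mathcomp Require Import all_boot all_order all_algebra.
From mathcomp Require Import all_classical all_reals all_analysis.
Set Implicit Arguments.
Unset Strict Implicit.
Unset Printing Implicit Defensive.
Import Order.TTheory GRing.Theory Num.Theory.
Import numFieldNormedType.Exports.
Local Open Scope classical_set_scope.
Local Open Scope ring_scope.

(* A function on the torus is a function on R^3 of which
   only the restriction to the box [0, 2 pi]^3 matters, up to almost-everywhere
   equality: every integral is over the box, and periodicity is carried by the
   (periodic) test functions and by the body charge.  Hence all the sets of
   functions below are unions of a.e.-equality classes, and norms are
   seminorms vanishing on functions that are a.e. zero. *)

Section Torus.
Context {R : realType}.

Definition leb3 :=
  ((@lebesgue_measure R \x @lebesgue_measure R) \x @lebesgue_measure R)%E.

Definition box : set (R * R * R) :=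
  (`[0, 2 * pi] `*` `[0, 2 * pi]) `*` `[0, 2 * pi].

Definition intT (f : R * R * R -> R) : R := \int[leb3]_(x in box) f x.

Definition avg (f : R * R * R -> R) : R := intT f / (2 * pi) ^+ 3.

Definition basis_vec (j : 'I_3) : R * R * R :=
  ((j == 0 :> nat)%:R, (j == 1 :> nat)%:R, (j == 2 :> nat)%:R).

(* All iterated directional derivatives are differentiable: in finite
   dimension, this is C^infinity. *)
Definition smooth (V : normedModType R) (f : V -> R) : Prop :=
  forall (s : seq V) (x : V),
    differentiable (foldr (fun v (g : V -> R) => fun y => 'D_v g y) f s) x.

Definition torus_periodic (f : R * R * R -> R) : Prop :=
  forall j x, f (x + (2 * pi) *: basis_vec j) = f x.

Definition pd (j : 'I_3) (f : R * R * R -> R) : R * R * R -> R :=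
  fun x => 'D_(basis_vec j) f x.

Definition lap (f : R * R * R -> R) : R * R * R -> R :=
  fun x => \sum_(j < 3) pd j (pd j f) x.

Definition smooth_periodic (phi : R * R * R -> R) : Prop := smooth phi /\ torus_periodic phi.

(* Test functions on (0, +oo) x T^3: compactly supported in time. *)
Definition ttestfun (phi : R * (R * R * R) -> R) : Prop :=
  [/\ smooth phi, (forall t, torus_periodic (fun x => phi (t, x))) &
      exists a b : R, 0 < a /\
        forall t x, (t < a) || (b < t) -> phi (t, x) = 0].

Definition L2 (f : R * R * R -> R) : Prop :=
  measurable_fun box f /\ leb3.-integrable box (fun x => (f x ^+ 2)%:E).

Definition weak_deriv (j : 'I_3) (f g : R * R * R -> R) : Prop :=
  L2 g /\ forall phi, smooth_periodic phi ->
    intT (fun x => f x * pd j phi x) = - intT (fun x => g x * phi x).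

(* A representative of the weak derivative, which is unique up to a.e.
   equality. *)
Definition wderiv (j : 'I_3) (f : R * R * R -> R) : R * R * R -> R :=
  xget (fun=> 0) [set g | weak_deriv j f g].

Fixpoint inH (k : nat) (f : R * R * R -> R) : Prop :=
  if k is k'.+1 then
    L2 f /\ forall j, exists2 g, weak_deriv j f g & inH k' g
  else L2 f.

(* ||f||^2 + sum_j ||d_j f||^2 + sum_(j1, j2) ||d_j2 d_j1 f||^2 + ... *)
Fixpoint sqHnorm (k : nat) (f : R * R * R -> R) : R :=
  if k is k'.+1 then
    intT (fun x => f x ^+ 2) + \sum_(j < 3) sqHnorm k' (wderiv j f)
  else intT (fun x => f x ^+ 2).

Definition Hnorm (k : nat) (f : R * R * R -> R) : R := Num.sqrt (sqHnorm k f).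

(* q = (-Delta)^{-1} T, mean-free, where the distribution T is given by its
   action on test functions. *)
Definition inv_lap (T : (R * R * R -> R) -> R) (q : R * R * R -> R) : Prop :=
  [/\ inH 1 q, intT q = 0 &
      forall phi, smooth_periodic phi -> intT (fun x => q x * - lap phi x) = T phi].

Definition potential (f Phi : R * R * R -> R) : Prop :=
  inv_lap (fun phi => intT (fun x => f x * phi x)) Phi.

(* v = P F = F + grad (-Delta)^{-1} div F *)
Definition leray (F v : 'I_3 -> R * R * R -> R) : Prop :=
  (forall j, L2 (v j)) /\
  exists2 q,
    inv_lap (fun phi => - intT (fun x => \sum_(j < 3) F j x * pd j phi x)) q &
    forall j, {ae leb3, forall x, box x -> v j x = F j x + wderiv j q x}.

End Torus.

Section NPD.
Context {R : realType}.
Variables (N : nat) (D : R) (z : 'I_N -> R) (rhot : R * R * R -> R).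

Definition state : Type := 'I_N -> R * R * R -> R.

Definition total_charge (w : state) : R * R * R -> R :=
  fun x => \sum_(i < N) z i * w i x + rhot x.

(* The continuous representative in time is selected by L^2-continuity, which
   also gives the values c(t) and the initial data their meaning, and makes c
   strongly measurable in time (so only essential bounds and finiteness of
   integrals remain to be asked in Linfty(H^1) and L^2(H^2)). *)
Definition NPD_solution (c : R -> state) : Prop :=
  [/\ forall t i, 0 <= t -> L2 (c t i),
      forall t0 i, 0 <= t0 ->
        Hnorm 0 (c t i \- c t0 i) @[t --> within `[0, +oo[ (nbhs t0)] --> (0 : R),
      forall T i, 0 < T -> exists C : R,
        {ae lebesgue_measure, forall t : R, 0 < t < T ->
           inH 1 (c t i) /\ Hnorm 1 (c t i) <= C},
      forall T i, 0 < T ->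
        {ae lebesgue_measure, forall t : R, 0 < t < T -> inH 2 (c t i)} /\
        (\int[lebesgue_measure]_(t in `]0%R, T[) (Hnorm 2 (c t i) ^+ 2)%:E
           < +oo)%E
    & exists (Phi : R -> R * R * R -> R) (u : R -> 'I_3 -> R * R * R -> R),
      [/\ forall t, 0 < t -> potential (total_charge (c t)) (Phi t),
          forall t, 0 < t ->
            leray (fun j x => total_charge (c t) x * wderiv j (Phi t) x)
                  (fun j x => - u t j x)
        & forall i phi, ttestfun phi ->
          \int[lebesgue_measure]_(t in `]0, +oo[) intT (fun x =>
              - (c t i x * 'D_1 (fun s => phi (s, x)) t)
              + (\sum_(j < 3) u t j x * wderiv j (c t i) x) * phi (t, x)
              - D * (c t i x * lap (fun y => phi (t, y)) x)
              + z i * D * (\sum_(j < 3) c t i x * wderiv j (Phi t) x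
                                        * pd j (fun y => phi (t, y)) x)) = 0]].

(* S(t) A for the solution map S(t), as the set of time-t values of all
   solutions starting in A: by existence and uniqueness of the solution this is
   the image of A, but neither is needed for the definition. *)
Definition flow (t : R) (A : set state) : set state :=
  [set w | exists c, [/\ NPD_solution c, A (c 0) & c t = w]].

Definition Vset : set state :=
  [set w | [/\ forall i, inH 1 (w i),
               forall i, {ae leb3, forall x, box x -> 0 <= w i x} &
               intT (total_charge w) = 0]].

Definition Vnorm (w : state) : R := Num.sqrt (\sum_(i < N) Hnorm 1 (w i) ^+ 2).

Definition Vball (a : state) (r : R) : set state :=
  [set w | Vset w /\ Vnorm (fun i => w i \- a i) < r].

Definition VM (M : R) : set state :=
  [set w | Vset w /\ forall i, intT (w i) <= M].

Definition BM (M rad : R) : set state :=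
  [set w | [/\ VM M w, forall i, inH 2 (w i) &
    \sum_(i < N) Hnorm 2 (fun x => w i x - avg (w i)) <= rad]].

Definition absorbing (M rad T : R) : Prop :=
  [/\ 0 < rad, 0 < T,
      forall t, T <= t -> flow t (BM M rad) `<=` BM M rad
    & exists t0 : R -> R, forall w0, VM M w0 ->
        0 < t0 (Vnorm w0) /\
        forall t, t0 (Vnorm w0) <= t -> flow t [set w0] `<=` BM M rad].

Definition attractor (M rad : R) : set state :=
  [set w | forall t, 0 < t -> flow t (BM M rad) w].

(* +oo if no finite cover exists *)
Definition covering_number (X : set state) (r : R) : \bar R :=
  ereal_inf [set n%:R%:E | n in [set n : nat |
    exists a : 'I_n -> state, (forall k, Vset (a k)) /\
      X `<=` \bigcup_(k in [set: 'I_n]) Vball (a k) r]].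

Definition fractal_dim (X : set state) : \bar R :=
  limf_esup (fun r : R => lne (covering_number X r) * ((ln (1 / r))^-1)%:E)%E
            0^'+.

End NPD.

(* Main.v *)
From HB Require Import structures.
From mathcomp Require Import finmap.
Require Import Defs.
From mathcomp Require Import all_boot all_order all_algebra.
From mathcomp Require Import all_classical all_reals all_analysis.
From mathcomp Require Import measurable_realfun borel_hierarchy.
From mathcomp Require Import ring lra zify.
Set Implicit Arguments.
Unset Strict Implicit.
Unset Printing Implicit Defensive.
Import Order.TTheory GRing.Theory Num.Theory.
Import numFieldNormedType.Exports.
Local Open Scope classical_set_scope.
Local Open Scope ring_scope.


(** * Square-integrable functions *)

Section SquareIntegrable.
Context (d : measure_display) (T : measurableType d) (R : realType)
  (mu : {measure set T -> \bar R}) (D : set T) (mD : measurable D).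
Implicit Types f g h : T -> R.

Definition sqint f :=
  measurable_fun D f /\ mu.-integrable D (fun x => (f x ^+ 2)%:E).

Definition ip f g : R := \int[mu]_(x in D) (f x * g x).

Lemma sqint_mul f g : sqint f -> sqint g ->
  mu.-integrable D (EFin \o (fun x => f x * g x)).
Proof.
move=> [mf If] [mg Ig].
apply: (le_integrable mD (f := EFin \o (fun x => f x * g x))
  (g := (fun x => (f x ^+ 2)%:E) \+ (fun x => (g x ^+ 2)%:E))) => //.
- by apply/measurable_EFinP; exact: measurable_funM.
- move=> x Dx /=; rewrite lee_fin (ger0_norm (addr_ge0 (sqr_ge0 _) (sqr_ge0 _))).
  rewrite ler_norml; apply/andP; split; nra.
- exact: integrableD.
Qed.

Lemma sqint_scale (a : R) f : sqint f -> sqint (fun x => a * f x).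
Proof.
move=> [mf If]; split; first exact: measurable_funM.
rewrite (_ : (fun x => _) = (fun x => (a ^+ 2)%:E * (f x ^+ 2)%:E)%E).
  exact: integrableZl.
by apply/funext => x; rewrite -EFinM exprMn.
Qed.

Lemma sqint_opp f : sqint f -> sqint (fun x => - f x).
Proof.
by move=> /(sqint_scale (-1)); under eq_fun do rewrite mulN1r.
Qed.

Lemma sqint_add f g : sqint f -> sqint g -> sqint (fun x => f x + g x).
Proof.
move=> sf sg; split; first by apply: measurable_funD; [apply sf.1 | apply sg.1].
rewrite (_ : (fun x => _) =
  ((fun x => (f x ^+ 2)%:E) \+ ((fun x => 2%:E * (f x * g x)%:E) \+
   (fun x => (g x ^+ 2)%:E)))%E); last first.
  by apply/funext => x /=; rewrite -EFinM -!EFinD; congr EFin; ring.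
apply: integrableD => //; first exact: sf.2.
apply: integrableD => //; last exact: sg.2.
by apply: integrableZl => //; exact: sqint_mul.
Qed.

Lemma sqint_sub f g : sqint f -> sqint g -> sqint (fun x => f x - g x).
Proof. by move=> sf sg; apply: sqint_add => //; exact: sqint_opp. Qed.

Lemma sqint0 : sqint (fun=> 0).
Proof.
split; first exact: measurable_cst.
by under eq_fun do rewrite expr0n /=; exact: integrable0.
Qed.

Lemma sqint_sum (I : Type) (s : seq I) (F : I -> T -> R) :
  (forall i, sqint (F i)) -> sqint (fun x => \sum_(i <- s) F i x).
Proof.
move=> sF; elim: s => [|i s IH].
  by under eq_fun do rewrite big_nil; exact: sqint0.
by under eq_fun do rewrite big_cons; exact: sqint_add.
Qed.

Lemma sqint_mul_bounded_ae f g C : sqint f -> measurable_fun D g ->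
  {ae mu, forall x, D x -> `|g x| <= C} ->
  sqint (fun x => f x * g x) /\
  ip (fun x => f x * g x) (fun x => f x * g x) <= C ^+ 2 * ip f f.
Proof.
move=> [mf If] mg gC.
have mfg : measurable_fun D (fun x => f x * g x) by exact: measurable_funM.
have le_int : (\int[mu]_(x in D) ((f x * g x) ^+ 2)%:E <=
    \int[mu]_(x in D) ((C ^+ 2)%:E * (f x ^+ 2)%:E))%E.
  apply: ae_ge0_le_integral => //.
  - by move=> x _; rewrite lee_fin sqr_ge0.
  - by apply/measurable_EFinP; exact: measurable_funX.
  - by move=> x _; rewrite -EFinM lee_fin mulr_ge0 ?sqr_ge0.
  - under eq_fun do rewrite -EFinM.
    apply/measurable_EFinP; apply: measurable_funM => //.
    exact: measurable_funX.
  - apply: filterS gC => x gC Dx; rewrite -EFinM lee_fin exprMn mulrC.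
    rewrite ler_wpM2r ?sqr_ge0// -(real_normK (num_real (g x))).
    by rewrite lerXn2r ?nnegrE ?(le_trans _ (gC Dx))// gC.
have IC : mu.-integrable D (fun x => ((C ^+ 2)%:E * (f x ^+ 2)%:E)%E).
  exact: integrableZl.
have Ifg : mu.-integrable D (fun x => ((f x * g x) ^+ 2)%:E).
  apply/integrableP; split.
    by apply/measurable_EFinP; exact: measurable_funX.
  under eq_integral do rewrite abse_EFin ger0_norm ?sqr_ge0//.
  apply: (le_lt_trans le_int).
  move/integrableP: IC => [_]; apply: le_lt_trans.
  by apply: ge0_le_integral => //;
   [move=> x _; rewrite -EFinM lee_fin mulr_ge0 ?sqr_ge0
   | under eq_fun do rewrite -EFinM; apply/measurable_EFinP;
     apply: measurable_funM => //; exact: measurable_funX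
   | apply: measurableT_comp => //; under eq_fun do rewrite -EFinM;
     apply/measurable_EFinP;
     apply: measurable_funM => //; exact: measurable_funX
   | move=> x _; exact: lee_abs].
split=> //.
rewrite /ip -RintegralZl//.
rewrite /Rintegral; apply: fine_le.
- by apply: integrable_fin_num => //; apply: (eq_integrable mD _ _ _ Ifg) => // x _ /=; rewrite expr2.
- apply: integrable_fin_num => //; apply: (eq_integrable mD _ _ _ IC).
- under eq_integral do rewrite -expr2.
  under [leRHS]eq_integral do rewrite -[_ * f _]expr2 EFinM.
  exact: le_int.
Qed.

Lemma sqint_mul_bounded f g C : sqint f -> measurable_fun D g ->
  (forall x, D x -> `|g x| <= C) -> sqint (fun x => f x * g x).
Proof.
move=> sf mg gC; apply: (@sqint_mul_bounded_ae f g C sf mg _).1.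
by apply: aeW => x; exact: gC.
Qed.

Lemma ipC f g : ip f g = ip g f.
Proof. by apply: eq_Rintegral => x _; rewrite mulrC. Qed.

Lemma eq_ip f g f' g' : {in D, f =1 f'} -> {in D, g =1 g'} -> ip f g = ip f' g'.
Proof. by move=> ff gg; apply: eq_Rintegral => x Dx; rewrite ff// gg. Qed.

Lemma ipDl f g h : sqint f -> sqint g -> sqint h ->
  ip (fun x => f x + g x) h = ip f h + ip g h.
Proof.
move=> sf sg sh; rewrite /ip; under eq_Rintegral do rewrite mulrDl.
by rewrite RintegralD//; exact: sqint_mul.
Qed.

Lemma ipZl (a : R) f h : sqint f -> sqint h ->
  ip (fun x => a * f x) h = a * ip f h.
Proof.
move=> sf sh; rewrite /ip; under eq_Rintegral do rewrite -mulrA.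
by rewrite RintegralZl//; exact: sqint_mul.
Qed.

Lemma ipNl f h : sqint f -> sqint h -> ip (fun x => - f x) h = - ip f h.
Proof.
by move=> sf sh; under eq_fun do rewrite -mulN1r; rewrite ipZl// mulN1r.
Qed.

Lemma ipBl f g h : sqint f -> sqint g -> sqint h ->
  ip (fun x => f x - g x) h = ip f h - ip g h.
Proof. by move=> *; rewrite ipDl ?ipNl//; exact: sqint_opp. Qed.

Lemma ip0l h : ip (fun=> 0) h = 0.
Proof. by rewrite /ip; under eq_Rintegral do rewrite mul0r; rewrite Rintegral_cst// mul0r. Qed.

Lemma ip_suml (I : Type) (s : seq I) (F : I -> T -> R) h :
  (forall i, sqint (F i)) -> sqint h ->
  ip (fun x => \sum_(i <- s) F i x) h = \sum_(i <- s) ip (F i) h.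
Proof.
move=> sF sh; elim: s => [|i s IH].
  by rewrite big_nil; under eq_fun do rewrite big_nil; rewrite ip0l.
under eq_fun do rewrite big_cons.
by rewrite ipDl ?big_cons ?IH//; exact: sqint_sum.
Qed.

Lemma ip_ge0 f : 0 <= ip f f.
Proof. by apply: Rintegral_ge0 => x _; rewrite -expr2 sqr_ge0. Qed.

Lemma ipDD f g : sqint f -> sqint g ->
  ip (fun x => f x + g x) (fun x => f x + g x) = ip f f + 2 * ip f g + ip g g.
Proof.
move=> sf sg; have sfg := sqint_add sf sg.
rewrite ipDl// (ipC f (fun x => _ + _)) (ipC g (fun x => _ + _)) !ipDl// (ipC g f); ring.
Qed.

Lemma ipBB f g : sqint f -> sqint g ->
  ip (fun x => f x - g x) (fun x => f x - g x) = ip f f - 2 * ip f g + ip g g.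
Proof.
move=> sf sg; have sg' := sqint_opp sg.
rewrite (ipDD sf sg') (ipC f (fun x => - g x)) !ipNl//.
rewrite (ipC g (fun x => - g x)) ipNl// (ipC g f); ring.
Qed.

Lemma ipDD_le f g : sqint f -> sqint g ->
  ip (fun x => f x + g x) (fun x => f x + g x) <= 2 * ip f f + 2 * ip g g.
Proof.
move=> sf sg; have := ip_ge0 (fun x => f x - g x).
rewrite ipBB// ipDD//; lra.
Qed.

Lemma ip_sum_le (I : Type) (s : seq I) (F : I -> T -> R) :
  (forall i, sqint (F i)) ->
  ip (fun x => \sum_(i <- s) F i x) (fun x => \sum_(i <- s) F i x) <=
  2 ^+ size s * \sum_(i <- s) ip (F i) (F i).
Proof.
move=> sF; elim: s => [|i s IH].
  by under eq_fun do rewrite big_nil; rewrite ip0l big_nil mulr0.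
under eq_fun do rewrite big_cons.
have := ipDD_le (sF i) (sqint_sum s sF) => /le_trans; apply.
rewrite big_cons /= exprS -mulrA mulrDr mulrDr lerD// ?ler_pM2l//.
by rewrite ler_peMl ?ip_ge0// exprn_ege1// ler1n.
Qed.

Lemma cauchy_schwarz f g : sqint f -> sqint g ->
  ip f g ^+ 2 <= ip f f * ip g g.
Proof.
move=> sf sg.
have P t : 0 <= ip f f - 2 * t * ip f g + t ^+ 2 * ip g g.
  have := ip_ge0 (fun x => f x - t * g x).
  rewrite ipBB//; last exact: sqint_scale.
  rewrite (ipC f (fun x => t * g x)) ipZl// (ipC g f) ipZl//; last exact: sqint_scale.
  rewrite (ipC g (fun x => t * g x)) ipZl//.
  by move=> H; apply: (le_trans H); rewrite le_eqVlt; apply/orP; left; apply/eqP; ring.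
have [g0|g0] := eqVneq (ip g g) 0.
  rewrite g0 mulr0.
  have [->|fg0] := eqVneq (ip f g) 0; first by rewrite expr0n.
  have := P ((ip f f + 1) / ip f g); rewrite g0 mulr0 addr0.
  rewrite -mulrA mulfVK//; have := ip_ge0 f; lra.
have gp : 0 < ip g g by rewrite lt0r g0 ip_ge0.
have := P (ip f g / ip g g).
rewrite (_ : _ + _ = ip f f - ip f g ^+ 2 / ip g g); last by field.
by rewrite subr_ge0 ler_pdivrMr.
Qed.

Lemma norm_ip_le f g : sqint f -> sqint g ->
  `|ip f g| <= Num.sqrt (ip f f) * Num.sqrt (ip g g).
Proof.
move=> sf sg; rewrite -sqrtrM ?ip_ge0// -sqrtr_sqr ler_wsqrtr//.
exact: cauchy_schwarz.
Qed.

Lemma ae_eq0_ip f : sqint f -> ip f f = 0 -> {ae mu, forall x, D x -> f x = 0}.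
Proof.
move=> [mf If] f0.
have /(ae_eq_integral_abs mu mD) H : measurable_fun D (fun x => (f x ^+ 2)%:E).
  by apply/measurable_EFinP; exact: measurable_funX.
have : (\int[mu]_(x in D) `|(f x ^+ 2)%:E| = 0)%E.
  under eq_integral do rewrite abse_EFin ger0_norm ?sqr_ge0//.
  rewrite -(fineK (integrable_fin_num mD If)).
  by move: f0; rewrite /ip /Rintegral; under eq_integral do rewrite -expr2; move=> ->.
move=> /H; apply: filterS => x /= fx Dx; move: (fx Dx) => [] /eqP.
by rewrite expf_eq0 => /andP[_ /eqP].
Qed.

Lemma eq_ae_Rintegral f g : measurable_fun D f -> measurable_fun D g ->
  {ae mu, forall x, D x -> f x = g x} ->
  \int[mu]_(x in D) f x = \int[mu]_(x in D) g x.
Proof.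
move=> mf mg fg; congr fine; apply: ae_eq_integral => //.
- exact/measurable_EFinP.
- exact/measurable_EFinP.
- by apply: filterS fg => x fg Dx /=; rewrite fg.
Qed.

Hypothesis fin : (mu D < +oo)%E.

Lemma integrable_bounded f C : measurable_fun D f ->
  (forall x, D x -> `|f x| <= C) -> mu.-integrable D (EFin \o f).
Proof.
move=> mf fC; apply: measurable_bounded_integrable => //.
by exists C; split; [exact: num_real | move=> y Cy x Dx; apply: le_trans (fC x Dx) (ltW Cy)].
Qed.

Lemma sqint_bounded f C : measurable_fun D f ->
  (forall x, D x -> `|f x| <= C) -> sqint f.
Proof.
move=> mf fC; split=> //; apply: (@integrable_bounded (fun x => f x ^+ 2) (C ^+ 2)).
  exact: measurable_funX.
move=> x Dx; rewrite normrX lerXn2r ?nnegrE ?(le_trans _ (fC x Dx))//.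
Qed.

Lemma sqint_cst (c : R) : sqint (fun=> c).
Proof. by apply: (@sqint_bounded _ `|c|). Qed.

Lemma sqint_integrable f : sqint f -> mu.-integrable D (EFin \o f).
Proof.
move=> sf; have := sqint_mul sf (sqint_cst 1).
by under [X in EFin \o X]eq_fun do rewrite mulr1.
Qed.

End SquareIntegrable.

(** * Integrals over products *)

Section ProductSigmaFinite.
Context d1 d2 (T1 : measurableType d1) (T2 : measurableType d2) (R : realType)
  (m1 : {sigma_finite_measure set T1 -> \bar R})
  (m2 : {sigma_finite_measure set T2 -> \bar R}).

Lemma product_sigma_finite : sigma_finite setT (m1 \x m2)%E.
Proof.
have /sigma_finiteP[F [TF ndF Foo]] := sigma_finiteT m1.
have /sigma_finiteP[G [TG ndG Goo]] := sigma_finiteT m2.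
exists (fun n => F n `*` G n).
 rewrite -setXTT TF TG predeqE => -[x y]; split.
    move=> [/= [n _ Fnx] [k _ Gky]]; exists (maxn n k) => //; split.
    - by move: x Fnx; exact/subsetPset/ndF/leq_maxl.
    - by move: y Gky; exact/subsetPset/ndG/leq_maxr.
  by move=> [n _ []/= ? ?]; split; exists n.
move=> k; have [? ?] := Foo k; have [? ?] := Goo k.
split; first exact: measurableX.
by rewrite product_measure1E// lte_mul_pinfty// ge0_fin_numE.
Qed.

Definition product_sfm : {sigma_finite_measure set (T1 * T2)%type -> \bar R} :=
  HB.pack (m1 \x m2)%E
   (Measure_isSigmaFinite.Build _ _ _ (m1 \x m2)%E product_sigma_finite).
End ProductSigmaFinite.

Section ProductIntegral.
Context (d1 d2 : measure_display) (T1 : measurableType d1)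
  (T2 : measurableType d2) (R : realType).
Variables (m1 : {sigma_finite_measure set T1 -> \bar R})
  (m2 : {sigma_finite_measure set T2 -> \bar R})
  (D1 : set T1) (D2 : set T2).
Hypotheses (mD1 : measurable D1) (mD2 : measurable D2).
Implicit Types (f : T1 -> R) (g : T2 -> R).

Lemma measurable_fun_mul2 f g : measurable_fun D1 f -> measurable_fun D2 g ->
  measurable_fun (D1 `*` D2) (fun x => f x.1 * g x.2).
Proof.
move=> mf mg; apply: measurable_funM.
- apply: (measurable_comp mD1 (f := f) (g := fst)) => //.
    by move=> _ [[x y] [Dx _] <-].
  exact: measurable_funTS.
- apply: (measurable_comp mD2 (f := g) (g := snd)) => //.
    by move=> _ [[x y] [_ Dy] <-].
  exact: measurable_funTS.
Qed.

Lemma restrict_mul2 f g :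
  (fun x => f x.1 * g x.2) \_ (D1 `*` D2) =
  (fun x : T1 * T2 => (f \_ D1) x.1 * (g \_ D2) x.2).
Proof.
apply/funext => -[x y]; rewrite /patch in_setX /=.
by case: ifPn => [/andP[-> ->]//|]; rewrite negb_and => /orP[] /negbTE ->;
  rewrite ?mul0r ?mulr0.
Qed.

Lemma integrable_mul2 f g : m1.-integrable D1 (EFin \o f) ->
  m2.-integrable D2 (EFin \o g) ->
  (m1 \x m2)%E.-integrable (D1 `*` D2) (EFin \o (fun x => f x.1 * g x.2)).
Proof.
move=> If Ig; have mD12 := measurableX mD1 mD2.
have mf : measurable_fun D1 f by apply/measurable_EFinP; case/integrableP: If.
have mg : measurable_fun D2 g by apply/measurable_EFinP; case/integrableP: Ig.
apply/(integrable_mkcond _ mD12); rewrite restrict_EFin restrict_mul2.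
apply/integrable12ltyP.
  apply/measurable_EFinP; apply: measurable_funM.
    by apply: measurableT_comp => //; exact/(measurable_restrictT _ mD1).
  by apply: measurableT_comp => //; exact/(measurable_restrictT _ mD2).
under eq_integral => x _.
  under eq_integral do rewrite /= normrM EFinM.
  rewrite ge0_integralZl//; last first.
    apply/measurable_EFinP/measurableT_comp => //.
    exact/(measurable_restrictT _ mD2).
  over.
have /integrableP[_ g_lty] : m2.-integrable setT (EFin \o (g \_ D2)).
  by rewrite -restrict_EFin; exact/(integrable_mkcond _ mD2).
have /integrableP[_ f_lty] : m1.-integrable setT (EFin \o (f \_ D1)).
  by rewrite -restrict_EFin; exact/(integrable_mkcond _ mD1).
rewrite ge0_integralZr//; last exact: integral_ge0.
  rewrite lte_mul_pinfty//; first exact: integral_ge0.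
  by rewrite ge0_fin_numE//; exact: integral_ge0.
apply/measurable_EFinP/measurableT_comp => //.
exact/(measurable_restrictT _ mD1).
Qed.

Lemma Rintegral_mul2 f g : m1.-integrable D1 (EFin \o f) ->
  m2.-integrable D2 (EFin \o g) ->
  \int[(m1 \x m2)%E]_(x in D1 `*` D2) (f x.1 * g x.2) =
  (\int[m1]_(x in D1) f x) * (\int[m2]_(y in D2) g y).
Proof.
move=> If Ig; have mD12 := measurableX mD1 mD2.
have := integrable_mul2 If Ig.
move=> /(integrable_mkcond _ mD12); rewrite restrict_EFin restrict_mul2 => Ifg.
have Ig' : m2.-integrable setT (EFin \o (g \_ D2)).
  by rewrite -restrict_EFin; exact/(integrable_mkcond _ mD2).
have If' : m1.-integrable setT (EFin \o (f \_ D1)).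
  by rewrite -restrict_EFin; exact/(integrable_mkcond _ mD1).
rewrite Rintegral_mkcond restrict_mul2 {1}/Rintegral.
rewrite -(integral12_prod_meas1 Ifg) /fubini_F /=.
under eq_integral => x _.
  under eq_integral do rewrite /= EFinM.
  rewrite integralZl// -(fineK (integrable_fin_num measurableT Ig')) muleC.
  over.
rewrite integralZl// fineM//; last exact: (integrable_fin_num measurableT If').
by rewrite mulrC (Rintegral_mkcond _ D1) (Rintegral_mkcond _ D2).
Qed.

End ProductIntegral.

(** * Calculus of smooth functions *)

Section Smooth.
Context {R : realType}.

Lemma smooth_coind (V : normedModType R) (S : (V -> R) -> Prop) :
  (forall f, S f -> forall x, differentiable f x) ->
  (forall f v, S f -> S (fun y => 'D_v f y)) ->
  forall f, S f -> smooth f.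
Proof.
move=> Sd SD f Sf s x; apply: Sd.
by elim: s => //= v s IH; exact: SD.
Qed.

Lemma smooth_differentiable (V : normedModType R) (f : V -> R) x :
  smooth f -> differentiable f x.
Proof. by move=> /(_ [::] x). Qed.

Lemma smooth_derivable (V : normedModType R) (f : V -> R) x v :
  smooth f -> derivable f x v.
Proof. by move=> /(smooth_differentiable x) /diff_derivable. Qed.

Lemma smooth_continuous (V : normedModType R) (f : V -> R) :
  smooth f -> continuous f.
Proof. by move=> sf x; exact/differentiable_continuous/smooth_differentiable. Qed.

Lemma smooth_derive (V : normedModType R) (f : V -> R) v :
  smooth f -> smooth (fun y => 'D_v f y).
Proof.
by move=> sf s x; have := sf (rcons s v) x; rewrite foldr_rcons.
Qed.

Lemma smooth_cst (V : normedModType R) (c : R) : smooth (fun _ : V => c).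
Proof.
apply: (@smooth_coind _ (fun f => exists c, f = (fun=> c))); last by exists c.
  by move=> _ [a ->] x; exact: differentiable_cst.
move=> _ v [a ->]; exists 0; apply/funext => x.
by rewrite (_ : (fun=> a) = cst a)// derive_cst.
Qed.

Lemma smooth_add (V : normedModType R) (f g : V -> R) :
  smooth f -> smooth g -> smooth (fun x => f x + g x).
Proof.
move=> sf sg; apply: (@smooth_coind _ (fun h => exists f g,
  [/\ smooth f, smooth g & h = (fun x => f x + g x)])); last by exists f, g.
  move=> _ [{sf sg}f [{}g [sf sg ->]]] x.
  by apply: differentiableD; exact: smooth_differentiable.
move=> _ v [{sf sg}f [{}g [sf sg ->]]].
exists (fun y => 'D_v f y), (fun y => 'D_v g y).
split; [exact: smooth_derive|exact: smooth_derive|].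
apply/funext => x; rewrite (_ : (fun x => _) = f + g)//.
by rewrite deriveD//; exact: smooth_derivable.
Qed.

(** By the Leibniz rule, the finite sums of products of smooth functions are
    stable under differentiation. *)
Inductive sum_of_products (V : normedModType R) : (V -> R) -> Prop :=
| sop_mul f g : smooth f -> smooth g -> sum_of_products (fun x => f x * g x)
| sop_add h k : sum_of_products h -> sum_of_products k ->
    sum_of_products (fun x => h x + k x).

Lemma smooth_mul (V : normedModType R) (f g : V -> R) :
  smooth f -> smooth g -> smooth (fun x => f x * g x).
Proof.
have sop_diff h : sum_of_products h -> forall x : V, differentiable h x.
  move=> Sh; elim: Sh => {h} [f' g' sf sg x|h k _ IHh _ IHk x].
    by apply: differentiableM; exact: smooth_differentiable.
  exact: differentiableD.
move=> sf sg; apply: (@smooth_coind _ (@sum_of_products V)) => //; last exact: sop_mul.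
move=> h v Sh; elim: Sh => {h} [f' g' sf' sg'|h k Sh IHh Sk IHk].
  rewrite (_ : (fun y => _) = (fun x => f' x * 'D_v g' x + g' x * 'D_v f' x)).
    by apply: sop_add; apply: sop_mul => //; exact: smooth_derive.
  apply/funext => x; rewrite (_ : (fun x => _) = f' * g')//.
  by rewrite deriveM//; exact: smooth_derivable.
rewrite (_ : (fun y => _) = (fun x => 'D_v h x + 'D_v k x)); first exact: sop_add.
apply/funext => x; rewrite (_ : (fun x => _) = h + k)//.
by rewrite deriveD//; apply: diff_derivable; exact: sop_diff.
Qed.

Lemma smooth_scale (V : normedModType R) (c : R) (f : V -> R) :
  smooth f -> smooth (fun x => c * f x).
Proof. by move=> sf; apply: smooth_mul => //; exact: smooth_cst. Qed.

Lemma smooth_sum (V : normedModType R) (I : Type) (s : seq I) (F : I -> V -> R) :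
  (forall i, smooth (F i)) -> smooth (fun x => \sum_(i <- s) F i x).
Proof.
move=> sF; elim: s => [|i s IH].
  by under eq_fun do rewrite big_nil; exact: smooth_cst.
by under eq_fun do rewrite big_cons; exact: smooth_add.
Qed.

Lemma derive_comp_linear (U V : normedModType R) (L : {linear U -> V})
  (f : V -> R) v x : 'D_v (fun y => f (L y)) x = 'D_(L v) f (L x).
Proof.
rewrite /derive; set F := (X in lim (X @ _)); set G := (X in _ = lim (X @ _)).
suff -> : F = G by [].
by apply/funext => h; rewrite /F /G /= linearP.
Qed.

Lemma smooth_comp_linear (U V : normedModType R) (L : {linear U -> V})
  (f : V -> R) : continuous L -> smooth f -> smooth (fun x => f (L x)).
Proof.
move=> cL sf; apply: (@smooth_coind _ (fun h => exists2 f, smooth f &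
  h = (fun x => f (L x)))); last by exists f.
  move=> _ [{sf}f sf ->] x; apply: (@differentiable_comp _ _ _ _ L f).
    exact: linear_differentiable.
  exact: smooth_differentiable.
move=> _ v [{sf}f sf ->]; exists (fun y => 'D_(L v) f y); first exact: smooth_derive.
by apply/funext => x; exact: derive_comp_linear.
Qed.

Lemma smooth_fst (U V : normedModType R) (f : U -> R) :
  smooth f -> smooth (fun x : U * V => f x.1).
Proof. by apply: (@smooth_comp_linear _ _ (fst : {linear (U * V)%type -> U})) => x; exact: cvg_fst. Qed.

Lemma smooth_snd (U V : normedModType R) (f : V -> R) :
  smooth f -> smooth (fun x : U * V => f x.2).
Proof. by apply: (@smooth_comp_linear _ _ (snd : {linear (U * V)%type -> V})) => x; exact: cvg_snd. Qed.

Lemma derive_fst (U V : normedModType R) (f : U -> R) v x :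
  'D_v (fun y : U * V => f y.1) x = 'D_(v.1) f x.1.
Proof. exact: (derive_comp_linear (fst : {linear (U * V)%type -> U})). Qed.

Lemma derive_snd (U V : normedModType R) (f : V -> R) v x :
  'D_v (fun y : U * V => f y.2) x = 'D_(v.2) f x.2.
Proof. exact: (derive_comp_linear (snd : {linear (U * V)%type -> V})). Qed.

Lemma smooth_primitive (f f' : R -> R) : (forall x : R, is_derive x (1 : R) f (f' x)) ->
  smooth f' -> smooth f.
Proof.
move=> df sf'; have fE v : (fun y => 'D_v f y) = (fun y => v * f' y).
  apply/funext => y; have dfy : differentiable f y.
    by apply/derivable1_diffP; have [] := df y.
  have vE : 'd f y v = v * 'd f y 1.
    by rewrite -[in LHS](mulr1 v) -[v * 1]/(v *: (1 : R)) linearZ.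
  by rewrite deriveE// vE -deriveE//; have [_ ->] := df y.
apply: (@smooth_coind _ (fun h => h = f \/ smooth h)); last by left.
  move=> h [->|sh] x; last exact: smooth_differentiable.
  by apply/derivable1_diffP; have [] := df x.
move=> h v [->|sh]; right; last exact: smooth_derive.
by rewrite fE; exact: smooth_scale.
Qed.

Lemma eq_derive_dir (V : normedModType R) (f : V -> R) x :
  differentiable f x -> forall v w, 'D_(v + w) f x = 'D_v f x + 'D_w f x.
Proof. by move=> df v w; rewrite !deriveE// linearD. Qed.

End Smooth.

(** * The Hartley basis *)

Section Cas.
Context {R : realType}.
Implicit Types (n m : int) (x : R).

(** The real trigonometric system in the form cas(nx) = cos(nx) + sin(nx), with
    n ranging over all integers: every element has the same norm, and
    differentiation amounts to n times the change of n into -n. *)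
Definition cas n x : R := cos (n%:~R * x) + sin (n%:~R * x).

Lemma is_derive_cas n x : is_derive x (1 : R) (cas n) (n%:~R * cas (- n) x).
Proof.
have dl : is_derive x (1 : R) (fun y => n%:~R * y) (n%:~R : R).
  by apply: is_derive_eq; exact: mulr1.
have dc : is_derive x (1 : R) (fun y => cos (n%:~R * y)) (- sin (n%:~R * x) * n%:~R).
  exact: (@is_derive1_comp _ cos (fun y => n%:~R * y)).
have ds : is_derive x (1 : R) (fun y => sin (n%:~R * y)) (cos (n%:~R * x) * n%:~R).
  exact: (@is_derive1_comp _ sin (fun y => n%:~R * y)).
rewrite (_ : cas n = (fun y => cos (n%:~R * y)) + (fun y => sin (n%:~R * y)))//.
apply: is_derive_eq; rewrite /cas mulrNz (mulNr n%:~R x) cosN sinN; ring.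
Qed.

Lemma smooth_cas n : smooth (cas n).
Proof.
apply: (@smooth_coind _ _ (fun f => exists a b : R,
  f = (fun x => a * cas n x + b * cas (- n) x))).
- move=> _ [a [b ->]] x; apply/derivable1_diffP.
  have := is_derive_cas n x; have := is_derive_cas (- n) x => d1 d2.
  by apply: derivableD; apply: derivableM.
- move=> _ v [a [b ->]]; exists (- (v * b * n%:~R)), (v * a * n%:~R).
  apply/funext => x.
  have := is_derive_cas n x; have := is_derive_cas (- n) x => d1 d2.
  have dab : is_derive x (1 : R) (fun x => a * cas n x + b * cas (- n) x)
     (a * (n%:~R * cas (- n) x) + b * ((- n)%:~R * cas n x)).
    by apply: is_derive_eq; rewrite opprK.
  rewrite deriveE; last by apply/derivable1_diffP.
  have -> : v = v *: (1 : R) by rewrite [RHS]mulr1.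
  rewrite linearZ /= -deriveE; last by apply/derivable1_diffP.
  by have [_ ->] := dab; rewrite mulrNz /GRing.scale /= mulr1; ring.
- by exists 1, 0; apply/funext => x; rewrite mul1r mul0r addr0.
Qed.

Lemma continuous_cas n : continuous (cas n).
Proof. exact/smooth_continuous/smooth_cas. Qed.

Lemma measurable_cas n (D : set R) : measurable_fun D (cas n).
Proof.
by apply: measurable_funTS; apply: continuous_measurable_fun; exact: continuous_cas.
Qed.

Lemma norm_cas_le2 n x : `|cas n x| <= 2.
Proof.
by rewrite (le_trans (ler_normD _ _))// (_ : 2 = 1 + 1)// lerD// ?cos_max// sin_max.
Qed.

Lemma cos_sin_nat2pi (n : nat) : cos (n%:R * (2 * pi)) = 1 :> R /\
  sin (n%:R * (2 * pi)) = 0 :> R.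
Proof.
elim: n => [|n [IHc IHs]]; first by rewrite mul0r cos0 sin0.
rewrite -natr1 mulrDl mul1r cosD sinD IHc IHs.
by rewrite (_ : 2 * pi = pi *+ 2) ?cos2pi ?sin2pi ?mulr_natl//; split; ring.
Qed.

Lemma cas_periodic n x : cas n (x + 2 * pi) = cas n x.
Proof.
have [c s] : cos (n%:~R * (2 * pi)) = 1 :> R /\ sin (n%:~R * (2 * pi)) = 0 :> R.
  case: n => n; first exact: cos_sin_nat2pi.
  rewrite NegzE mulrNz mulNr cosN sinN; have [] := cos_sin_nat2pi n.+1.
  by move=> -> ->; rewrite oppr0.
by rewrite /cas mulrDr cosD sinD c s; ring.
Qed.

Lemma cas_mul n m x : cas n x * cas m x =
  2^-1 * (cas (n - m) x + cas (m - n) x + cas (n + m) x - cas (- (n + m)) x).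
Proof.
rewrite /cas !(intrD, mulrNz) !(mulNr, mulrDl) !(cosD, sinD, cosN, sinN).
by field.
Qed.

Lemma lebesgue_period_lty : (@lebesgue_measure R [set` `[0%R, (2 * pi)%R]%R] < +oo)%E.
Proof.
rewrite lebesgue_measure_itv /= lte_fin mulr_gt0 ?pi_gt0//.
by rewrite -EFinB ltry.
Qed.

Lemma integrable_cas n :
  (@lebesgue_measure R).-integrable `[0, 2 * pi] (EFin \o cas n).
Proof.
apply: (integrable_bounded _ lebesgue_period_lty (C := 2)) => //.
- exact: measurable_cas.
- by move=> x _; exact: norm_cas_le2.
Qed.

Lemma integral_cas n : \int[lebesgue_measure]_(x in `[0, 2 * pi]) cas n x =
  2 * pi * (n == 0)%:R :> R.
Proof.
have pi2 : 0 < 2 * pi :> R by rewrite mulr_gt0 ?pi_gt0.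
have [->|n0] := eqVneq n 0.
  under eq_Rintegral do rewrite /cas mul0r cos0 sin0 addr0.
  rewrite Rintegral_cst//= lebesgue_measure_itv /= lte_fin pi2.
  by rewrite -EFinB /= subr0 mul1r mulr1.
have nR0 : n%:~R != 0 :> R by rewrite intr_eq0.
pose F x := (- n%:~R)^-1 * cas (- n) x.
have dF x : is_derive x (1 : R) F (cas n x).
  have d := is_derive_cas (- n) x.
  apply: is_derive_eq; rewrite opprK mulrNz /GRing.scale /= mulrA.
  by rewrite mulVf ?mul1r// oppr_eq0.
have cF : continuous F.
  by move=> x; apply/differentiable_continuous/derivable1_diffP; have [] := dF x.
rewrite /Rintegral (@continuous_FTC2 _ (cas n) F)//.
- have -> : F (2 * pi) = F 0 by rewrite /F -{1}(add0r (2 * pi)) cas_periodic.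
  by rewrite -EFinB /= subrr mulr0.
- exact/continuous_subspaceT/continuous_cas.
- split.
  + by move=> x _; have [] := dF x.
  + by apply: cvg_at_right_filter; exact: cF.
  + by apply: cvg_at_left_filter; exact: cF.
- by move=> x _; rewrite derive1E; have [] := dF x.
Qed.

Lemma integral_cas2 n m :
  \int[lebesgue_measure]_(x in `[0, 2 * pi]) (cas n x * cas m x) =
  2 * pi * (n == m)%:R :> R.
Proof.
under eq_Rintegral do rewrite cas_mul.
have I := integrable_cas.
have I2 : (@lebesgue_measure R).-integrable `[0, 2 * pi]
    (EFin \o (fun x => cas (n - m) x + cas (m - n) x)).
  exact: (integrableD _ (I _) (I _)).
have I3 : (@lebesgue_measure R).-integrable `[0, 2 * pi]
    (EFin \o (fun x => cas (n - m) x + cas (m - n) x + cas (n + m) x)).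
  exact: (integrableD _ I2 (I _)).
have I4 : (@lebesgue_measure R).-integrable `[0, 2 * pi]
    (EFin \o (fun x => cas (n - m) x + cas (m - n) x + cas (n + m) x - cas (- (n + m)) x)).
  exact: (integrableB _ I3 (I _)).
rewrite RintegralZl// RintegralB// RintegralD// RintegralD//.
rewrite !integral_cas oppr_eq0 -(opprB n m) oppr_eq0 subr_eq0; by field.
Qed.

Definition J3 n m l : R :=
  \int[lebesgue_measure]_(x in `[0, 2 * pi]) (cas n x * cas m x * cas l x).

Lemma integral_cas3 n m l : J3 n m l =
  pi * ((n - m == l)%:R + (m - n == l)%:R + (n + m == l)%:R
     - (- (n + m) == l)%:R).
Proof.
have I a : (@lebesgue_measure R).-integrable `[0, 2 * pi] (EFin \o (fun x => cas a x * cas l x)).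
  apply: (integrable_bounded _ lebesgue_period_lty (C := 4)) => //.
  - by apply: measurable_funM; exact: measurable_cas.
  - by move=> x _; rewrite normrM (_ : 4 = 2 * 2) ?ler_pM ?norm_cas_le2// -natrM.
pose c a x : R := cas a x * cas l x.
have I2 : (@lebesgue_measure R).-integrable `[0, 2 * pi]
    (EFin \o (fun x => c (n - m) x + c (m - n) x)).
  exact: (integrableD _ (I _) (I _)).
have I3 : (@lebesgue_measure R).-integrable `[0, 2 * pi]
    (EFin \o (fun x => c (n - m) x + c (m - n) x + c (n + m) x)).
  exact: (integrableD _ I2 (I _)).
have I4 : (@lebesgue_measure R).-integrable `[0, 2 * pi]
    (EFin \o (fun x => c (n - m) x + c (m - n) x + c (n + m) x - c (- (n + m)) x)).
  exact: (integrableB _ I3 (I _)).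
rewrite /J3; transitivity (\int[lebesgue_measure]_(x in `[0, 2 * pi])
    (2^-1 * (c (n - m) x + c (m - n) x + c (n + m) x - c (- (n + m)) x))).
  by apply: eq_Rintegral => x _; rewrite cas_mul /c; ring.
rewrite RintegralZl// (RintegralB _ I3 (I _))// (RintegralD _ I2 (I _))//.
rewrite (RintegralD _ (I _) (I _))// !integral_cas2; by field.
Qed.

End Cas.

(** * The Hartley basis of the torus *)

Section Lattice.

Definition coord (k : int * int * int) (j : 'I_3) : int :=
  match val j with 0%N => k.1.1 | 1%N => k.1.2 | _ => k.2 end.

Definition flip (j : 'I_3) (k : int * int * int) : int * int * int :=
  match val j with
  | 0%N => (- k.1.1, k.1.2, k.2)
  | 1%N => (k.1.1, - k.1.2, k.2)
  | _ => (k.1.1, k.1.2, - k.2)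
  end.

Lemma flipK j : involutive (flip j).
Proof. by case: j => -[|[|[|m]]] Hm [[a b] c]; rewrite /flip /= opprK. Qed.

Lemma coord_flip j k : coord (flip j k) j = - coord k j.
Proof. by case: j => -[|[|[|m]]] Hm. Qed.

Lemma norm_coord_flip i j k : `|coord (flip j k) i| = `|coord k i|.
Proof.
by case: j => -[|[|[|m]]] Hm; case: i => -[|[|[|l]]] Hl //=; rewrite /coord /= normrN.
Qed.

Lemma flipC i j k : flip i (flip j k) = flip j (flip i k).
Proof. by case: j => -[|[|[|m]]] Hm; case: i => -[|[|[|l]]] Hl. Qed.

Definition segment (n : nat) : seq int := [seq i%:Z - n%:Z | i <- iota 0 n.*2.+1].

Definition cube (n : nat) : seq (int * int * int) :=
  [seq (k, c) | k <- [seq (a, b) | a <- segment n, b <- segment n], c <- segment n].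

Lemma mem_segment n a : (a \in segment n) = (`|a| <= n%:Z).
Proof.
apply/mapP/idP => [[i]|]; first by rewrite mem_iota add0n => /= Hi ->; lia.
by move=> Ha; exists (absz (a + n%:Z)%R); [rewrite mem_iota|]; lia.
Qed.

Lemma segment_uniq n : uniq (segment n).
Proof. by rewrite map_inj_uniq ?iota_uniq// => i j /addIr []. Qed.

Lemma mem_cube n k : (k \in cube n) = [forall j, `|coord k j| <= n%:Z].
Proof.
case: k => -[a b] c; apply/idP/forallP => [|H].
  move=> /allpairsP[[ab c'] [Hab Hc]].
  move: Hab => /allpairsP[[a' b'] [Ha Hb ->]] [-> -> ->].
  rewrite mem_segment in Ha; rewrite mem_segment in Hb.
  rewrite mem_segment in Hc.
  by case=> -[|[|[|i]]] Hi.
apply/allpairsP; exists ((a, b), c); split => //; last first.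
  by have := H (inord 2); rewrite mem_segment /coord /= inordK.
apply/allpairsP; exists (a, b); split => //.
  by have := H ord0; rewrite mem_segment.
by have := H (inord 1); rewrite mem_segment /coord /= inordK.
Qed.

Lemma cube_uniq n : uniq (cube n).
Proof.
apply: allpairs_uniq; [|exact: segment_uniq|by move=> [? ?] [? ?]].
by apply: allpairs_uniq; [exact: segment_uniq|exact: segment_uniq|move=> [? ?] [? ?]].
Qed.

Lemma cube_le n m : (n <= m)%N -> {subset cube n <= cube m}.
Proof.
move=> nm k; rewrite !mem_cube => /forallP H; apply/forallP => j.
by rewrite (le_trans (H j))// lez_nat.
Qed.

Lemma flip_cube n j k : (flip j k \in cube n) = (k \in cube n).
Proof. by rewrite !mem_cube; apply: eq_forallb => i; rewrite norm_coord_flip. Qed.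

Lemma in_some_cube k : exists n, k \in cube n.
Proof.
exists (absz k.1.1 + absz k.1.2 + absz k.2)%N; rewrite mem_cube; apply/forallP.
by case=> -[|[|[|m]]] Hm //=; rewrite /coord /=; lia.
Qed.

Lemma big_flip_cube (T : Type) (idx : T) (op : Monoid.com_law idx) n j
  (F : int * int * int -> T) :
  \big[op/idx]_(k <- cube n) F (flip j k) = \big[op/idx]_(k <- cube n) F k.
Proof.
rewrite -(big_map (flip j) xpredT F); apply: perm_big.
apply: uniq_perm; [|exact: cube_uniq|].
  by rewrite map_inj_uniq ?cube_uniq//; exact: (can_inj (flipK j)).
move=> k; apply/mapP/idP => [[l Hl ->]|Hk]; first by rewrite flip_cube.
by exists (flip j k); rewrite ?flip_cube ?flipK.
Qed.

Lemma big_cube (T : Type) (idx : T) (op : Monoid.com_law idx) n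
  (F : int * int * int -> T) :
  \big[op/idx]_(k <- cube n) F k = \big[op/idx]_(a <- segment n)
    \big[op/idx]_(b <- segment n) \big[op/idx]_(c <- segment n) F (a, b, c).
Proof. by rewrite big_allpairs big_allpairs. Qed.

End Lattice.

Section Basis.
Context {R : realType}.
Implicit Types (k : int * int * int) (x : R * R * R).
Local Notation Rm := (measurableTypeR R).
Local Notation leb := (@lebesgue_measure R).

Definition hartley k x : R := cas k.1.1 x.1.1 * cas k.1.2 x.1.2 * cas k.2 x.2.

Definition sqnorm k : R := \sum_(j < 3) (coord k j)%:~R ^+ 2.

Lemma smooth_hartley k : smooth (hartley k).
Proof.
apply: smooth_mul; first apply: smooth_mul.
- by apply: (smooth_fst (f := fun y => cas k.1.1 y.1)); apply: smooth_fst; exact: smooth_cas.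
- by apply: (smooth_fst (f := fun y => cas k.1.2 y.2)); apply: smooth_snd; exact: smooth_cas.
- by apply: smooth_snd; exact: smooth_cas.
Qed.

Lemma derive_cas n v (x : R) : 'D_v (cas n) x = v * (n%:~R * cas (- n) x).
Proof.
have d := is_derive_cas n x.
have df : differentiable (cas n) x by apply/derivable1_diffP.
have -> : 'D_v (cas n) x = v * 'D_1 (cas n) x.
  by rewrite !deriveE// -[in LHS](mulr1 v) -[v * 1]/(v *: (1 : R)) linearZ.
by have [_ ->] := d.
Qed.

Lemma pd_hartley j k : pd j (hartley k) =
  (fun x => (coord k j)%:~R * hartley (flip j k) x).
Proof.
apply/funext => x; rewrite /pd.
pose f1 (y : R * R * R) : R := cas k.1.1 y.1.1.
pose f2 (y : R * R * R) : R := cas k.1.2 y.1.2.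
pose f3 (y : R * R * R) : R := cas k.2 y.2.
have s1 : smooth f1.
  by apply: (smooth_fst (f := fun y => cas k.1.1 y.1)); apply: smooth_fst; exact: smooth_cas.
have s2 : smooth f2.
  by apply: (smooth_fst (f := fun y => cas k.1.2 y.2)); apply: smooth_snd; exact: smooth_cas.
have s3 : smooth f3 by apply: smooth_snd; exact: smooth_cas.
have D1 v : 'D_v f1 x = v.1.1 * (k.1.1%:~R * cas (- k.1.1) x.1.1).
  by rewrite /f1 (derive_fst (fun y => cas k.1.1 y.1)) derive_fst derive_cas.
have D2 v : 'D_v f2 x = v.1.2 * (k.1.2%:~R * cas (- k.1.2) x.1.2).
  by rewrite /f2 (derive_fst (fun y => cas k.1.2 y.2)) derive_snd derive_cas.
have D3 v : 'D_v f3 x = v.2 * (k.2%:~R * cas (- k.2) x.2).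
  by rewrite /f3 derive_snd derive_cas.
rewrite (_ : hartley k = f1 * f2 * f3)//.
rewrite deriveM; [|exact/smooth_derivable/smooth_mul|exact: smooth_derivable].
rewrite deriveM; [|exact: smooth_derivable|exact: smooth_derivable].
rewrite D1 D2 D3 /GRing.scale /= /hartley /f1 /f2 /f3.
have -> : (f1 * f2) x = cas k.1.1 x.1.1 * cas k.1.2 x.1.2 by [].
by case: j => -[|[|[|m]]] Hm //; rewrite /flip /coord /=; ring.
Qed.

Lemma smooth_pd (f : R * R * R -> R) j : smooth f -> smooth (pd j f).
Proof. exact: smooth_derive. Qed.

Lemma pd_scale (c : R) (f : R * R * R -> R) j : smooth f ->
  pd j (fun x => c * f x) = (fun x => c * pd j f x).
Proof.
move=> sf; apply/funext => x; rewrite /pd (_ : (fun x => _) = c *: f)//.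
by rewrite deriveZ//; exact: smooth_derivable.
Qed.

Lemma lap_hartley k : lap (hartley k) = (fun x => - sqnorm k * hartley k x).
Proof.
apply/funext => x; rewrite /lap /sqnorm mulNr mulr_suml -sumrN.
apply: eq_bigr => j _; rewrite pd_hartley pd_scale; last exact: smooth_hartley.
rewrite pd_hartley flipK coord_flip mulrNz; ring.
Qed.

Lemma smooth_periodic_hartley k : smooth_periodic (hartley k).
Proof.
split; first exact: smooth_hartley.
move=> j x; rewrite /hartley /basis_vec.
by case: j => -[|[|[|m]]] Hm //=; rewrite /GRing.scale /= ?mulr0 ?mulr1 ?addr0 ?cas_periodic.
Qed.

Lemma norm_hartley_le8 k x : `|hartley k x| <= 8.
Proof.
rewrite /hartley !normrM (_ : 8 = 2 * 2 * 2); last by rewrite -!natrM.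
by rewrite !ler_pM ?mulr_ge0 ?norm_cas_le2.
Qed.

Lemma measurable_box : measurable (@box R : set (Rm * Rm * Rm)).
Proof. by apply: measurableX => //; exact: measurableX. Qed.

Lemma leb3_box : leb3 (@box R) = ((2 * pi) ^+ 3)%:E.
Proof.
have pi2 : 0 < 2 * pi :> R by rewrite mulr_gt0 ?pi_gt0.
rewrite /leb3 /box product_measure1E//; last exact: measurableX.
rewrite [X in (X * _)%E]product_measure1E//= lebesgue_measure_itv /= lte_fin pi2.
by rewrite oppr0 addr0 -!EFinM; congr EFin; ring.
Qed.

Lemma leb3_box_lty : (leb3 (@box R) < +oo)%E.
Proof. by rewrite leb3_box ltry. Qed.

Lemma measurable_hartley k : measurable_fun (@box R) (hartley k).
Proof.
have m0 : measurable (`[0, 2 * pi] : set R) by [].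
have m2 := measurable_fun_mul2 m0 m0 (@measurable_cas R k.1.1 _) (@measurable_cas R k.1.2 _).
exact: (measurable_fun_mul2 (measurableX m0 m0) m0 m2 (@measurable_cas R k.2 _)).
Qed.

Lemma intT_tensor (f g h : R -> R) :
  (@lebesgue_measure R).-integrable `[0, 2 * pi] (EFin \o f) ->
  (@lebesgue_measure R).-integrable `[0, 2 * pi] (EFin \o g) ->
  (@lebesgue_measure R).-integrable `[0, 2 * pi] (EFin \o h) ->
  intT (fun x => f x.1.1 * g x.1.2 * h x.2) =
  \int[lebesgue_measure]_(x in `[0, 2 * pi]) f x *
  \int[lebesgue_measure]_(x in `[0, 2 * pi]) g x *
  \int[lebesgue_measure]_(x in `[0, 2 * pi]) h x.
Proof.
move=> If Ig Ih; have m0 : measurable (`[0, 2 * pi] : set Rm) by [].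
rewrite -(Rintegral_mul2 m0 m0 If Ig).
have I12 := integrable_mul2 m0 m0 If Ig.
have := @Rintegral_mul2 _ _ _ _ R (product_sfm leb leb) leb _ _ (measurableX m0 m0) m0
  (fun y => f y.1 * g y.2) h I12 Ih.
exact.
Qed.

Lemma intT_hartley2 k l :
  intT (fun x => hartley k x * hartley l x) = (2 * pi) ^+ 3 * (k == l)%:R :> R.
Proof.
have I a b : (@lebesgue_measure R).-integrable `[0, 2 * pi] (EFin \o (fun x : R => cas a x * cas b x)).
  apply: (integrable_bounded _ lebesgue_period_lty (C := 4)) => //.
  - by apply: measurable_funM; exact: measurable_cas.
  - by move=> x _; rewrite normrM (_ : 4 = 2 * 2) ?ler_pM ?norm_cas_le2// -natrM.
transitivity (intT (fun x : R * R * R => (cas k.1.1 x.1.1 * cas l.1.1 x.1.1) *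
   (cas k.1.2 x.1.2 * cas l.1.2 x.1.2) * (cas k.2 x.2 * cas l.2 x.2))).
  by apply: eq_Rintegral => x _; rewrite /hartley; ring.
rewrite (@intT_tensor _ _ _ (I k.1.1 l.1.1) (I k.1.2 l.1.2) (I k.2 l.2)) !integral_cas2.
case: k => -[a b] c; case: l => -[a' b'] c' /=.
rewrite !xpair_eqE /=; do 3 case: (_ == _) => /=; ring.
Qed.

Lemma intT_hartley3 k l m :
  intT (fun x => hartley k x * hartley l x * hartley m x) =
  J3 k.1.1 l.1.1 m.1.1 * J3 k.1.2 l.1.2 m.1.2 * J3 k.2 l.2 m.2 :> R.
Proof.
have I a b c : (@lebesgue_measure R).-integrable `[0, 2 * pi]
    (EFin \o (fun x : R => cas a x * cas b x * cas c x)).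
  apply: (integrable_bounded _ lebesgue_period_lty (C := 8)) => //.
  - by do ![apply: measurable_funM]; exact: measurable_cas.
  - move=> x _; rewrite !normrM (_ : 8 = 2 * 2 * 2); last by rewrite -!natrM.
    by rewrite !ler_pM ?mulr_ge0 ?norm_cas_le2.
rewrite /J3 -(@intT_tensor _ _ _ (I k.1.1 l.1.1 m.1.1) (I k.1.2 l.1.2 m.1.2) (I k.2 l.2 m.2)).
by apply: eq_Rintegral => x _; rewrite /hartley; ring.
Qed.

End Basis.

(** * Density in the space of square-integrable functions *)

Section Span.
Context (T : Type) (R : realType).

Inductive span (B : (T -> R) -> Prop) : (T -> R) -> Prop :=
| span0 : span B (fun=> 0)
| span_add a f g : B f -> span B g -> span B (fun x => a * f x + g x).

Variable B : (T -> R) -> Prop.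

Lemma span_gen f : B f -> span B f.
Proof.
move=> Bf; have := span_add 1 Bf (span0 B).
by under eq_fun do rewrite mul1r addr0.
Qed.

Lemma span_scale a f : span B f -> span B (fun x => a * f x).
Proof.
elim=> [|c h k Bh Sk IH]; first by under eq_fun do rewrite mulr0; exact: span0.
by under eq_fun do rewrite mulrDr mulrA; exact: span_add.
Qed.

Lemma span_lin a b f g : span B f -> span B g -> span B (fun x => a * f x + b * g x).
Proof.
move=> Sf Sg; elim: Sf => [|c h k Bh Sk IH].
  by under eq_fun do rewrite mulr0 add0r; exact: span_scale.
under eq_fun do rewrite mulrDr mulrA -addrA.
exact: span_add.
Qed.

Lemma spanD f g : span B f -> span B g -> span B (fun x => f x + g x).
Proof.
by move=> Sf Sg; have := span_lin 1 1 Sf Sg; under eq_fun do rewrite !mul1r.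
Qed.

End Span.

Section Closure.
Context (d : measure_display) (T : measurableType d) (R : realType)
  (mu : {measure set T -> \bar R}) (D : set T).
Hypotheses (mD : measurable D) (fin : (mu D < +oo)%E).
Implicit Types f g h : T -> R.

Local Notation sq := (sqint mu D).
Local Notation ip := (ip mu D).

Lemma dominated_L2_cvg (f_ : (T -> R)^nat) f g :
  (forall n, measurable_fun D (f_ n)) -> measurable_fun D f -> sq g ->
  (forall n x, D x -> `|f_ n x| <= g x) -> (forall x, D x -> `|f x| <= g x) ->
  {ae mu, forall x, D x -> f_ ^~ x @ \oo --> f x} ->
  (fun n => ip (fun x => f x - f_ n x) (fun x => f x - f_ n x)) @ \oo --> (0 : R).
Proof.
move=> mf_ mf sg f_g fg cf.
have Ig : mu.-integrable D (fun x => (4 * g x ^+ 2)%:E).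
  under eq_fun do rewrite EFinM; apply: integrableZl => //; exact: sg.2.
have mh n : measurable_fun D (fun x => ((f x - f_ n x) * (f x - f_ n x))%:E).
  apply/measurable_EFinP; apply: measurable_funM; exact: measurable_funB.
have hg n x : D x -> `|(f x - f_ n x) * (f x - f_ n x)| <= 4 * g x ^+ 2.
  move=> Dx; rewrite ger0_norm -?expr2 ?sqr_ge0//.
  have := f_g n x Dx; have := fg x Dx; rewrite !ler_norml => /andP[? ?] /andP[? ?]; nra.
have h0 : {ae mu, forall x, D x ->
    (fun n => ((f x - f_ n x) * (f x - f_ n x))%:E) @ \oo --> (0 : \bar R)}.
  apply: filterS cf => x cf Dx; apply: cvg_EFin; first exact: nearW.
  rewrite [X in _ --> X](_ : _ = (f x - f x) * (f x - f x)); last by rewrite subrr mulr0.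
  by apply: cvgM; apply: cvgB; (try exact: cvg_cst); exact: cf.
have [_ _] := dominated_convergence mD mh (measurable_cst _) h0 Ig
  (aeW _ (fun x n Dx => hg n x Dx)).
by rewrite integral0 => /fine_cvg.
Qed.

Variable V : (T -> R) -> Prop.
Hypothesis Vsq : forall p, V p -> sq p.
Hypothesis Vlin : forall a b f g, V f -> V g -> V (fun x => a * f x + b * g x).

Definition L2_closure f := sq f /\ forall e : R, 0 < e ->
  exists2 p, V p & ip (fun x => f x - p x) (fun x => f x - p x) < e.

Lemma closure_in f : V f -> L2_closure f.
Proof.
move=> Vf; split=> [|e e0]; first exact: Vsq.
by exists f => //; under eq_fun do rewrite subrr; rewrite ip0l.
Qed.

(** Up to a factor 2 on squared norms, this is the triangle inequality. *)
Lemma ip_triangle f g h : sq f -> sq g -> sq h ->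
  ip (fun x => f x - h x) (fun x => f x - h x) <=
  2 * ip (fun x => f x - g x) (fun x => f x - g x) +
  2 * ip (fun x => g x - h x) (fun x => g x - h x).
Proof.
move=> sf sg sh.
have := ipDD_le mD (sqint_sub mD sf sg) (sqint_sub mD sg sh).
rewrite (_ : (fun x => _) = (fun x => f x - h x))//.
by apply/funext => x; ring.
Qed.

Lemma closure_closed f : sq f -> (forall e : R, 0 < e ->
  exists2 g, L2_closure g & ip (fun x => f x - g x) (fun x => f x - g x) < e) ->
  L2_closure f.
Proof.
move=> sf fg; split=> // e e0; have [|g [sg gc] fge] := fg (e / 4); first by rewrite divr_gt0.
have [|p Vp gp] := gc (e / 4); first by rewrite divr_gt0.
exists p => //; have := ip_triangle sf sg (Vsq Vp); lra.
Qed.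

Lemma closure_lin a b f g : L2_closure f -> L2_closure g ->
  L2_closure (fun x => a * f x + b * g x).
Proof.
move=> [sf cf] [sg cg]; split=> [|e e0].
  by apply: sqint_add => //; exact: sqint_scale.
pose c := 4 * (a ^+ 2 + b ^+ 2 + 1).
have c0 : 0 < c by rewrite /c; nra.
have [|p Vp fp] := cf (e / c); first by rewrite divr_gt0.
have [|q Vq gq] := cg (e / c); first by rewrite divr_gt0.
exists (fun x => a * p x + b * q x); first exact: Vlin.
have sfp := sqint_sub mD sf (Vsq Vp); have sgq := sqint_sub mD sg (Vsq Vq).
have := ipDD_le mD (sqint_scale mD a sfp) (sqint_scale mD b sgq).
rewrite (_ : (fun x => _) = (fun x => a * f x + b * g x - (a * p x + b * q x))); last first.
  by apply/funext => x; ring.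
rewrite !ipZl//; [|exact: sqint_scale..].
rewrite (ipC _ _ _ (fun x => a * _)) (ipC _ _ _ (fun x => b * _)) !ipZl//.
move=> /le_lt_trans; apply.
move: fp gq; rewrite !ltr_pdivlMr// /c => fp gq.
have := ip_ge0 mu D (fun x => f x - p x); have := ip_ge0 mu D (fun x => g x - q x).
nra.
Qed.

Lemma closure0 f : V f -> L2_closure (fun=> 0).
Proof.
move=> /closure_in cf; have := closure_lin 0 0 cf cf.
by under eq_fun do rewrite !mul0r addr0.
Qed.

Lemma closure_cvg (f_ : (T -> R)^nat) f g : (forall n, L2_closure (f_ n)) ->
  measurable_fun D f -> sq g ->
  (forall n x, D x -> `|f_ n x| <= g x) -> (forall x, D x -> `|f x| <= g x) ->
  {ae mu, forall x, D x -> f_ ^~ x @ \oo --> f x} -> L2_closure f.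
Proof.
move=> cf_ mf sg f_g fg cf.
have sf : sq f.
  split=> //; apply: (le_integrable mD _ _ sg.2).
    by apply/measurable_EFinP; exact: measurable_funX.
  move=> x Dx /=; rewrite lee_fin !ger0_norm ?sqr_ge0// -(real_normK (num_real (f x))).
  by rewrite lerXn2r ?nnegrE ?(le_trans _ (fg x Dx))// fg.
apply: closure_closed => // e e0.
have := @dominated_L2_cvg f_ f g (fun n => (cf_ n).1.1) mf sg f_g fg cf.
move=> /cvgrPdist_lt/(_ e e0) [n _ /(_ n (leqnn n)) /=].
by rewrite sub0r normrN ger0_norm ?ip_ge0// => H; exists (f_ n).
Qed.

Lemma closure_eq f g : {in D, f =1 g} -> L2_closure f -> measurable_fun D g -> L2_closure g.
Proof.
move=> fg [[mf If] cf] mg; split=> [|e e0].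
  split=> //; apply: (eq_integrable mD _ _ _ If) => x Dx; rewrite fg//.
have [p Vp fp] := cf e e0; exists p => //; apply: le_lt_trans fp.
by rewrite le_eqVlt; apply/orP; left; apply/eqP; apply: eq_ip => x Dx; rewrite fg.
Qed.

(** It is enough to approximate the indicator functions of a family of sets
    stable under intersection that generates the sigma-algebra. *)
Lemma indicator_closure_pi (G : set (set T)) :
  @measurable _ T = <<s G >> -> setI_closed G -> L2_closure (\1_setT) ->
  (forall A, G A -> L2_closure (\1_A)) ->
  forall A, measurable A -> L2_closure (\1_A).
Proof.
move=> mG GI c1 cG A; rewrite mG.
apply: (@dynkin_induction _ _ G (fun A => L2_closure (\1_A))) => //.
- move=> S mS cS; have := closure_lin 1 (-1) c1 cS.
  rewrite (_ : (fun x => _) = \1_(~` S))//.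
  by apply/funext => x; rewrite !indicE in_setT in_setC; case: (x \in S) => /=; ring.
- move=> F mF tF cF.
  pose f_ n x : R := \sum_(k < n) \1_(F k) x.
  have f_E n : f_ n = \1_(\bigcup_(k < n) F k).
    apply/funext => x; rewrite /f_ indicE bigcup_mkord.
    elim: n => [|n IH]; first by rewrite !big_ord0 in_set0.
    rewrite !big_ord_recr /= IH in_setU indicE.
    have [xn|//] := boolP (x \in F n); last by rewrite orbF addr0.
    rewrite orbT (_ : x \in _ = false) ?add0r//; apply/negbTE.
    rewrite -bigcup_mkord notin_setE => -[k /= kn Fk].
    move/trivIsetP : tF => /(_ k n Logic.I Logic.I (negbT (ltn_eqF kn))).
    by apply/eqP/set0P; exists x; split => //; exact: set_mem.
  have f01 n x : `|f_ n x| <= 1 by rewrite f_E indicE; case: (_ \in _); rewrite /= ?normr1 ?normr0.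
  apply: (@closure_cvg f_ _ (cst 1)).
  + elim=> [|n IH].
      rewrite (_ : f_ 0%N = (fun=> 0)); last by apply/funext => x; rewrite /f_ big_ord0.
      by have := closure_lin 0 0 c1 c1; under eq_fun do rewrite !mul0r addr0.
    have := closure_lin 1 1 IH (cF n); rewrite (_ : (fun x => _) = f_ n.+1)//.
    by apply/funext => x; rewrite !mul1r /f_ big_ord_recr.
  + by apply: measurable_indic; exact: bigcup_measurable.
  + exact: sqint_cst.
  + by [].
  + by move=> x _; rewrite indicE; case: (_ \in _); rewrite /= ?normr1 ?normr0.
  + apply: aeW => x _; have := @indic_bigcup _ R F x tF => E.
    apply: cvg_near_cst.
    have [xF|xF] := boolP (x \in \bigcup_k F k).
      have [m _ Fm] := set_mem xF; exists m.+1 => //= n mn.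
      rewrite f_E !indicE xF (_ : _ \in _ = true)//.
      by apply/mem_set; exists m.
    apply: nearW => n; rewrite f_E !indicE (negbTE xF).
    case: (boolP (x \in _)) => // /set_mem [k /= _ Fk].
    by move: xF; rewrite notin_setE => []; case; exists k.
Qed.

Lemma closure_sum (I : Type) (s : seq I) (F : I -> T -> R) : L2_closure (fun=> 0) ->
  (forall i, L2_closure (F i)) -> L2_closure (fun x => \sum_(i <- s) F i x).
Proof.
move=> c0 cF; elim: s => [|i s IH]; first by under eq_fun do rewrite big_nil.
under eq_fun do rewrite big_cons.
by have := closure_lin 1 1 (cF i) IH; under eq_fun do rewrite !mul1r.
Qed.

Import HBNNSimple.

Lemma closure_all : (forall A, measurable A -> L2_closure (\1_A)) ->
  forall f, sq f -> L2_closure f.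
Proof.
move=> cI.
have c0 : L2_closure (fun=> 0).
  by have := cI _ measurable0; rewrite indic0.
have csimple (h : {nnsfun T >-> R}) : L2_closure h.
  rewrite (_ : (h : T -> R) = (fun x => \sum_(y <- enum_fset (fset_set (range h))) y * \1_(h @^-1` [set y]) x)).
    apply: closure_sum => // y.
    have := closure_lin y 0 (cI _ (measurable_sfunP h (measurable_set1 y))) c0.
    by under eq_fun do rewrite mulr0 addr0.
  by apply/funext => x; rewrite [LHS]fimfunE fsbig_finite.
have cpos f : sq f -> (forall x, 0 <= f x) -> L2_closure f.
  move=> sf f0; have mf : measurable_fun D (EFin \o f) by apply/measurable_EFinP; exact: sf.1.
  have f0E x : D x -> (0%:E <= (EFin \o f) x)%E by move=> _; rewrite lee_fin.
  pose f_ n : T -> R := nnsfun_approx mD mf n.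
  have f_f n x : D x -> f_ n x <= f x.
    move=> Dx; rewrite -lee_fin /f_ nnsfun_approxE; exact: (le_approx _ f0E Dx).
  apply: (@closure_cvg f_ f f) => //.
  + by move=> n; exact: csimple.
  + exact: sf.1.
  + by move=> n x Dx; rewrite ger0_norm ?f_f//; exact: fun_ge0.
  + by move=> x _; rewrite ger0_norm.
  + by apply: aeW => x Dx; have := cvg_nnsfun_approx mD mf f0E Dx => /fine_cvg.
move=> f sf.
have spos : sq (f^\+).
  split; first by apply: measurable_funrpos; exact: sf.1.
  apply: (le_integrable mD _ _ sf.2).
    by apply/measurable_EFinP; apply: measurable_funX; apply: measurable_funrpos; exact: sf.1.
  move=> x _ /=; rewrite lee_fin !ger0_norm ?sqr_ge0//.
  by rewrite /funrpos /=; case: (leP (f x) 0) => _; rewrite ?expr0n /= ?sqr_ge0.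
have sneg : sq (f^\-).
  split; first by apply: measurable_funrneg; exact: sf.1.
  apply: (le_integrable mD _ _ sf.2).
    by apply/measurable_EFinP; apply: measurable_funX; apply: measurable_funrneg; exact: sf.1.
  move=> x _ /=; rewrite lee_fin !ger0_norm ?sqr_ge0//.
  by rewrite /funrneg /=; case: (leP (- f x) 0) => _; rewrite ?sqrrN ?expr0n /= ?sqr_ge0.
have := closure_lin 1 (-1) (cpos _ spos (funrpos_ge0 f)) (cpos _ sneg (funrneg_ge0 f)).
rewrite (_ : (fun x => _) = f)//.
apply/funext => x; rewrite mul1r mulN1r /funrpos /funrneg.
by case: (leP (f x) 0) => ?; case: (leP (- f x) 0) => ?; lra.
Qed.

End Closure.

Section Tensor.
Context (d1 d2 : measure_display) (T1 : measurableType d1)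
  (T2 : measurableType d2) (R : realType).
Variables (m1 : {sigma_finite_measure set T1 -> \bar R})
  (m2 : {sigma_finite_measure set T2 -> \bar R})
  (D1 : set T1) (D2 : set T2).
Hypotheses (mD1 : measurable D1) (mD2 : measurable D2).
Hypotheses (fin1 : (m1 D1 < +oo)%E) (fin2 : (m2 D2 < +oo)%E).

Local Notation m12 := (product_sfm m1 m2).
Local Notation D12 := (D1 `*` D2).

Lemma product_fin : (m12 D12 < +oo)%E.
Proof.
rewrite /product_sfm /= product_measure1E// lte_mul_pinfty//.
by rewrite ge0_fin_numE.
Qed.

Lemma sqint_tensor f g : sqint m1 D1 f -> sqint m2 D2 g ->
  sqint m12 D12 (fun x => f x.1 * g x.2) /\
  ip m12 D12 (fun x => f x.1 * g x.2) (fun x => f x.1 * g x.2) =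
  ip m1 D1 f f * ip m2 D2 g g.
Proof.
move=> [mf If] [mg Ig]; split.
  split; first exact: measurable_fun_mul2.
  have := integrable_mul2 mD1 mD2 If Ig.
  rewrite (_ : EFin \o _ = (fun x => ((f x.1 * g x.2) ^+ 2)%:E))//.
  by apply/funext => x /=; rewrite exprMn.
have := Rintegral_mul2 mD1 mD2 If Ig.
rewrite /ip => E; transitivity (\int[m12]_(x in D12) (f x.1 ^+ 2 * g x.2 ^+ 2)).
  by apply: eq_Rintegral => x _; ring.
by rewrite [LHS]E; congr (_ * _); apply: eq_Rintegral => x _; rewrite expr2.
Qed.

Variables (B1 : (T1 -> R) -> Prop) (B2 : (T2 -> R) -> Prop).
Hypotheses (sB1 : forall b, B1 b -> sqint m1 D1 b)
  (sB2 : forall b, B2 b -> sqint m2 D2 b).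

Definition tensor (f : T1 * T2 -> R) : Prop :=
  exists b1 b2, [/\ B1 b1, B2 b2 & f = (fun x => b1 x.1 * b2 x.2)].

Lemma span_tensor p q : span B1 p -> span B2 q ->
  span tensor (fun x => p x.1 * q x.2).
Proof.
move=> Sp Sq; elim: Sp => [|a b p' Bb _ IH].
  by under eq_fun do rewrite mul0r; exact: span0.
under eq_fun do rewrite mulrDl -mulrA.
have Sbq : span tensor (fun x => b x.1 * q x.2).
  elim: Sq => [|c h q' Bh _ IH']; first by under eq_fun do rewrite mulr0; exact: span0.
  under eq_fun do rewrite mulrDr mulrCA.
  by apply: span_add => //; exists b, h.
have := span_lin a 1 Sbq IH.
by under eq_fun do rewrite mul1r.
Qed.

Lemma sqint_span1 p : span B1 p -> sqint m1 D1 p.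
Proof.
elim=> [|a b p' Bb _ IH]; first exact: sqint0.
by apply: sqint_add => //; apply: sqint_scale => //; exact: sB1.
Qed.

Lemma sqint_span2 p : span B2 p -> sqint m2 D2 p.
Proof.
elim=> [|a b p' Bb _ IH]; first exact: sqint0.
by apply: sqint_add => //; apply: sqint_scale => //; exact: sB2.
Qed.

Lemma sqint_span12 p : span tensor p -> sqint m12 D12 p.
Proof.
elim=> [|a b p' [b1 [b2 [Bb1 Bb2 ->]]] _ IH]; first exact: sqint0.
apply: sqint_add => //; first exact: measurableX.
apply: sqint_scale => //; first exact: measurableX.
by apply: (sqint_tensor _ _).1; [exact: sB1|exact: sB2].
Qed.

Let closed12 := @closure_closed _ _ R m12 _ (measurableX mD1 mD2) (span tensor) sqint_span12.

Lemma closure_tensor f g : L2_closure m1 D1 (span B1) f ->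
  L2_closure m2 D2 (span B2) g ->
  L2_closure m12 D12 (span tensor) (fun x => f x.1 * g x.2).
Proof.
move=> [sf cf] [sg cg].
apply: closed12; first exact: (sqint_tensor sf sg).1.
move=> e e0; pose c := ip m2 D2 g g + 1.
have c0 : 0 < c by have := ip_ge0 m2 D2 g; rewrite /c; lra.
have [|p Vp fp] := cf (e / c); first by rewrite divr_gt0.
have sp := sqint_span1 Vp.
exists (fun x => p x.1 * g x.2); last first.
  have [_] := sqint_tensor (sqint_sub mD1 sf sp) sg.
  rewrite (_ : (fun x => _) = (fun x => f x.1 * g x.2 - p x.1 * g x.2)); last first.
    by apply/funext => x; ring.
  move=> ->; move: fp; rewrite ltr_pdivlMr// /c.
  have := ip_ge0 m1 D1 (fun x => f x - p x); have := ip_ge0 m2 D2 g; nra.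
split; first exact: (sqint_tensor sp sg).1.
move=> {cf fp c c0 e e0} e e0; pose c := ip m1 D1 p p + 1.
have c0 : 0 < c by have := ip_ge0 m1 D1 p; rewrite /c; lra.
have [|q Vq gq] := cg (e / c); first by rewrite divr_gt0.
have sq := sqint_span2 Vq.
exists (fun x => p x.1 * q x.2); first exact: span_tensor.
have [_] := sqint_tensor sp (sqint_sub mD2 sg sq).
rewrite (_ : (fun x => _) = (fun x => p x.1 * g x.2 - p x.1 * q x.2)); last first.
  by apply/funext => x; ring.
move=> ->; move: gq; rewrite ltr_pdivlMr// /c.
have := ip_ge0 m2 D2 (fun x => g x - q x); have := ip_ge0 m1 D1 p; nra.
Qed.

Lemma tensor_dense :
  (forall A, measurable A -> L2_closure m1 D1 (span B1) (\1_A)) ->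
  (forall A, measurable A -> L2_closure m2 D2 (span B2) (\1_A)) ->
  forall A, measurable A -> L2_closure m12 D12 (span tensor) (\1_A).
Proof.
move=> c1 c2.
have rect A1 A2 : measurable A1 -> measurable A2 ->
    L2_closure m12 D12 (span tensor) (\1_(A1 `*` A2)).
  move=> mA1 mA2; have := closure_tensor (c1 _ mA1) (c2 _ mA2).
  rewrite (_ : (fun x => _) = \1_(A1 `*` A2))//.
  by apply/funext => -[x y]; rewrite !indicE in_setX /= -natrM mulnb.
apply: (@indicator_closure_pi _ _ R m12 D12 (measurableX mD1 mD2) product_fin
  (span tensor) sqint_span12 _ [set A1 `*` A2 | A1 in measurable & A2 in measurable]).
- by move=> a b f g; exact: span_lin.
- by rewrite measurable_prod_measurableType.
- move=> _ _ [A1 mA1 [A2 mA2 <-]] [B1' mB1 [B2' mB2 <-]].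
  by rewrite -setXI; exists (A1 `&` B1'); [exact: measurableI|exists (A2 `&` B2') => //; exact: measurableI].
- by rewrite -setXTT; exact: rect.
- by move=> _ [A1 mA1 [A2 mA2 <-]]; exact: rect.
Qed.

End Tensor.

Section StepPolynomial.
Context {R : realType}.
Implicit Types s : R.

Lemma bernoulli (t : R) n : -1 <= t -> 1 + n%:R * t <= (1 + t) ^+ n.
Proof.
move=> t1; elim: n => [|n IH]; first by rewrite mul0r addr0.
have IH' := ler_wpM2l (_ : 0 <= 1 + t) IH.
rewrite exprS; apply: le_trans (IH' _); last by lra.
by rewrite -natr1; have : 0 <= n%:R :> R by []; nra.
Qed.

(** The polynomials behind the Brosowski-Deutsch proof of the Stone-Weierstrass
    theorem: on [0, 1] they converge to a step at 1/2. *)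
Definition step_poly m s : R := (1 - s ^+ m) ^+ (2 ^ m).

Lemma step_poly_bound m s : 0 <= s <= 1 -> 0 <= step_poly m s <= 1.
Proof.
move=> /andP[s0 s1]; have h : 0 <= s ^+ m <= 1 by rewrite exprn_ge0// exprn_ile1.
rewrite exprn_ge0 ?exprn_ile1//; lra.
Qed.

Lemma step_poly_cvg1 s : 0 <= s < 2^-1 -> (fun m => step_poly m s) @ \oo --> (1 : R).
Proof.
move=> /andP[s0 s1]; have geo : (fun m => 1 - (2 * s) ^+ m) @ \oo --> (1 : R).
  rewrite -[X in _ --> X]subr0; apply: cvgB; first exact: cvg_cst.
  by apply: cvg_expr; rewrite ger0_norm; lra.
apply: (squeeze_cvgr _ geo (cvg_cst _)); apply: nearW => m /=.
have /andP[_ ->] : 0 <= step_poly m s <= 1 by apply: step_poly_bound; lra.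
have sm : 0 <= s ^+ m <= 1 by rewrite exprn_ge0// exprn_ile1//; lra.
have := @bernoulli (- s ^+ m) (2 ^ m); rewrite natrX mulrN -exprMn => H.
by rewrite andbT; apply: H; lra.
Qed.

Lemma step_poly_cvg0 s : 2^-1 < s <= 1 -> (fun m => step_poly m s) @ \oo --> (0 : R).
Proof.
move=> /andP[s0 s1]; have geo : (fun m => (2 * s)^-1 ^+ m) @ \oo --> (0 : R).
  apply: cvg_expr; rewrite ger0_norm ?invr_ge0; last by lra.
  by rewrite invf_lt1; lra.
apply: (squeeze_cvgr _ (cvg_cst _) geo); apply: nearW => m /=.
have /andP[-> _] : 0 <= step_poly m s <= 1 by apply: step_poly_bound; lra.
have sm : 0 <= s ^+ m <= 1 by rewrite exprn_ge0 ?exprn_ile1//; lra.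
have q0 : 0 < (2 * s) ^+ m by rewrite exprn_gt0//; lra.
rewrite exprVn -[leRHS]mul1r ler_pdivlMr//=.
have B := @bernoulli (s ^+ m) (2 ^ m); rewrite natrX -exprMn in B.
have {}B : (2 * s) ^+ m <= (1 + s ^+ m) ^+ (2 ^ m) by apply: le_trans (B _); lra.
have p0 : 0 <= step_poly m s by rewrite exprn_ge0//; lra.
apply: (le_trans (ler_wpM2l p0 B)); rewrite -exprMn exprn_ile1//; nra.
Qed.

End StepPolynomial.

Section CasDense.
Context {R : realType}.
Local Notation leb := (@lebesgue_measure R).
Local Notation D := (`[0%R, (2 * pi)%R]%classic : set (measurableTypeR R)).

Definition cas_class (f : R -> R) : Prop := exists n, f = cas n.

Local Notation V := (span cas_class).

Lemma span_cas n : V (cas n).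
Proof. by apply: span_gen; exists n. Qed.

Lemma span_cas_mul f g : V f -> V g -> V (fun x => f x * g x).
Proof.
have cas_mul_span n g' : V g' -> V (fun x => cas n x * g' x).
  elim=> [|a b h [m ->] _ IH]; first by under eq_fun do rewrite mulr0; exact: span0.
  have := span_lin a 1 (span_lin 2^-1 2^-1 (spanD (span_cas (n - m)) (span_cas (m - n)))
    (span_lin 1 (-1) (span_cas (n + m)) (span_cas (- (n + m))))) IH.
  congr (V _); apply/funext => x.
  transitivity (a * (cas n x * cas m x) + cas n x * h x); last by ring.
  by rewrite cas_mul; ring.
move=> Vf Vg; elim: Vf => [|a b h [n ->] _ IH].
  by under eq_fun do rewrite mul0r; exact: span0.
have := span_lin a 1 (cas_mul_span n g Vg) IH.
by congr (V _); apply/funext => x; ring.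
Qed.

Lemma span_cst c : V (fun=> c).
Proof.
have := span_scale c (span_cas 0); congr (V _); apply/funext => x.
by rewrite /cas mul0r cos0 sin0 addr0 mulr1.
Qed.

Lemma span_exp f n : V f -> V (fun x => f x ^+ n).
Proof.
move=> Vf; elim: n => [|n IH].
  by under eq_fun do rewrite expr0; exact: span_cst.
by under eq_fun do rewrite exprS; exact: span_cas_mul.
Qed.

Lemma span_step_poly m f : V f -> V (fun x => step_poly m (f x)).
Proof.
move=> Vf; apply: span_exp.
have := span_lin 1 (-1) (span_cst 1) (span_exp m Vf).
by congr (V _); apply/funext => x; ring.
Qed.

(** On the period, this trigonometric polynomial exceeds 1/2 exactly between 0
    and b. *)
Definition arc (b x : R) : R := 2^-1 + 2^-1 * (sin (x / 2) * sin ((b - x) / 2)).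

Lemma span_arc b : V (arc b).
Proof.
have V1 := span_lin (cos (b / 2) / 4) (sin (b / 2) / 4)
  (span_lin 2^-1 2^-1 (span_cas 1) (span_cas (-1)))
  (span_lin 2^-1 (- 2^-1) (span_cas 1) (span_cas (-1))).
have := spanD V1 (span_cst (2^-1 - cos (b / 2) / 4)); congr (V _).
apply/funext => x; rewrite /cas /arc mul1r mulN1r cosN sinN.
pose y := x / 2; have -> : x = y + y by rewrite /y; field.
have -> : (y + y) / 2 = y by field.
have -> : (b - (y + y)) / 2 = b / 2 - y by field.
rewrite sinB cosD sinD; have := cos2Dsin2 y; set c := cos y; set s := sin y => cs.
have -> : c * c = 1 - s * s by rewrite -cs; ring.
by field.
Qed.

Lemma arc_bound b x : 0 <= arc b x <= 1.
Proof.
rewrite /arc; have := sin_max (x / 2); have := sin_max ((b - x) / 2).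
rewrite !ler_norml => /andP[? ?] /andP[? ?]; apply/andP; split; nra.
Qed.

Lemma sqint_cas_span p : V p -> sqint leb D p.
Proof.
elim=> [|a b q [n ->] _ IH]; first exact: sqint0.
apply: sqint_add => //; apply: sqint_scale => //.
apply: (@sqint_bounded _ _ _ _ _ _ lebesgue_period_lty _ 2) => //.
  exact: measurable_cas.
by move=> x _; exact: norm_cas_le2.
Qed.

Lemma arc_cvg b x : 0 < b <= 2 * pi -> 0 < x < 2 * pi -> x <> b ->
  (fun m => 1 - step_poly m (arc b x)) @ \oo --> (\1_(`]-oo, b[%classic : set R) x : R).
Proof.
move=> /andP[b0 b2] /andP[x0 x2] xb.
have s0 : 0 < sin (x / 2) by apply: sin_gt0_pi; lra.
rewrite indicE; have [xltb|bltx|//] := ltgtP x b.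
- have sb : 0 < sin ((b - x) / 2) by apply: sin_gt0_pi; lra.
  rewrite mem_set /= ?in_itv//=.
  rewrite -[X in _ --> X]subr0; apply: cvgB; first exact: cvg_cst.
  apply: step_poly_cvg0; have /andP[_ ->] := arc_bound b x.
  by rewrite andbT /arc ltrDl mulr_gt0// mulr_gt0.
- have sb : 0 < sin ((x - b) / 2) by apply: sin_gt0_pi; lra.
  rewrite memNset /= ?in_itv/=; last by apply/negP; rewrite -leNgt ltW.
  rewrite -[X in _ --> X](subrr 1); apply: cvgB; first exact: cvg_cst.
  apply: step_poly_cvg1; have /andP[-> _] := arc_bound b x.
  rewrite /= /arc -subr_gt0 (_ : (b - x) / 2 = - ((x - b) / 2)); last by field.
  by rewrite sinN; have := mulr_gt0 s0 sb; lra.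
Qed.

Lemma ray_closure b : L2_closure leb D V (\1_(`]-oo, b[%classic : set R)).
Proof.
have mD : measurable D by [].
have fin : (leb D < +oo)%E := lebesgue_period_lty.
have V0 := closure_in mD sqint_cas_span (span0 _).
have m1 : measurable_fun D (\1_(`]-oo, b[%classic : set R) : R -> R).
  by apply: measurable_indic.
have [b0|b0] := leP b 0.
  apply: (closure_eq mD _ V0) => // x.
  rewrite inE /= in_itv /= => /andP[x0 _]; rewrite indicE memNset//=.
  by rewrite in_itv /= => /lt_le_trans/(_ b0); rewrite ltNge x0.
have [b2|b2] := ltP (2 * pi) b.
  apply: (closure_eq mD _ (closure_in mD sqint_cas_span (span_cst 1))) => // x.
  rewrite inE /= in_itv /= => /andP[_ x2]; rewrite indicE mem_set//=.
  by rewrite in_itv /=; exact: le_lt_trans x2 b2.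
apply: (@closure_cvg _ _ R leb D mD V sqint_cas_span (fun m x => 1 - step_poly m (arc b x)) _ (cst 1)).
- move=> m; apply: (closure_in mD sqint_cas_span).
  have := span_lin 1 (-1) (span_cst 1) (span_step_poly m (span_arc b)).
  by congr (V _); apply/funext => x; ring.
- exact: m1.
- exact: sqint_cst.
- by move=> m x _; have := step_poly_bound m (arc_bound b x); rewrite ler_norml /=; lra.
- by move=> x _; rewrite indicE; case: (_ \in _); rewrite /= ?normr1 ?normr0.
- exists [set 0; b; 2 * pi]; split.
  + by apply: measurableU => //; exact: measurableU.
  + apply/null_set_setU => //; [exact: measurableU | |exact: lebesgue_measure_set1].
    by apply/null_set_setU => //; exact: lebesgue_measure_set1.
  + move=> x /=; apply: contra_notP => /not_orP[/not_orP[/eqP x0 /eqP xb] /eqP x2].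
    rewrite in_itv /= => /andP[xge0 xle2].
    apply: arc_cvg; [by rewrite b0 b2| |exact/eqP].
    by apply/andP; split; rewrite lt_neqAle; [rewrite eq_sym x0|rewrite x2].
Qed.

Lemma cas_dense A : measurable A -> L2_closure leb D V (\1_A).
Proof.
have mD : measurable D by [].
have fin : (leb D < +oo)%E := lebesgue_period_lty.
apply: (@indicator_closure_pi _ _ R leb D mD fin V sqint_cas_span _ (@RGenInftyO.G R)).
- by move=> a b f g; exact: span_lin.
- exact: RGenInftyO.measurableE.
- move=> _ _ [x ->] [y ->]; exists (Num.min x y).
  by apply/seteqP; split => t /=; rewrite !in_itv /= lt_min => /andP.
- rewrite (_ : \1_setT = (fun=> 1)); last by apply/funext => x; rewrite indicE in_setT.
  exact: (closure_in mD sqint_cas_span (span_cst 1)).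
- by move=> _ [x ->]; exact: ray_closure.
Qed.

End CasDense.

(** * Fourier coefficients and the Parseval identity *)

Section Fourier.
Context {R : realType}.
Local Notation Rm := (measurableTypeR R).
Local Notation leb := (@lebesgue_measure R).
Local Notation mB := (@measurable_box R).
Implicit Types (f g h : R * R * R -> R) (k l : int * int * int) (n : nat).

Definition vol : R := (2 * pi) ^+ 3.

Definition coef k f : R := intT (fun x => f x * hartley k x).

Definition nrm2 f : R := intT (fun x => f x * f x).

Definition proj n f x : R := vol^-1 * \sum_(k <- cube n) coef k f * hartley k x.

Lemma vol_ge8 : 8 <= vol.
Proof.
have pi2 := @pi_ge2 R; rewrite /vol (_ : 8 = 2 ^+ 3); last by rewrite -natrX.
by rewrite lerXn2r ?nnegrE; lra.
Qed.

Lemma vol_gt0 : 0 < vol.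
Proof. by have := vol_ge8; lra. Qed.

Lemma L2_add f g : L2 f -> L2 g -> L2 (fun x => f x + g x).
Proof. exact: (sqint_add mB). Qed.

Lemma L2_sub f g : L2 f -> L2 g -> L2 (fun x => f x - g x).
Proof. exact: (sqint_sub mB). Qed.

Lemma L2_scale a f : L2 f -> L2 (fun x => a * f x).
Proof. exact: (sqint_scale mB). Qed.

Lemma L2_opp f : L2 f -> L2 (fun x => - f x).
Proof. exact: (sqint_opp mB). Qed.

Lemma L2_sum (I : Type) (s : seq I) (F : I -> R * R * R -> R) :
  (forall i, L2 (F i)) -> L2 (fun x => \sum_(i <- s) F i x).
Proof. exact: (sqint_sum mB). Qed.

Lemma L2_cst (c : R) : L2 (fun=> c).
Proof. exact: (sqint_cst mB leb3_box_lty). Qed.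

Lemma L2_bounded f C : measurable_fun (@box R) f -> (forall x, `|f x| <= C) -> L2 f.
Proof. by move=> mf fC; apply: (sqint_bounded mB leb3_box_lty mf (C := C)). Qed.

Lemma L2_hartley k : L2 (hartley k : R * R * R -> R).
Proof. exact: (L2_bounded (measurable_hartley k) (norm_hartley_le8 k)). Qed.

Lemma L2_proj n f : L2 (proj n f).
Proof.
by apply: L2_scale; apply: L2_sum => k; apply: L2_scale; exact: L2_hartley.
Qed.

Lemma intT_mulDl f g h : L2 f -> L2 g -> L2 h ->
  intT (fun x => (f x + g x) * h x) = intT (fun x => f x * h x) + intT (fun x => g x * h x).
Proof. exact: (ipDl mB). Qed.

Lemma intT_mulBl f g h : L2 f -> L2 g -> L2 h ->
  intT (fun x => (f x - g x) * h x) = intT (fun x => f x * h x) - intT (fun x => g x * h x).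
Proof. exact: (ipBl mB). Qed.

Lemma intT_mulZl a f h : L2 f -> L2 h ->
  intT (fun x => a * f x * h x) = a * intT (fun x => f x * h x).
Proof. exact: (ipZl mB). Qed.

Lemma intT_mul_suml (I : Type) (s : seq I) (F : I -> R * R * R -> R) h :
  (forall i, L2 (F i)) -> L2 h ->
  intT (fun x => (\sum_(i <- s) F i x) * h x) = \sum_(i <- s) intT (fun x => F i x * h x).
Proof. exact: (ip_suml mB). Qed.

Lemma intT_mulC f g : intT (fun x => f x * g x) = intT (fun x => g x * f x).
Proof. by apply: eq_Rintegral => x _; rewrite mulrC. Qed.

Lemma eq_intT f g : (forall x, f x = g x) -> intT f = intT g.
Proof. by move=> fg; apply: eq_Rintegral => x _. Qed.

Lemma coefD k f g : L2 f -> L2 g -> coef k (fun x => f x + g x) = coef k f + coef k g.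
Proof. by move=> sf sg; apply: intT_mulDl => //; exact: L2_hartley. Qed.

Lemma coefB k f g : L2 f -> L2 g -> coef k (fun x => f x - g x) = coef k f - coef k g.
Proof. by move=> sf sg; apply: intT_mulBl => //; exact: L2_hartley. Qed.

Lemma coefZ k a f : L2 f -> coef k (fun x => a * f x) = a * coef k f.
Proof. by move=> sf; apply: intT_mulZl => //; exact: L2_hartley. Qed.

Lemma coefN k f : L2 f -> coef k (fun x => - f x) = - coef k f.
Proof.
by move=> sf; under eq_fun do rewrite -mulN1r; rewrite coefZ// mulN1r.
Qed.

Lemma coef_sum k (I : Type) (s : seq I) (F : I -> R * R * R -> R) :
  (forall i, L2 (F i)) ->
  coef k (fun x => \sum_(i <- s) F i x) = \sum_(i <- s) coef k (F i).
Proof. by move=> sF; apply: intT_mul_suml => //; exact: L2_hartley. Qed.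

Lemma coef_hartley k l : coef k (hartley l) = vol * (l == k)%:R.
Proof. exact: intT_hartley2. Qed.

Lemma nrm2_ge0 f : 0 <= nrm2 f.
Proof. exact: (ip_ge0 leb3). Qed.

Lemma nrm2B f g : L2 f -> L2 g ->
  nrm2 (fun x => f x - g x) = nrm2 f - 2 * intT (fun x => f x * g x) + nrm2 g.
Proof. exact: (ipBB mB). Qed.

Definition trig_poly n (c : int * int * int -> R) x : R :=
  \sum_(k <- cube n) c k * hartley k x.

Lemma L2_trig_poly n c : L2 (trig_poly n c).
Proof. by apply: L2_sum => k; apply: L2_scale; exact: L2_hartley. Qed.

Lemma projE n f : proj n f = trig_poly n (fun k => vol^-1 * coef k f).
Proof.
by apply/funext => x; rewrite /proj /trig_poly mulr_sumr; under eq_bigr do rewrite mulrA.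
Qed.

Lemma intT_trig_poly n f c : L2 f ->
  intT (fun x => f x * trig_poly n c x) = \sum_(k <- cube n) c k * coef k f.
Proof.
move=> sf; rewrite intT_mulC intT_mul_suml//; last first.
  by move=> k; apply: L2_scale; exact: L2_hartley.
by apply: eq_bigr => k _; rewrite intT_mulZl ?(intT_mulC (hartley k))//; exact: L2_hartley.
Qed.

Lemma coef_trig_poly n c k :
  coef k (trig_poly n c) = if k \in cube n then vol * c k else 0.
Proof.
rewrite coef_sum; last by move=> l; apply: L2_scale; exact: L2_hartley.
under eq_bigr => l _ do rewrite (coefZ k (c l) (L2_hartley l)) coef_hartley.
case: ifPn => [kn|kn].
  rewrite (bigD1_seq k) ?cube_uniq//= eqxx mulr1 big1 ?addr0 1?mulrC// => l /negbTE ->.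
  by rewrite !mulr0.
rewrite big_seq big1// => l ln; case: eqVneq => [E|_]; last by rewrite !mulr0.
by move: kn; rewrite -E ln.
Qed.

Lemma nrm2_trig_poly n c : nrm2 (trig_poly n c) = vol * \sum_(k <- cube n) c k ^+ 2.
Proof.
rewrite /nrm2 intT_trig_poly; last exact: L2_trig_poly.
rewrite mulr_sumr big_seq [RHS]big_seq; apply: eq_bigr => k kn.
rewrite coef_trig_poly kn; ring.
Qed.

Lemma nrm2_sub_trig_poly n f c : L2 f ->
  nrm2 (fun x => f x - trig_poly n c x) =
  nrm2 f - vol^-1 * \sum_(k <- cube n) coef k f ^+ 2 +
  vol * \sum_(k <- cube n) (c k - vol^-1 * coef k f) ^+ 2.
Proof.
move=> sf; rewrite nrm2B//; last exact: L2_trig_poly.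
rewrite nrm2_trig_poly intT_trig_poly//.
have v0 := vol_gt0; have v0' : vol != 0 by rewrite gt_eqF.
rewrite -[LHS]addrA -[RHS]addrA; congr (_ + _).
rewrite -mulNr !mulr_sumr -sumrN -!big_split /=.
by apply: eq_bigr => k _; field.
Qed.

Lemma nrm2_sub_proj n f : L2 f -> nrm2 (fun x => f x - proj n f x) =
  nrm2 f - vol^-1 * \sum_(k <- cube n) coef k f ^+ 2.
Proof.
move=> sf; rewrite projE nrm2_sub_trig_poly// [X in _ + _ * X]big1 ?mulr0 ?addr0// => k _.
by rewrite subrr expr0n.
Qed.

Lemma bessel n f : L2 f -> \sum_(k <- cube n) coef k f ^+ 2 <= vol * nrm2 f.
Proof.
move=> sf; have := nrm2_ge0 (fun x => f x - proj n f x).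
by rewrite nrm2_sub_proj// subr_ge0 mulrC ler_pdivrMr ?vol_gt0// mulrC.
Qed.

Definition hartley_class : (R * R * R -> R) -> Prop :=
  tensor (tensor (@cas_class R) (@cas_class R)) (@cas_class R).

Lemma hartley_dense f : L2 f -> L2_closure leb3 (@box R) (span hartley_class) f.
Proof.
have m0 : measurable (`[0, 2 * pi] : set Rm) by [].
have sc b : cas_class b -> sqint leb `[0, 2 * pi] b by move=> /span_gen /sqint_cas_span.
have d2 := @tensor_dense _ _ _ _ R leb leb _ _ m0 m0 lebesgue_period_lty lebesgue_period_lty
  _ _ sc sc cas_dense cas_dense.
have m00 := measurableX m0 m0.
have sc2 b : tensor (@cas_class R) (@cas_class R) b ->
    sqint (product_sfm leb leb) (`[0, 2 * pi] `*` `[0, 2 * pi]) b.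
  by move=> /span_gen; exact: (sqint_span12 m0 m0 sc sc).
have fin2 := @product_fin _ _ _ _ R leb leb _ _ m0 m0 lebesgue_period_lty lebesgue_period_lty.
have d3 := @tensor_dense _ _ _ _ R (product_sfm leb leb) leb _ _ m00 m0 fin2 lebesgue_period_lty
  _ _ sc2 sc d2 cas_dense.
have ss p : span hartley_class p -> L2 p.
  by exact: (@sqint_span12 _ _ _ _ R (product_sfm leb leb) leb _ _ m00 m0 _ _ sc2 sc).
move=> sf; apply: (closure_all mB ss) => //.
  by move=> a b g h; exact: span_lin.
Qed.

Lemma span_hartley_class p : span hartley_class p ->
  exists n0, forall n, (n0 <= n)%N -> exists c, p = trig_poly n c.
Proof.
elim=> [|a b q [_ [_ [[_ [_ [[k1 ->] [k2 ->] ->]]] [k3 ->] ->]]] _ [n0 IH]].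
  by exists 0%N => n _; exists (fun=> 0); apply/funext => x; rewrite /trig_poly big1// => k _; rewrite mul0r.
have [m Hm] := in_some_cube (k1, k2, k3).
exists (maxn n0 m) => n; rewrite geq_max => /andP[n0n mn].
have [c ->] := IH n n0n; have kn := cube_le mn Hm.
exists (fun k => a * (k == (k1, k2, k3))%:R + c k); apply/funext => x.
rewrite /trig_poly; under [RHS]eq_bigr do rewrite mulrDl.
rewrite big_split /=; congr (_ + _).
rewrite (bigD1_seq (k1, k2, k3)) ?cube_uniq//= eqxx mulr1 big1 ?addr0// => k /negbTE ->.
by rewrite mulr0 mul0r.
Qed.

Lemma proj_cvg f : L2 f ->
  (fun n => nrm2 (fun x => f x - proj n f x)) @ \oo --> (0 : R).
Proof.
move=> sf; apply/cvgrPdist_lt => e e0.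
have [_ /(_ e e0) [p Vp fp]] := hartley_dense sf.
have [n0 Hn0] := span_hartley_class Vp.
exists n0 => //= n n0n; have [c pc] := Hn0 n n0n.
rewrite sub0r normrN ger0_norm ?nrm2_ge0//; apply: le_lt_trans fp.
have -> : ip leb3 (@box R) (fun x => f x - p x) (fun x => f x - p x) =
  nrm2 (fun x => f x - trig_poly n c x) by rewrite pc.
rewrite nrm2_sub_proj// nrm2_sub_trig_poly// lerDl mulr_ge0 ?(ltW vol_gt0)//.
by apply: sumr_ge0 => k _; rewrite sqr_ge0.
Qed.

Lemma parseval f : L2 f ->
  (fun n => \sum_(k <- cube n) coef k f ^+ 2) @ \oo --> vol * nrm2 f.
Proof.
move=> sf; have v0 := vol_gt0; have v0' : vol != 0 by rewrite gt_eqF.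
rewrite [X in X @ \oo --> _](_ : _ = (fun n => vol * (nrm2 f - nrm2 (fun x => f x - proj n f x)))).
  rewrite -(subr0 (nrm2 f)) (_ : (fun n => _) = (fun n => vol *
    (nrm2 f - nrm2 (fun x => f x - proj n f x)))); last by rewrite subr0.
  apply: cvgM; first exact: cvg_cst.
  by apply: cvgB; [exact: cvg_cst|exact: proj_cvg].
by apply/funext => n; rewrite nrm2_sub_proj//; field.
Qed.

Lemma nrm2_le_coef f C : L2 f -> (forall n, \sum_(k <- cube n) coef k f ^+ 2 <= C) ->
  vol * nrm2 f <= C.
Proof.
move=> sf H; have P := parseval sf.
rewrite -(cvg_lim _ P)//; apply: limr_le; first by apply/cvg_ex; eexists; exact: P.
exact: nearW.
Qed.

End Fourier.

(** * Absolutely convergent Fourier series *)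

Section Wiener.
Context {R : realType}.
Local Notation mB := (@measurable_box R).
Implicit Types (f g h : R * R * R -> R) (k l m : int * int * int) (n : nat).

Definition wiener f (B : R) := forall n, \sum_(k <- cube n) `|coef k f| <= B.

Lemma wiener_ge0 f B : wiener f B -> 0 <= B.
Proof. by move=> /(_ 0%N); apply: le_trans; apply: sumr_ge0. Qed.

Lemma norm_proj_le f B n x : wiener f B -> `|proj n f x| <= B.
Proof.
move=> wf; have v8 := @vol_ge8 R; have v0 := @vol_gt0 R; have B0 := wiener_ge0 wf.
rewrite /proj normrM gtr0_norm ?invr_gt0// ler_pdivrMl//.
apply: (le_trans (ler_norm_sum _ _ _)).
apply: (@le_trans _ _ (\sum_(k <- cube n) `|coef k f| * 8)).
  by apply: ler_sum => k _; rewrite normrM ler_wpM2l ?norm_hartley_le8.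
by rewrite -mulr_suml; have := wf n; nra.
Qed.

(** The truncation excess of f over B is at most the distance from f to any
    function bounded by B, in particular to its partial Fourier sums. *)
Lemma wiener_ae_bound f B : L2 f -> wiener f B ->
  {ae leb3, forall x, box x -> `|f x| <= B}.
Proof.
move=> sf wf; have B0 := wiener_ge0 wf.
pose e x : R := Num.max (`|f x| - B) 0.
have mf : measurable_fun (@box R) f by exact: sf.1.
have me : measurable_fun (@box R) e.
  apply: measurable_maxr; last exact: measurable_cst.
  apply: measurable_funB; last exact: measurable_cst.
  by apply: measurableT_comp => //; exact: normr_measurable.
have e0 x : 0 <= e x by rewrite /e le_max lexx orbT.
have ef x p : `|p| <= B -> e x ^+ 2 <= (f x - p) ^+ 2.
  move=> pB; rewrite -(real_normK (num_real (f x - p))) lerXn2r ?nnegrE//.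
  rewrite /e ge_max normr_ge0 andbT; have := lerB_dist (f x) p; lra.
have se : L2 e.
  split=> //; apply: (le_integrable mB _ _ sf.2).
    by apply/measurable_EFinP; exact: measurable_funX.
  move=> x Dx /=; rewrite lee_fin !ger0_norm ?sqr_ge0//.
  by have := ef x 0; rewrite normr0 subr0; apply.
have nrm_e : nrm2 e = 0.
  apply/eqP; rewrite eq_le nrm2_ge0 andbT; apply: (cvgr_to_ge (proj_cvg sf)).
  apply: nearW => n; have sfp := L2_sub sf (L2_proj n f).
  rewrite /nrm2; apply: le_Rintegral => //; [exact: mB| | |].
  - exact: (sqint_mul mB se se).
  - exact: (sqint_mul mB sfp sfp).
  - by move=> x Dx; rewrite -!expr2; apply: ef; exact: norm_proj_le.
have := ae_eq0_ip mB se nrm_e; apply: filterS => x H Bx.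
have /eqP := H Bx; rewrite eq_le /e ge_max => /andP[/andP[]]; lra.
Qed.

Lemma cvg0_sqr (u v : R^nat) C : (forall n, u n ^+ 2 <= C * v n) ->
  v @ \oo --> (0 : R) -> u @ \oo --> (0 : R).
Proof.
move=> uv v0; apply/cvgrPdist_lt => e e0.
have /cvgrPdist_lt/(_ (e ^+ 2)) H : (fun n => C * v n) @ \oo --> (0 : R).
  by rewrite -(mulr0 C); apply: cvgM => //; exact: cvg_cst.
have : 0 < e ^+ 2 by rewrite exprn_gt0.
move=> /H; apply: filterS => n; rewrite !sub0r !normrN => Cv.
rewrite -(ltr_pXn2r (n := 2)) ?nnegrE ?(ltW e0)// real_normK ?num_real//.
by apply: le_lt_trans (uv n) _; apply: le_lt_trans Cv; exact: ler_norm.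
Qed.

Lemma proj_weak_cvg f w : L2 f -> L2 w ->
  (fun n => intT (fun x => proj n f x * w x)) @ \oo --> intT (fun x => f x * w x).
Proof.
move=> sf sw; apply/cvgrPdist_lt.
suff /cvgrPdist_lt H : (fun n => intT (fun x => (f x - proj n f x) * w x)) @ \oo --> (0 : R).
  move=> e /H; apply: filterS => n; rewrite sub0r normrN intT_mulBl//.
  exact: L2_proj.
apply: (@cvg0_sqr _ (fun n => nrm2 (fun x => f x - proj n f x)) (nrm2 w)); last exact: proj_cvg.
move=> n; rewrite mulrC; apply: (cauchy_schwarz mB) => //.
exact: L2_sub (L2_proj n f).
Qed.

Lemma sum_norm_J3 a b n : \sum_(c <- segment n) `|J3 a b c : R| <= 4 * pi.
Proof.
have pi0 := @pi_ge0 R.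
have delta (t : int) : \sum_(c <- segment n) (t == c)%:R <= 1 :> R.
  have [tn|tn] := boolP (t \in segment n).
    rewrite (bigD1_seq t) ?segment_uniq//= eqxx big1 ?addr0// => c.
    by rewrite eq_sym => /negbTE ->.
  rewrite big_seq big1 ?ler01// => c cn; case: eqVneq => // E.
  by move: tn; rewrite E cn.
apply: (@le_trans _ _ (\sum_(c <- segment n) pi * ((a - b == c)%:R + (b - a == c)%:R +
   (a + b == c)%:R + (- (a + b) == c)%:R))).
  apply: ler_sum => c _; rewrite integral_cas3 normrM ger0_norm// ler_wpM2l//.
  by do 4 case: (_ == c) => /=; rewrite ler_norml; apply/andP; split; lra.
rewrite -mulr_sumr mulrC ler_wpM2r// !big_split /=.
have := delta (a - b); have := delta (b - a); have := delta (a + b).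
have := delta (- (a + b)); lra.
Qed.

Lemma sum_norm_hartley3 k l n :
  \sum_(m <- cube n) `|intT (fun x => hartley k x * hartley l x * hartley m x) : R| <= 8 * vol.
Proof.
under eq_bigr do rewrite intT_hartley3 !normrM.
rewrite (big_cube +%R) /=.
rewrite (_ : 8 * vol = (4 * pi) * (4 * pi) * (4 * pi)); last by rewrite /vol; ring.
have S0 a b : 0 <= \sum_(c <- segment n) `|J3 a b c : R| by exact: sumr_ge0.
apply: (@le_trans _ _ ((\sum_(c <- segment n) `|J3 k.1.1 l.1.1 c : R|) *
  (\sum_(c <- segment n) `|J3 k.1.2 l.1.2 c : R|) *
  (\sum_(c <- segment n) `|J3 k.2 l.2 c : R|))); last first.
  by rewrite !ler_pM ?mulr_ge0 ?sum_norm_J3.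
rewrite !mulr_suml; apply: ler_sum => a _; rewrite -mulrA mulr_suml mulr_sumr.
apply: ler_sum => b _; rewrite !mulr_sumr.
by apply: ler_sum => c _ /=; rewrite mulrA.
Qed.

Lemma L2_mul_bounded f g C : L2 f -> measurable_fun (@box R) g ->
  (forall x, `|g x| <= C) -> L2 (fun x => f x * g x).
Proof. by move=> sf mg gC; apply: (sqint_mul_bounded mB sf mg (C := C)). Qed.

Lemma L2_mul_wiener f g B : L2 f -> L2 g -> wiener g B ->
  L2 (fun x => f x * g x) /\ nrm2 (fun x => f x * g x) <= B ^+ 2 * nrm2 f.
Proof.
move=> sf sg wg; exact: (sqint_mul_bounded_ae mB sf sg.1 (wiener_ae_bound sg wg)).
Qed.

Lemma L2_mul_hartley f k : L2 f -> L2 (fun x => f x * hartley k x).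
Proof.
move=> sf; exact: (L2_mul_bounded sf (measurable_hartley k) (norm_hartley_le8 k)).
Qed.

Lemma L2_mul_proj f g B n : L2 f -> L2 g -> wiener g B -> L2 (fun x => f x * proj n g x).
Proof.
move=> sf sg wg; apply: (L2_mul_bounded sf (L2_proj n g).1 (C := B)) => x.
exact: norm_proj_le.
Qed.

Lemma wiener_proj_mul f g Bf Bg p q : wiener f Bf -> wiener g Bg ->
  wiener (fun x => proj p f x * proj q g x) (Bf * Bg).
Proof.
move=> wf wg n; have v8 := @vol_ge8 R; have v0 := @vol_gt0 R.
have coefE m : coef m (fun x => proj p f x * proj q g x) =
  \sum_(k <- cube p) \sum_(l <- cube q) vol^-1 ^+ 2 * coef k f * coef l g *
    intT (fun x => hartley k x * hartley l x * hartley m x).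
  rewrite /coef; transitivity (intT (fun x => (\sum_(k <- cube p) \sum_(l <- cube q)
     (vol^-1 ^+ 2 * coef k f * coef l g) * (hartley k x * hartley l x)) * hartley m x)).
    apply: eq_intT => x; congr (_ * _); rewrite /proj mulrACA -expr2.
    rewrite mulr_suml mulr_sumr; apply: eq_bigr => k _.
    rewrite mulr_sumr mulr_sumr; apply: eq_bigr => l _; ring.
  have Lkl k l : L2 (fun x => (vol^-1 ^+ 2 * coef k f * coef l g) * (hartley k x * hartley l x)).
    by apply: L2_scale; apply: L2_mul_hartley; exact: L2_hartley.
  rewrite intT_mul_suml; [|by move=> k; exact: L2_sum|exact: L2_hartley].
  apply: eq_bigr => k _; rewrite intT_mul_suml; [|by []|exact: L2_hartley].
  apply: eq_bigr => l _; rewrite intT_mulZl//; last exact: L2_hartley.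
  by apply: L2_mul_hartley; exact: L2_hartley.
apply: (@le_trans _ _ (\sum_(m <- cube n) \sum_(k <- cube p) \sum_(l <- cube q)
   vol^-1 ^+ 2 * `|coef k f| * `|coef l g| *
   `|intT (fun x => hartley k x * hartley l x * hartley m x)|)).
  apply: ler_sum => m _; rewrite coefE; apply: (le_trans (ler_norm_sum _ _ _)).
  apply: ler_sum => k _; apply: (le_trans (ler_norm_sum _ _ _)).
  apply: ler_sum => l _; rewrite !normrM ler_wpM2r// ler_wpM2r// ler_wpM2r//.
  by rewrite ger0_norm// invr_ge0 ltW.
rewrite exchange_big /=.
apply: (@le_trans _ _ (\sum_(k <- cube p) \sum_(l <- cube q)
   vol^-1 ^+ 2 * `|coef k f| * `|coef l g| * (8 * vol))).
  apply: ler_sum => k _; rewrite exchange_big /=; apply: ler_sum => l _.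
  rewrite -mulr_sumr ler_wpM2l ?sum_norm_hartley3//.
  by rewrite !mulr_ge0// invr_ge0 ltW.
apply: (@le_trans _ _ (8 / vol * ((\sum_(k <- cube p) `|coef k f|) * \sum_(l <- cube q) `|coef l g|))).
  rewrite mulr_suml mulr_sumr; apply: ler_sum => k _.
  rewrite !mulr_sumr; apply: ler_sum => l _.
  by rewrite le_eqVlt; apply/orP; left; apply/eqP; field; rewrite gt_eqF.
rewrite -[leRHS]mul1r ler_pM//.
- by rewrite divr_ge0// ltW.
- by rewrite mulr_ge0// sumr_ge0.
- by rewrite ler_pdivrMr// mul1r.
- by rewrite ler_pM ?sumr_ge0.
Qed.

Lemma wiener_cvg (f_ : (R * R * R -> R)^nat) f B : (forall n, wiener (f_ n) B) ->
  (forall k, (fun n => coef k (f_ n)) @ \oo --> coef k f) -> wiener f B.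
Proof.
move=> wf_ cf n.
have cvs : (fun p => \sum_(k <- cube n) `|coef k (f_ p)|) @ \oo --> \sum_(k <- cube n) `|coef k f|.
  elim: (cube n) => [|k s IH].
    by rewrite big_nil; under eq_fun do rewrite big_nil; exact: cvg_cst.
  rewrite big_cons; under eq_fun do rewrite big_cons.
  by apply: cvgD => //; apply: cvg_norm; exact: cf.
by apply: (cvgr_to_le cvs); apply: nearW => p; exact: wf_.
Qed.

Lemma wiener_mul f g Bf Bg : L2 f -> L2 g -> wiener f Bf -> wiener g Bg ->
  wiener (fun x => f x * g x) (Bf * Bg).
Proof.
move=> sf sg wf wg.
apply: (@wiener_cvg (fun q x => f x * proj q g x)).
  move=> q; apply: (@wiener_cvg (fun p x => proj p f x * proj q g x)).
    by move=> p; exact: wiener_proj_mul.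
  move=> k; rewrite /coef; under [X in _ --> intT X]eq_fun do rewrite -mulrA.
  under [X in X @ _]eq_fun do under eq_fun do rewrite -mulrA.
  apply: proj_weak_cvg => //; under eq_fun do rewrite mulrC.
  exact: (L2_mul_proj _ (L2_hartley k) sg wg).
move=> k; rewrite /coef.
under [X in _ --> intT X]eq_fun do rewrite (mulrC (f _)) -mulrA.
under [X in X @ _]eq_fun do under eq_fun do rewrite (mulrC (f _)) -mulrA.
by apply: proj_weak_cvg => //; exact: L2_mul_hartley.
Qed.

End Wiener.

(** * Sobolev regularity in terms of Fourier coefficients *)

Section Lattice2.
Context {R : realType}.
Implicit Types (k : int * int * int) (n : nat).

Definition quartic k : R := \sum_(j < 3) (coord k j)%:~R ^+ 4.

Lemma quartic_ge0 k : 0 <= quartic k.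
Proof. by apply: sumr_ge0 => j _; rewrite exprn_even_ge0. Qed.

Lemma size_cube n : size (cube n) = (n.*2.+1 ^ 3)%N.
Proof. by rewrite !size_allpairs size_map size_iota !expnS expn0; ring. Qed.

Lemma quartic_notin_cube n k : k \notin cube n -> n.+1%:R ^+ 4 <= quartic k.
Proof.
rewrite mem_cube negb_forall => /existsP[j]; rewrite -ltNge => nk.
have nk' : n.+1%:R <= `|(coord k j)%:~R| :> R.
  by rewrite -intr_norm (_ : n.+1%:R = (n.+1%:Z)%:~R)// ler_int; lia.
rewrite /quartic (bigD1 j)//= -[leLHS]addr0 lerD//.
  have -> : (coord k j)%:~R ^+ 4 = `|(coord k j)%:~R| ^+ 4 :> R.
    by rewrite -normrX ger0_norm// exprn_even_ge0.
  by rewrite lerXn2r ?nnegrE.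
by apply: sumr_ge0 => i _; rewrite exprn_even_ge0.
Qed.

Lemma big_cubeS n (F : int * int * int -> R) :
  \sum_(k <- cube n.+1) F k =
  \sum_(k <- cube n) F k + \sum_(k <- cube n.+1 | k \notin cube n) F k.
Proof.
rewrite (bigID (mem (cube n))) /=; congr (_ + _).
rewrite -big_filter; apply: perm_big; apply: uniq_perm.
- by rewrite filter_uniq// cube_uniq.
- exact: cube_uniq.
- by move=> k; rewrite mem_filter; case: (boolP (k \in cube n)) => // /(cube_le (leqnSn n)) ->.
Qed.

(** The shell of radius n contains 24 n^2 + 2 points. *)
Lemma lattice_sum n : \sum_(k <- cube n) (1 + quartic k)^-1 <= 53.
Proof.
have shell m (c : R) : 0 <= c -> (forall k, k \notin cube m -> (1 + quartic k)^-1 <= c) ->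
    \sum_(k <- cube m.+1 | k \notin cube m) (1 + quartic k)^-1 <= c * (24 * m.+1%:R ^+ 2 + 2).
  move=> c0 H; apply: (@le_trans _ _ (\sum_(k <- cube m.+1 | k \notin cube m) c)).
    by apply: ler_sum => k; exact: H.
  have := big_cubeS m (fun=> c); rewrite !big_const_seq !iter_addr_0 !count_predT !size_cube => E.
  have -> : c *+ count (fun k => k \notin cube m) (cube m.+1) =
     c *+ (m.+1.*2.+1 ^ 3) - c *+ (m.*2.+1 ^ 3).
    by rewrite E; ring.
  rewrite -!(mulr_natr c) -mulrBr ler_wpM2l// !natrX -!addnn.
  by rewrite -!natr1 !natrD -!natr1 le_eqVlt; apply/orP; left; apply/eqP; ring.
have base : \sum_(k <- cube 0) (1 + quartic k)^-1 <= 1.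
  rewrite (_ : cube 0 = [:: (0, 0, 0)])// big_seq1 /quartic big1 ?addr0 ?invr1//.
  by case=> -[|[|[|m]]] Hm _ //; rewrite /coord /= expr0n.
have main m : \sum_(k <- cube m.+1) (1 + quartic k)^-1 <= 53 - 26 / m.+1%:R.
  elim: m => [|m IH].
    have w1 k : (1 + quartic k)^-1 <= 1 by rewrite invf_le1 ?lerDl ?quartic_ge0// ltr_pwDl// quartic_ge0.
    have := shell 0%N 1 ler01 (fun k _ => w1 k).
    by rewrite big_cubeS divr1 expr1n; move: base; lra.
  rewrite big_cubeS; set a : R := m.+1%:R in IH *; set b : R := m.+2%:R.
  have ab : b = a + 1 by rewrite /a /b natr1.
  have a1 : 1 <= a by rewrite /a ler1n.
  have b0 : 0 < b by rewrite ab; lra.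
  have b40 : 0 < b ^+ 4 by rewrite exprn_gt0.
  have S : \sum_(k <- cube m.+2 | k \notin cube m.+1) (1 + quartic k)^-1 <= (b ^+ 4)^-1 * (24 * b ^+ 2 + 2).
    apply: shell; first by rewrite invr_ge0 ltW.
    move=> k /quartic_notin_cube kb; rewrite lef_pV2 ?posrE//; last by have := quartic_ge0 k; lra.
    by rewrite (le_trans kb)// lerDr.
  have T : (b ^+ 4)^-1 * (24 * b ^+ 2 + 2) <= 26 / a - 26 / b.
    apply: (@le_trans _ _ (26 / b ^+ 2)).
      rewrite mulrC ler_pdivrMr// (_ : 26 / b ^+ 2 * b ^+ 4 = 26 * b ^+ 2); last first.
        by field; rewrite gt_eqF.
      have : 1 <= b by rewrite ab; lra.
      by nra.
    have -> : 26 / a - 26 / b = 26 / (a * b).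
      by rewrite ab; field; rewrite !gt_eqF//; lra.
    have a0 : 0 < a by lra.
    rewrite ler_pM2l// lef_pV2 ?posrE ?mulr_gt0 ?exprn_gt0// expr2 ler_wpM2r ?(ltW b0)//.
    by rewrite ab lerDl.
  by apply: (le_trans (lerD IH (le_trans S T))); rewrite addrA subrK.
case: n => [|n]; first by move: base; lra.
by apply: (le_trans (main n)); rewrite gerBl divr_ge0.
Qed.

Lemma sum_norm_le_weight (s : seq (int * int * int)) (a w : int * int * int -> R) :
  (forall k, 0 < w k) ->
  (\sum_(k <- s) `|a k|) ^+ 2 <= (\sum_(k <- s) (w k)^-1) * \sum_(k <- s) w k * a k ^+ 2.
Proof.
move=> w0; elim: s => [|k s IH]; first by rewrite !big_nil expr0n mul0r.
rewrite !big_cons.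
set A := \sum_(_ <- _) _ in IH *; set B := \sum_(_ <- _) _ in IH *.
set C := \sum_(_ <- _) _ in IH *.
have A0 : 0 <= A by apply: sumr_ge0.
have B0 : 0 <= B by apply: sumr_ge0 => l _; rewrite invr_ge0 ltW.
have C0 : 0 <= C by apply: sumr_ge0 => l _; rewrite mulr_ge0 ?sqr_ge0// ltW.
have wk := w0 k; set x := `|a k|; have <- : x ^+ 2 = a k ^+ 2 by rewrite real_normK ?num_real.
have x0 : 0 <= x by exact: normr_ge0.
have -> : ((w k)^-1 + B) * (w k * x ^+ 2 + C) =
   x ^+ 2 + B * C + ((w k)^-1 * C + w k * x ^+ 2 * B) by field; rewrite gt_eqF.
suff : 2 * x * A <= (w k)^-1 * C + w k * x ^+ 2 * B by move: IH; nra.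
set p := (w k)^-1 * C; set q := w k * x ^+ 2 * B.
have p0 : 0 <= p by rewrite /p mulr_ge0// invr_ge0 ltW.
have q0 : 0 <= q by rewrite /q !mulr_ge0 ?sqr_ge0// ltW.
have pq : x ^+ 2 * (B * C) = p * q by rewrite /p /q; field; rewrite gt_eqF.
rewrite -(@ler_pXn2r _ 2) ?nnegrE ?mulr_ge0 ?addr_ge0//.
have : x ^+ 2 * A ^+ 2 <= p * q by rewrite -pq ler_wpM2l ?sqr_ge0.
by have := sqr_ge0 (p - q); rewrite !exprMn; nra.
Qed.

End Lattice2.

Section Sobolev.
Context {R : realType}.
Implicit Types (f g h : R * R * R -> R) (k l m : int * int * int) (n : nat).

Lemma sobolev_wiener f Q : (forall n, \sum_(k <- cube n) (1 + quartic k) * coef k f ^+ 2 <= Q) ->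
  wiener f (Num.sqrt (53 * Q)).
Proof.
move=> H n; have w0 k : 0 < 1 + quartic k :> R by have := @quartic_ge0 R k; lra.
have := sum_norm_le_weight (cube n) (fun k => coef k f) w0.
set X := \sum_(_ <- _) `|_|; have X0 : 0 <= X by apply: sumr_ge0.
move=> XW; rewrite -(ger0_norm X0) -sqrtr_sqr.
apply: ler_wsqrtr; apply: (le_trans XW).
apply: ler_pM; [| |exact: lattice_sum|exact: H].
- by apply: sumr_ge0 => k _; rewrite invr_ge0 ltW.
- by apply: sumr_ge0 => k _; rewrite mulr_ge0 ?sqr_ge0// ltW.
Qed.

Lemma coef_weak_deriv j f g k : L2 f -> weak_deriv j f g ->
  coef k g = - (coord k j)%:~R * coef (flip j k) f.
Proof.
move=> sf [sg /(_ _ (smooth_periodic_hartley k))] E.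
rewrite /coef mulNr -[LHS]opprK -E; congr (- _); rewrite pd_hartley.
rewrite intT_mulC (intT_mulC f); apply: intT_mulZl => //; exact: L2_hartley.
Qed.

Lemma weak_deriv_wderiv j f : (exists g, weak_deriv j f g) -> weak_deriv j f (wderiv j f).
Proof. by move=> [g fg]; rewrite /wderiv; case: xgetP => [h -> //|/(_ g)]. Qed.

Lemma inH_L2 n f : inH n f -> L2 f.
Proof. by case: n => [|n] //= []. Qed.

Lemma inH_weak_deriv n f j : inH n.+1 f -> weak_deriv j f (wderiv j f).
Proof. by move=> [_ /(_ j) [g fg _]]; apply: weak_deriv_wderiv; exists g. Qed.

Lemma weak_deriv_eq i j f g g' h : weak_deriv j f g -> weak_deriv j f g' ->
  weak_deriv i g h -> weak_deriv i g' h.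
Proof.
move=> [_ fg] [_ fg'] [sh gh]; split=> // phi sphi.
have spd : smooth_periodic (pd i phi).
  case: sphi => sphi pphi; split; first exact: smooth_pd.
  move=> l x; rewrite /pd /derive; set F := (X in lim (X @ _)); set G := (X in _ = lim (X @ _)).
  suff -> : F = G by [].
  by apply/funext => e; rewrite /F /G /= addrA !pphi.
rewrite -gh//; apply: oppr_inj; rewrite -fg// -fg'//.
Qed.

Lemma inH_wderiv n f j : inH n.+1 f -> inH n (wderiv j f).
Proof.
move=> Hf; have fw := inH_weak_deriv j Hf; have [_ /(_ j) [g fg Hg]] := Hf.
case: n Hf Hg => [|n] Hf; first by move=> _; exact: fw.1.
move=> [_ Hg]; split; first exact: fw.1.
by move=> i; have [h gh Hh] := Hg i; exists h => //; exact: weak_deriv_eq fg fw gh.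
Qed.

Lemma inH_le n f : inH n.+1 f -> inH n f.
Proof.
elim: n f => [|n IH] f [sf Hf] //=; split=> // j.
by have [g fg Hg] := Hf j; exists g => //; exact: IH.
Qed.

Lemma coef_wderiv n j f k : inH n.+1 f ->
  coef k (wderiv j f) = - (coord k j)%:~R * coef (flip j k) f.
Proof. by move=> Hf; apply: coef_weak_deriv; [exact: inH_L2 Hf|exact: inH_weak_deriv Hf]. Qed.

Lemma sqHnorm_ge0 n f : 0 <= sqHnorm n f.
Proof.
have nn g : 0 <= intT (fun x => g x ^+ 2) by apply: Rintegral_ge0 => x _; exact: sqr_ge0.
by elim: n f => [|n IH] f //=; rewrite addr_ge0// sumr_ge0.
Qed.

Lemma sqHnorm0E f : sqHnorm 0 f = nrm2 f.
Proof. by apply: eq_intT => x; rewrite expr2. Qed.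

Lemma sqHnormSE n f : sqHnorm n.+1 f = nrm2 f + \sum_(j < 3) sqHnorm n (wderiv j f).
Proof. by rewrite -sqHnorm0E. Qed.

Lemma sqr_Hnorm n f : Hnorm n f ^+ 2 = sqHnorm n f.
Proof. by rewrite sqr_sqrtr// sqHnorm_ge0. Qed.

Lemma nrm2_wderiv_le j g : nrm2 (wderiv j g) <= sqHnorm 1 g.
Proof.
rewrite sqHnormSE -sqHnorm0E (bigD1 j isT) addrCA lerDl.
by rewrite addr_ge0 ?nrm2_ge0// sumr_ge0// => i _; exact: sqHnorm_ge0.
Qed.

(** Only the pure second derivatives enter. *)
Lemma sqHnorm2_coef f n : inH 2 f ->
  \sum_(k <- cube n) (1 + quartic k) * coef k f ^+ 2 <= vol * sqHnorm 2 f.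
Proof.
move=> Hf; rewrite sqHnormSE; under eq_bigr do rewrite mulrDl mul1r.
rewrite big_split /= mulrDr lerD//; first by apply: bessel; exact: inH_L2 Hf.
rewrite mulr_sumr; under eq_bigr do rewrite mulr_suml.
rewrite exchange_big /=; apply: ler_sum => j _.
have Hj := inH_wderiv j Hf; have Hjj := inH_wderiv j Hj.
rewrite -[leRHS]/(vol * sqHnorm 1 (wderiv j f)).
have B := bessel n (inH_L2 Hjj).
apply: (@le_trans _ _ (vol * nrm2 (wderiv j (wderiv j f)))).
  apply: le_trans B; rewrite le_eqVlt; apply/orP; left; apply/eqP.
  apply: eq_bigr => k _; rewrite (coef_wderiv _ _ Hj) (coef_wderiv _ _ Hf) flipK coord_flip.
  rewrite mulrNz; ring.
by rewrite ler_wpM2l ?(ltW vol_gt0)// nrm2_wderiv_le.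
Qed.

End Sobolev.

(** * Smooth periodic functions *)

Section Caratheodory.
Context (d : measure_display) (T : measurableType d) (R : realType).
Local Notation Rm := (measurableTypeR R).

Lemma floor_step_cvg (y : R) :
  (fun n => (Num.floor (y * n.+1%:R))%:~R / n.+1%:R) @ \oo --> y.
Proof.
have lo : (fun n => y - n.+1%:R^-1) @ \oo --> y.
  rewrite -[X in _ --> X]subr0; apply: cvgB; first exact: cvg_cst.
  exact: cvg_harmonic.
apply: (squeeze_cvgr _ lo (cvg_cst y)); apply: nearW => n.
have n0 : 0 < n.+1%:R :> R by [].
rewrite ler_pdivlMr// ler_pdivrMr// mulrBl mulVf ?gt_eqF// floor_le_tmp andbT.
by have /andP[_] := floor_itv (y * n.+1%:R); rewrite intrD; lra.
Qed.

(** A function measurable in its first argument and continuous in its second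
    one is the limit of its values at points whose second argument is rounded
    to a multiple of 1/n. *)
Lemma caratheodory (f : T * R -> R) :
  (forall y, measurable_fun setT (fun x => f (x, y))) ->
  (forall x, continuous (fun y => f (x, y))) ->
  measurable_fun setT (f : T * Rm -> R).
Proof.
move=> mf cf.
pose h n (p : T * R) := f (p.1, (Num.floor (p.2 * n.+1%:R))%:~R / n.+1%:R).
apply: (@measurable_fun_cvg _ _ R setT h); last first.
  move=> [x y] _; rewrite /h /=.
  exact: (cvg_comp _ _ (@floor_step_cvg y) (cf x y)).
move=> n _ Y mY; rewrite setTI.
rewrite (_ : h n @^-1` Y = \bigcup_(a : int)
    ([set x | Y (f (x, a%:~R / n.+1%:R))] `*` [set y | Num.floor (y * n.+1%:R) = a])).
  apply: countable_bigcupT_measurable => // a.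
  apply: measurableX; first by have := mf (a%:~R / n.+1%:R) measurableT Y mY; rewrite setTI.
  rewrite (_ : [set y | _] = `[a%:~R / n.+1%:R, (a + 1)%:~R / n.+1%:R[%classic)//.
  apply/seteqP; split => y /=; rewrite in_itv /= ler_pdivrMr// ltr_pdivlMr//.
    by move=> <-; exact: floor_itv.
  by move=> /floor_def.
apply/seteqP; split => [[x y] /= Yh|[x y] [a _ [/= Ya ya]]].
  by exists (Num.floor (y * n.+1%:R)).
by rewrite /h /preimage /= ya.
Qed.

End Caratheodory.

Section SmoothPeriodic.
Context {R : realType}.
Local Notation Rm := (measurableTypeR R).
Local Notation leb := (@lebesgue_measure R).
Local Notation mB := (@measurable_box R).
Implicit Types (f g : R * R * R -> R).

Lemma continuous_pair (U V W : topologicalType) (f : U -> V) (g : U -> W) :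
  continuous f -> continuous g -> continuous (fun x => (f x, g x)).
Proof. by move=> cf cg x; apply: cvg_pair; [exact: cf|exact: cg]. Qed.

Lemma continuous_measurable3 f : continuous f -> measurable_fun setT (f : Rm * Rm * Rm -> R).
Proof.
move=> cf; apply: caratheodory => [z|[x y]].
  apply: caratheodory => [y|x].
    apply: continuous_measurable_fun => x.
    apply: (continuous_comp (f := fun x => (x, y, z))); last exact: cf.
    by apply: continuous_pair => [|t]; [apply: continuous_pair => t; [exact: cvg_id|exact: cvg_cst]|exact: cvg_cst].
  move=> y; apply: (continuous_comp (f := fun y => (x, y, z))); last exact: cf.
  by apply: continuous_pair => [|t]; [apply: continuous_pair => t; [exact: cvg_cst|exact: cvg_id]|exact: cvg_cst].
move=> z; apply: (continuous_comp (f := fun z => (x, y, z))); last exact: cf.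
by apply: continuous_pair => t; [exact: cvg_cst|exact: cvg_id].
Qed.

Lemma continuous_bounded_box f : continuous f -> exists C, forall x, box x -> `|f x| <= C.
Proof.
move=> cf.
have cB : compact (@box R).
  apply: compact_setX; last exact: segment_compact.
  by apply: compact_setX; exact: segment_compact.
have := @continuous_compact _ _ f _ (continuous_subspaceT cf) cB.
move=> /compact_bounded [C [_ HC]]; exists (C + 1) => x Bx.
by apply: (HC (C + 1)); [rewrite ltrDl|exists x].
Qed.

Lemma continuous_L2 f : continuous f -> L2 f.
Proof.
move=> cf; have [C HC] := continuous_bounded_box cf.
apply: (sqint_bounded mB leb3_box_lty (C := C)) => //.
by apply: measurable_funTS; exact: continuous_measurable3.
Qed.

Lemma smooth_periodic_L2 f : smooth_periodic f -> L2 f.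
Proof. by move=> [sf _]; exact/continuous_L2/smooth_continuous. Qed.

Lemma smooth_periodic_pd j f : smooth_periodic f -> smooth_periodic (pd j f).
Proof.
move=> [sf pf]; split; first exact: smooth_pd.
move=> l x; rewrite /pd /derive; set F := (X in lim (X @ _)); set G := (X in _ = lim (X @ _)).
suff -> : F = G by [].
by apply/funext => e; rewrite /F /G /= addrA !pf.
Qed.

Lemma smooth_periodic_mul f g : smooth_periodic f -> smooth_periodic g ->
  smooth_periodic (fun x => f x * g x).
Proof.
move=> [sf pf] [sg pg]; split; first exact: smooth_mul.
by move=> j x; rewrite pf pg.
Qed.

Lemma pd_mul j f g x : smooth f -> smooth g ->
  pd j (fun x => f x * g x) x = pd j f x * g x + f x * pd j g x.
Proof.
move=> sf sg; rewrite /pd (_ : (fun x => _) = f * g)//.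
rewrite deriveM; [|exact: smooth_derivable|exact: smooth_derivable].
by rewrite addrC (mulrC _ (g x)).
Qed.

Lemma integral_period_derivative (h h' : R -> R) : (forall s, is_derive s (1 : R) h (h' s)) ->
  continuous h' -> h (2 * pi) = h 0 ->
  \int[leb]_(s in `[0, 2 * pi]) h' s = 0.
Proof.
move=> dh ch' per; have pi2 : 0 < 2 * pi :> R by rewrite mulr_gt0 ?pi_gt0.
have ch : continuous h.
  by move=> x; apply/differentiable_continuous/derivable1_diffP; have [] := dh x.
rewrite /Rintegral (@continuous_FTC2 _ h' h)//.
- by rewrite per -EFinB /= subrr.
- exact/continuous_subspaceT.
- split.
  + by move=> x _; have [] := dh x.
  + by apply: cvg_at_right_filter; exact: ch.
  + by apply: cvg_at_left_filter; exact: ch.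
- by move=> x _; rewrite derive1E; have [] := dh x.
Qed.

End SmoothPeriodic.

Section ProductZero.
Context (d1 d2 : measure_display) (T1 : measurableType d1)
  (T2 : measurableType d2) (R : realType).
Variables (m1 : {sigma_finite_measure set T1 -> \bar R})
  (m2 : {sigma_finite_measure set T2 -> \bar R})
  (D1 : set T1) (D2 : set T2).
Hypotheses (mD1 : measurable D1) (mD2 : measurable D2).

Lemma Rintegral_prod_eq0_r (g : T1 * T2 -> R) :
  (m1 \x m2)%E.-integrable (D1 `*` D2) (EFin \o g) ->
  (forall x, D1 x -> (\int[m2]_(y in D2) (g (x, y))%:E = 0)%E) ->
  (\int[(m1 \x m2)%E]_(p in D1 `*` D2) (g p)%:E = 0)%E.
Proof.
move=> Ig g0; have mD12 := measurableX mD1 mD2.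
rewrite integral_mkcond.
have Ig' : (m1 \x m2)%E.-integrable setT ((EFin \o g) \_ (D1 `*` D2)).
  exact/(integrable_mkcond _ mD12).
rewrite -(integral12_prod_meas1 Ig') /fubini_F.
apply: integral0_eq => x _.
have [D1x|D1x] := pselect (D1 x); last first.
  apply: integral0_eq => y _; rewrite /patch in_setX (memNset D1x)//.
rewrite -[RHS](g0 x D1x) [RHS]integral_mkcond; apply: eq_integral => y _.
by rewrite /patch in_setX (mem_set D1x).
Qed.

Lemma Rintegral_prod_eq0_l (g : T1 * T2 -> R) :
  (m1 \x m2)%E.-integrable (D1 `*` D2) (EFin \o g) ->
  (forall y, D2 y -> (\int[m1]_(x in D1) (g (x, y))%:E = 0)%E) ->
  (\int[(m1 \x m2)%E]_(p in D1 `*` D2) (g p)%:E = 0)%E.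
Proof.
move=> Ig g0; have mD12 := measurableX mD1 mD2.
rewrite integral_mkcond.
have Ig' : (m1 \x m2)%E.-integrable setT ((EFin \o g) \_ (D1 `*` D2)).
  exact/(integrable_mkcond _ mD12).
rewrite -(integral21_prod_meas1 Ig') /fubini_G.
apply: integral0_eq => y _.
have [D2y|D2y] := pselect (D2 y); last first.
  apply: integral0_eq => x _; rewrite /patch in_setX (memNset D2y)// andbF//.
rewrite -[RHS](g0 y D2y) [RHS]integral_mkcond; apply: eq_integral => x _.
by rewrite /patch in_setX (mem_set D2y) andbT.
Qed.

End ProductZero.

Section IntegrationByParts.
Context {R : realType}.
Local Notation Rm := (measurableTypeR R).
Local Notation leb := (@lebesgue_measure R).
Local Notation mB := (@measurable_box R).
Implicit Types (f g : R * R * R -> R).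

Lemma integral_pd_line f (j : 'I_3) (L : R -> R * R * R) : smooth_periodic f ->
  continuous L -> (forall s h, L (s + h) = L s + h *: basis_vec j) ->
  (\int[leb]_(s in `[0%R, (2 * pi)%R]) (pd j f (L s))%:E = 0)%E.
Proof.
move=> [sf pf] cL LE.
have dh s : is_derive s (1 : R) (fun s => f (L s)) (pd j f (L s)).
  have E : (fun h : R => h^-1 *: (f (L (h *: 1 + s)) - f (L s))) =
     (fun h => h^-1 *: (f (h *: basis_vec j + L s) - f (L s))).
    apply/funext => h; congr (_ *: (f _ - _)).
    have -> : h *: 1 + s = s + h by rewrite addrC; congr (_ + _); exact: mulr1.
    by rewrite LE addrC.
  have df := @smooth_derivable _ _ f (L s) (basis_vec j) sf.
  split; first by rewrite /derivable /= E; exact: df.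
  by rewrite /pd /derive /= E.
have ch' : continuous (fun s => pd j f (L s)).
  move=> s; apply: (continuous_comp (f := L)); first exact: cL.
  exact/smooth_continuous/smooth_pd.
have := integral_period_derivative dh ch'; rewrite -{1}(add0r (2 * pi)) LE pf => /(_ erefl).
rewrite /Rintegral => H; rewrite -[LHS]fineK ?H//; apply: integrable_fin_num => //.
have := continuous_compact_integrable (@segment_compact _ 0 (2 * pi)) (continuous_subspaceT ch').
exact.
Qed.

Lemma intT_pd f j : smooth_periodic f -> intT (pd j f) = 0.
Proof.
move=> spf; have [spd ppd] := smooth_periodic_pd j spf.
have I3 : leb3.-integrable (@box R) (EFin \o pd j f).
  exact: (sqint_integrable mB leb3_box_lty (smooth_periodic_L2 (conj spd ppd))).
have m0 : measurable (`[0, 2 * pi] : set Rm) by [].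
suff E : (\int[leb3]_(x in box) (pd j f x)%:E = 0)%E by rewrite /intT /Rintegral E.
have cpd : continuous (pd j f) by exact: smooth_continuous.
have [C HC] := continuous_bounded_box cpd.
have mpd : measurable_fun setT (pd j f : Rm * Rm * Rm -> R) by exact: continuous_measurable3.
have I2 z : `[0, 2 * pi]%classic z ->
    (product_sfm leb leb).-integrable (`[0, 2 * pi] `*` `[0, 2 * pi])
    (EFin \o (fun p : Rm * Rm => pd j f (p, z))).
  move=> Dz; apply: (integrable_bounded (measurableX m0 m0)
    (product_fin m0 m0 lebesgue_period_lty lebesgue_period_lty) (C := C)).
    apply: measurable_funTS; exact: (measurableT_comp mpd (measurable_pair2 z)).
  by move=> p Dp; exact: HC.
case: j spf spd ppd I3 cpd HC mpd I2 => -[|[|[|m]]] Hm // spf spd ppd I3 cpd HC mpd I2.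
- apply: (Rintegral_prod_eq0_l (m1 := product_sfm leb leb) (measurableX m0 m0) m0 I3) => z Dz.
  apply: (Rintegral_prod_eq0_l m0 m0 (I2 z Dz)) => y _.
  apply: (@integral_pd_line f _ (fun x => (x, y, z))) => //.
    by apply: continuous_pair => [|t]; [apply: continuous_pair => t; [exact: cvg_id|exact: cvg_cst]|exact: cvg_cst].
  by move=> s h; rewrite /basis_vec /=; congr (_, _, _); rewrite /= ?[h *: 1]mulr1 ?[h *: 0]mulr0 ?addr0.
- apply: (Rintegral_prod_eq0_l (m1 := product_sfm leb leb) (measurableX m0 m0) m0 I3) => z Dz.
  apply: (Rintegral_prod_eq0_r m0 m0 (I2 z Dz)) => x _.
  apply: (@integral_pd_line f _ (fun y => (x, y, z))) => //.
    by apply: continuous_pair => [|t]; [apply: continuous_pair => t; [exact: cvg_cst|exact: cvg_id]|exact: cvg_cst].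
  by move=> s h; rewrite /basis_vec /=; congr (_, _, _); rewrite /= ?[h *: 1]mulr1 ?[h *: 0]mulr0 ?addr0.
- apply: (Rintegral_prod_eq0_r (m1 := product_sfm leb leb) (measurableX m0 m0) m0 I3) => -[x y] _.
  apply: (@integral_pd_line f _ (fun z => (x, y, z))) => //.
    by apply: continuous_pair => t; [exact: cvg_cst|exact: cvg_id].
  by move=> s h; rewrite /basis_vec /=; congr (_, _, _); rewrite /= ?[h *: 1]mulr1 ?[h *: 0]mulr0 ?addr0.
Qed.

Lemma weak_deriv_smooth j f : smooth_periodic f -> weak_deriv j f (pd j f).
Proof.
move=> spf; have spd := smooth_periodic_pd j spf.
split; first exact: smooth_periodic_L2.
move=> phi sphi; have sm := smooth_periodic_mul spf sphi.
have := intT_pd j sm; rewrite (_ : pd j _ = (fun x => pd j f x * phi x + f x * pd j phi x)); last first.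
  by apply/funext => x; rewrite pd_mul//; [case: spf|case: sphi].
have L1 := smooth_periodic_L2 (smooth_periodic_mul spd sphi).
have L2' := smooth_periodic_L2 (smooth_periodic_mul spf (smooth_periodic_pd j sphi)).
rewrite /intT RintegralD; [|exact: mB|exact: (sqint_integrable mB leb3_box_lty)..].
by move/eqP; rewrite addrC addr_eq0 => /eqP.
Qed.

Lemma smooth_periodic_inH n f : smooth_periodic f -> inH n f.
Proof.
elim: n f => [|n IH] f spf /=; first exact: smooth_periodic_L2.
split; first exact: smooth_periodic_L2.
move=> j; exists (pd j f); first exact: weak_deriv_smooth.
by apply: IH; exact: smooth_periodic_pd.
Qed.

Lemma smooth_periodic_wiener f : smooth_periodic f -> exists B, wiener f B.
Proof.
move=> spf; exists (Num.sqrt (53 * (vol * sqHnorm 2 f))).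
by apply: sobolev_wiener => n; apply: sqHnorm2_coef; exact: smooth_periodic_inH.
Qed.

Lemma weak_deriv_sub j f g f' g' : L2 f -> L2 f' -> weak_deriv j f g ->
  weak_deriv j f' g' -> weak_deriv j (fun x => f x - f' x) (fun x => g x - g' x).
Proof.
move=> sf sf' [sg fg] [sg' fg']; split; first exact: L2_sub.
move=> phi sphi; have Lphi := smooth_periodic_L2 sphi.
have Lpd := smooth_periodic_L2 (smooth_periodic_pd j sphi).
rewrite !intT_mulBl// fg// fg'//; ring.
Qed.

Lemma inH_sub n f f' : inH n f -> inH n f' -> inH n (fun x => f x - f' x).
Proof.
elim: n f f' => [|n IH] f f' /=; first exact: L2_sub.
move=> [sf Hf] [sf' Hf']; split; first exact: L2_sub.
move=> j; have [g fg Hg] := Hf j; have [g' fg' Hg'] := Hf' j.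
by exists (fun x => g x - g' x); [exact: weak_deriv_sub|exact: IH].
Qed.

Lemma smooth_periodic_cst (c : R) : smooth_periodic (fun _ : R * R * R => c).
Proof. by split; [exact: smooth_cst|]. Qed.

Lemma inH_cst n (c : R) : inH n (fun=> c).
Proof. by apply: smooth_periodic_inH; exact: smooth_periodic_cst. Qed.

End IntegrationByParts.

(** * The fundamental lemma of the calculus of variations *)

Section Bump.
Context {R : realType}.
Implicit Types (t u v : R).

Definition flat (n : nat) t : R := if 0 < t then t^-1 ^+ n * expR (- t^-1) else 0.

Lemma flat_ge0 n t : 0 <= flat n t.
Proof.
by rewrite /flat; case: ifP => // t0; rewrite mulr_ge0 ?expR_ge0// exprn_ge0// invr_ge0 ltW.
Qed.

Lemma flat_le n t : flat n.+1 t <= n.+1`!%:R.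
Proof.
rewrite /flat; case: ifP => // t0; have s0 : 0 <= t^-1 by rewrite invr_ge0 ltW.
rewrite expRN ler_pdivrMr ?expR_gt0// mulrC -ler_pdivrMr ?ltr0n ?fact_gt0//.
by apply: le_trans (expR_ge1Dxn n s0); rewrite lerDr.
Qed.

Lemma flat_sqr n t : flat n t = t ^+ 2 * flat n.+2 t.
Proof.
rewrite /flat; case: ifP => t0; last by rewrite mulr0.
by rewrite !exprS !exprVn; field; rewrite !gt_eqF// exprn_gt0.
Qed.

Lemma is_derive_flat n t :
  is_derive t (1 : R) (flat n) (flat n.+2 t - n%:R * flat n.+1 t).
Proof.
have [t0|t0|->] := ltgtP t 0.
- apply: (@near_eq_is_derive _ _ _ (fun=> 0)).
    near=> s; rewrite /flat ifF//; apply/negbTE; rewrite -leNgt ltW//.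
    by near: s; exact: lt_nbhsl.
  by rewrite /flat !ifF ?(lt_gtF t0)// mulr0 subr0; exact: is_derive_cst.
  apply: (@near_eq_is_derive R R R (fun s : R => s^-1 ^+ n * expR (- s^-1))).
    near=> s; rewrite /flat ifT//.
    by near: s; exact: lt_nbhsr.
  have tn0 : t != 0 by rewrite gt_eqF.
  have dinv : is_derive t (1 : R) (fun s => s^-1) (- t ^- 2).
    apply: DeriveDef; first exact: (@derivableV _ _ id).
    by rewrite (@deriveV _ _ id)// derive_id [LHS]mulr1.
  have dexp : is_derive t (1 : R) (fun s => expR (- s^-1)) (expR (- t^-1) * t ^- 2).
    have dneg : is_derive t (1 : R) (fun s => - s^-1) (t ^- 2).
      by apply: is_derive_eq; rewrite opprK.
    exact: (@is_derive1_comp _ expR (fun s => - s^-1)).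
  have dpow : is_derive t (1 : R) (fun s => s^-1 ^+ n) (- n%:R * t^-1 ^+ n.+1).
    elim: (n) => [|m IH].
      by rewrite oppr0 mul0r; under eq_fun do rewrite expr0; exact: is_derive_cst.
    have -> : (fun s : R => s^-1 ^+ m.+1) = (fun s => s^-1) * (fun s => s^-1 ^+ m).
      by apply/funext => s; rewrite exprS.
    apply: (is_derive_eq (is_deriveM dinv IH)).
    by rewrite /GRing.scale /= -exprVn -natr1 !exprS; ring.
  rewrite /flat t0; apply: (is_derive_eq (is_deriveM dpow dexp)).
  rewrite /GRing.scale /= -exprVn !exprS; ring.
- rewrite /flat ltxx mulr0 subr0.
  have lim0 : h^-1 *: (flat n (h + 0) - flat n 0) @[h --> (0:R)^'] --> (0 : R).
    apply/cvgrPdist_lt => e e0; near=> h.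
    have h0 : h != 0 by near: h; exact: nbhs_dnbhs_neq.
    rewrite sub0r normrN addr0 /flat ltxx subr0 -/(flat n h) flat_sqr /GRing.scale /=.
    rewrite expr2 -mulrA mulKf// normrM (ger0_norm (flat_ge0 _ _)).
    apply: (@le_lt_trans _ _ (`|h| * n.+2`!%:R)); first by rewrite ler_wpM2l ?flat_le.
    rewrite -ltr_pdivlMr ?ltr0n ?fact_gt0//; near: h.
    by apply: dnbhs0_lt; rewrite divr_gt0 ?ltr0n ?fact_gt0.
  have E : (fun h : R => h^-1 *: (flat n (h *: 1 + 0) - flat n 0)) =
     (fun h => h^-1 *: (flat n (h + 0) - flat n 0)).
    by apply/funext => h; rewrite [h *: 1]mulr1.
  split; first by apply/cvg_ex; exists 0; rewrite /= E.
  by rewrite /derive /= E; apply/cvg_lim => //.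
Unshelve. all: by end_near. Qed.

Lemma smooth_flat n : smooth (flat n).
Proof.
pose S := span (fun f : R -> R => exists m, f = flat m).
have dS f : S f -> exists2 f', S f' & forall t, is_derive t (1 : R) f (f' t).
  elim=> [|a _ g [m ->] _ [g' Sg' dg]].
    by exists (fun=> 0); [exact: span0|move=> t; exact: is_derive_cst].
  exists (fun t => a * (flat m.+2 t - m%:R * flat m.+1 t) + g' t).
    have S1 : S (flat m.+2) by apply: span_gen; exists m.+2.
    have S2 : S (flat m.+1) by apply: span_gen; exists m.+1.
    have := spanD (span_scale a (span_lin 1 (- m%:R) S1 S2)) Sg'.
    by congr (S _); apply/funext => t; ring.
  move=> t; have d1 := is_derive_flat m t; have d2 := dg t.
  by apply: is_derive_eq.
apply: (@smooth_coind _ _ S); last by apply: span_gen; exists n.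
  by move=> f /dS [f' _ df] t; apply/derivable1_diffP; have [] := df t.
move=> f v /dS [f' Sf' df]; rewrite (_ : (fun y => _) = (fun y => v * f' y)).
  exact: span_scale.
apply/funext => y; have dfy : differentiable f y by apply/derivable1_diffP; have [] := df y.
have vE : 'd f y v = v * 'd f y 1.
  by rewrite -[in LHS](mulr1 v) -[v * 1]/(v *: (1 : R)) linearZ.
by rewrite deriveE// vE -deriveE//; have [_ ->] := df y.
Qed.

Definition bump u v t : R := flat 0 (t - u) * flat 0 (v - t).

Lemma smooth_affine (a b : R) : smooth (fun t => a * t + b).
Proof.
apply: (@smooth_primitive _ _ (fun=> a)); last exact: smooth_cst.
by move=> x; apply: is_derive_eq; rewrite addr0 [LHS]mulr1.
Qed.

Lemma smooth_comp_affine (f : R -> R) (a b : R) : smooth f -> smooth (fun t => f (a * t + b)).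
Proof.
move=> sf; apply: (@smooth_coind _ _ (fun h => exists c g, smooth g /\
  h = (fun t => c * g (a * t + b)))).
- move=> _ [c [g [sg ->]]] x; apply: differentiableM; first exact: differentiable_cst.
  apply: (@differentiable_comp _ _ _ _ (fun t => a * t + b) g); last exact: smooth_differentiable.
  exact/smooth_differentiable/smooth_affine.
- move=> _ v [c [g [sg ->]]]; exists (c * v * a), (fun y => 'D_1 g y); split; first exact: smooth_derive.
  apply/funext => x.
  have dg y : is_derive y (1 : R) g ('D_1 g y) by apply: derivableP; exact: smooth_derivable.
  have da : is_derive x (1 : R) (fun t => a * t + b) a.
    by apply: is_derive_eq; rewrite addr0 [LHS]mulr1.
  have dc := @is_derive1_comp _ g (fun t => a * t + b) x _ _ (dg (a * x + b)) da.
  have dcc : is_derive x (1 : R) (fun t => c * g (a * t + b)) (c * ('D_1 g (a * x + b) * a)).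
    by apply: is_derive_eq.
  have df : differentiable (fun t => c * g (a * t + b)) x by apply/derivable1_diffP.
  have vE : 'd (fun t => c * g (a * t + b)) x v = v * 'd (fun t => c * g (a * t + b)) x 1.
    by rewrite -[in LHS](mulr1 v) -[v * 1]/(v *: (1 : R)) linearZ.
  by rewrite deriveE// vE -deriveE//; have [_ ->] := dcc; ring.
- by exists 1, f; split => //; apply/funext => t; rewrite mul1r.
Qed.

Lemma smooth_bump u v : smooth (bump u v).
Proof.
apply: smooth_mul.
  have := smooth_comp_affine 1 (- u) (smooth_flat 0).
  by congr smooth; apply/funext => t; rewrite mul1r.
have := smooth_comp_affine (-1) v (smooth_flat 0).
by congr smooth; apply/funext => t; rewrite mulN1r addrC.
Qed.

Lemma bump_ge0 u v t : 0 <= bump u v t.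
Proof. by rewrite mulr_ge0 ?flat_ge0. Qed.

Lemma bump_gt0 u v t : u < t -> t < v -> 0 < bump u v t.
Proof.
by move=> ut tv; rewrite /bump /flat !subr_gt0 ut tv !expr0 !mul1r mulr_gt0 ?expR_gt0.
Qed.

Lemma bump_out u v t : t <= u \/ v <= t -> bump u v t = 0.
Proof. by rewrite /bump /flat !subr_gt0 => -[/le_gtF ->|/le_gtF ->]; rewrite ?mul0r ?mulr0. Qed.

End Bump.

Section DuBoisReymond.
Context {R : realType}.
Local Notation leb := (@lebesgue_measure R).
Implicit Types (a b f g theta : R -> R) (c p q s t u v : R).

Lemma continuous_integrable_itv f u v : continuous f ->
  leb.-integrable `[u, v] (EFin \o f).
Proof.
move=> cf; apply: continuous_compact_integrable; first exact: segment_compact.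
exact: continuous_subspaceT.
Qed.

Lemma continuous_maxr c : continuous (fun t : R => Num.max t c).
Proof.
rewrite (_ : (fun t => _) = (fun t => (t + c + `|t - c|) / 2)); last first.
  by apply/funext => t; rewrite maxr_absE.
move=> t; apply: cvgM; last exact: cvg_cst.
apply: cvgD; first by apply: cvgD; [exact: cvg_id|exact: cvg_cst].
by apply: cvg_norm; apply: cvgB; [exact: cvg_id|exact: cvg_cst].
Qed.

Lemma Rintegral_gt0 f u v p : continuous f -> (forall t, u <= t <= v -> 0 <= f t) ->
  u < p < v -> 0 < f p -> 0 < \int[leb]_(t in `[u, v]) f t.
Proof.
move=> cf f0 /andP[up pv] fp.
have /cvgrPdist_lt/(_ (f p / 2)) := cf p; rewrite divr_gt0// => /(_ isT).
move=> /nbhs_ballP[e /= e0 He].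
pose d := Num.min (e / 2) (Num.min (p - u) (v - p)).
have d0 : 0 < d by rewrite !lt_min divr_gt0//= !subr_gt0 up pv.
have de : d < e by apply: (@le_lt_trans _ _ (e / 2)); [rewrite ge_min lexx|lra].
have du : d <= p - u by rewrite !ge_min lexx orbT.
have dv : d <= v - p by rewrite !ge_min lexx !orbT.
have fge t : p - d <= t <= p + d -> f p / 2 <= f t.
  move=> /andP[t1 t2]; have : `|f p - f t| < f p / 2.
    by apply: He; rewrite /ball /= ltr_norml; apply/andP; split; lra.
  by rewrite ltr_norml => /andP[]; lra.
have Iuv := continuous_integrable_itv u v cf.
apply: (@lt_le_trans _ _ (\int[leb]_(t in `[p - d, p + d]) (f p / 2))).
  rewrite Rintegral_cst//= lebesgue_measure_itv /= lte_fin.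
  have -> : p - d < p + d by lra.
  by rewrite -EFinB /= mulr_gt0 ?divr_gt0//; lra.
have sub : `[p - d, p + d]%classic `<=` `[u, v]%classic.
  by move=> t /=; rewrite !in_itv /= => /andP[? ?]; apply/andP; split; lra.
rewrite /Rintegral; apply: fine_le.
- apply: integrable_fin_num => //.
  by apply: (@continuous_integrable_itv (fun=> f p / 2)) => x; exact: cvg_cst.
- exact: integrable_fin_num.
apply: (@le_trans _ _ (\int[leb]_(t in `[(p - d)%R, (p + d)%R]) (f t)%:E)%E).
  apply: ge0_le_integral => //.
  - by move=> t _; rewrite lee_fin divr_ge0// ltW.
  - by apply/measurable_EFinP; apply: measurable_funTS; exact: continuous_measurable_fun.
apply: ge0_subset_integral => //.
- by apply/measurable_EFinP; apply: measurable_funTS; exact: continuous_measurable_fun.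
Qed.

Lemma is_derive_primitive f c t : continuous f -> c < t ->
  is_derive t (1 : R) (fun s => \int[leb]_(x in `[c, s]) f x) (f t).
Proof.
move=> cf ct; have t1 : t < t + 1 by rewrite ltrDl.
have [] := @continuous_FTC1_closed _ f c t (t + 1) t1 (continuous_integrable_itv _ _ cf) ct (cf t).
by move=> df; rewrite derive1E => E; split.
Qed.

Lemma integral_bump c u v t : c <= u -> v <= t ->
  \int[leb]_(x in `[c, t]) bump u v x = \int[leb]_(x in `[u, v]) bump u v x.
Proof.
move=> cu vt; rewrite Rintegral_mkcond [RHS]Rintegral_mkcond.
apply: eq_Rintegral => x _; rewrite /patch !mem_setE !in_itv /=.
have [ux|xu] := leP u x; last first.
  by rewrite !andFb; case: ifP => // _; rewrite bump_out//; left; exact: ltW.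
have [xv|vx] := leP x v; last first.
  by rewrite andbF; case: ifP => // _; rewrite bump_out//; right; exact: ltW.
by rewrite (le_trans cu ux) (le_trans xv vt).
Qed.

Lemma integral_bump_gt0 u v : u < v -> 0 < \int[leb]_(x in `[u, v]) bump u v x.
Proof.
move=> uv; apply: (@Rintegral_gt0 _ _ _ ((u + v) / 2)).
- exact/smooth_continuous/smooth_bump.
- by move=> t _; exact: bump_ge0.
- by apply/andP; split; lra.
- by apply: bump_gt0; lra.
Qed.

Definition weak_ode a b c := forall theta, smooth theta ->
  forall p q, c < p -> p < q -> (forall t, t < p \/ q < t -> theta t = 0) ->
  \int[leb]_(t in `[p, q]) (a t * 'D_1 theta t + b t * theta t) = 0.

(** A test function whose derivative is the difference of two normalised bumps
    moves mass from a neighbourhood of p to a neighbourhood of q. *)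
Lemma transport_test c u v u' v' : c < u -> u < v -> v < u' -> u' < v' ->
  exists theta, [/\ smooth theta, forall t, t <= u \/ v' <= t -> theta t = 0 &
   forall t, is_derive t (1 : R) theta
    ((\int[leb]_(x in `[u, v]) bump u v x)^-1 * bump u v t -
     (\int[leb]_(x in `[u', v']) bump u' v' x)^-1 * bump u' v' t)].
Proof.
move=> cu uv vu' uv'; have m0 := integral_bump_gt0 uv; have m'0 := integral_bump_gt0 uv'.
set m := Rintegral _ _ _ in m0 *; set m' := Rintegral _ _ _ in m'0 *.
pose P w z t := \int[leb]_(x in `[c, t]) bump w z x.
have cb w z : continuous (bump w z) by exact/smooth_continuous/smooth_bump.
have P0 w z t : t <= w -> P w z t = 0.
  move=> tw; rewrite /P (@eq_Rintegral _ _ _ _ _ (fun=> 0)).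
    by rewrite Rintegral_cst// mul0r.
  move=> x /set_mem /=; rewrite in_itv /= => /andP[_ xt].
  by rewrite bump_out//; left; exact: le_trans tw.
have dP w z t : c < w -> is_derive t (1 : R) (P w z) (bump w z t).
  move=> cw; have [tw|wt] := ltP t w; last by apply: is_derive_primitive => //; exact: lt_le_trans wt.
  apply: (@near_eq_is_derive _ _ _ (fun=> 0)).
    by near=> s; rewrite P0// ltW//; near: s; exact: lt_nbhsl.
  by rewrite bump_out; [exact: is_derive_cst|left; exact: ltW].
pose theta t := m^-1 * P u v t - m'^-1 * P u' v' t.
have dtheta t : is_derive t (1 : R) theta (m^-1 * bump u v t - m'^-1 * bump u' v' t).
  have d1 := dP u v t cu; have d2 : is_derive t (1 : R) (P u' v') (bump u' v' t) by apply: dP; lra.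
  by apply: is_derive_eq.
exists theta; split => //.
- apply: (smooth_primitive dtheta); have s1 := smooth_scale m^-1 (smooth_bump u v).
  have s2 := smooth_scale (- m'^-1) (smooth_bump u' v').
  have := smooth_add s1 s2; congr smooth; apply/funext => t; ring.
- move=> t [tu|vt]; rewrite /theta.
    by rewrite !P0; [ring|lra|lra].
  rewrite /P !integral_bump; [|lra..].
  by rewrite -/m -/m' !mulVf ?gt_eqF// subrr.
Unshelve. all: by end_near. Qed.

Lemma weak_ode_le a b c : continuous a -> continuous b -> weak_ode a b c ->
  forall p q, c < p -> p < q ->
  a p - \int[leb]_(x in `[c, p]) b x <= a q - \int[leb]_(x in `[c, q]) b x.
Proof.
move=> ca cb H p q cp pq.
pose B t := \int[leb]_(x in `[c, t]) b x; pose A t := a t - B t.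
rewrite -/(B p) -/(B q) -/(A p) -/(A q) leNgt; apply/negP => Aqp.
have dB t : c < t -> is_derive t (1 : R) B (b t) by move=> ct; exact: is_derive_primitive.
have cA t : c < t -> {for t, continuous A}.
  move=> ct; apply: cvgB; first exact: ca.
  by apply/differentiable_continuous/derivable1_diffP; have [] := dB t ct.
pose m := (A p + A q) / 2.
have [d [d0 dc dpq Ap Aq]] : exists d : R, [/\ 0 < d, c < p - d, p + d < q - d,
    forall t, p - d <= t <= p + d -> m < A t & forall t, q - d <= t <= q + d -> A t < m].
  have /cvgrPdist_lt/(_ ((A p - A q) / 2)) := cA p cp.
  have e0 : 0 < (A p - A q) / 2 by rewrite divr_gt0// subr_gt0.
  move=> /(_ e0) /nbhs_ballP[e1 /= e10 He1].
  have cq : c < q by exact: lt_trans pq.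
  have /cvgrPdist_lt/(_ ((A p - A q) / 2)) := cA q cq.
  move=> /(_ e0) /nbhs_ballP[e2 /= e20 He2].
  pose d := Num.min (Num.min e1 e2) (Num.min (p - c) (q - p)) / 3.
  have D0 : 0 < Num.min (Num.min e1 e2) (Num.min (p - c) (q - p)).
    by rewrite !lt_min e10 e20 !subr_gt0 cp pq.
  have d0 : 0 < d by rewrite divr_gt0.
  have d1 : 3 * d <= e1 by rewrite /d mulrC divfK// !ge_min lexx.
  have d2 : 3 * d <= e2 by rewrite /d mulrC divfK// !ge_min lexx !orbT.
  have d3 : 3 * d <= p - c by rewrite /d mulrC divfK// !ge_min lexx !orbT.
  have d4 : 3 * d <= q - p by rewrite /d mulrC divfK// !ge_min lexx !orbT.
  exists d; split; [by []|lra|lra| |].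
  - move=> t /andP[t1 t2]; have : `|A p - A t| < (A p - A q) / 2.
      by apply: He1; rewrite /ball /= ltr_norml; apply/andP; split; lra.
    by rewrite ltr_norml /m => /andP[]; lra.
  - move=> t /andP[t1 t2]; have : `|A q - A t| < (A p - A q) / 2.
      by apply: He2; rewrite /ball /= ltr_norml; apply/andP; split; lra.
    by rewrite ltr_norml /m => /andP[]; lra.
have [theta [sth th0 dth]] : _ := @transport_test c (p - d) (p + d) (q - d) (q + d) dc
  (ltac:(lra)) dpq (ltac:(lra)).
set mp := Rintegral _ _ _ in dth; set mq := Rintegral _ _ _ in dth.
have mp0 : 0 < mp by apply: integral_bump_gt0; lra.
have mq0 : 0 < mq by apply: integral_bump_gt0; lra.
pose eta t := mp^-1 * bump (p - d) (p + d) t - mq^-1 * bump (q - d) (q + d) t.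
have ceta : continuous eta.
  move=> t; apply: cvgB; apply: cvgM; (try exact: cvg_cst);
   exact/smooth_continuous/smooth_bump.
have cth : continuous theta by exact: smooth_continuous.
set P := p - d; set Q := q + d.
have cP : c < P by [].
have PQ : P < Q by rewrite /P /Q; lra.
have thP : theta P = 0 by apply: th0; left.
have thQ : theta Q = 0 by apply: th0; right.
have D1 : 'D_1 theta = eta by apply/funext => t; have [] := dth t.
(* The integral of (A - m) eta vanishes, although its integrand is nonnegative
   and positive at p. *)
have E1 : \int[leb]_(t in `[P, Q]) (a t * eta t + b t * theta t) = 0.
  rewrite -D1; apply: H => // t [tP|Qt]; apply: th0; [left|right]; exact: ltW.
have cF : continuous (fun t => (A (Num.max t P) - m) * eta t).
  move=> t; apply: cvgM; last exact: ceta.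
  apply: cvgB; last exact: cvg_cst.
  apply: (@cvg_comp _ _ _ (fun t => Num.max t P) A _ (nbhs (Num.max t P))).
    exact: continuous_maxr.
  by apply: cA; rewrite lt_max cP orbT.
have : 0 < \int[leb]_(t in `[P, Q]) ((A (Num.max t P) - m) * eta t).
  apply: (@Rintegral_gt0 _ _ _ p cF).
  - move=> t /andP[Pt tQ]; rewrite (max_idPl Pt) /eta.
    have [tp|pt] := leP t (p + d).
      rewrite (@bump_out _ (q - d)); last by left; lra.
      rewrite mulr0 subr0 mulr_ge0//; last by rewrite mulr_ge0 ?bump_ge0// invr_ge0 ltW.
      by rewrite subr_ge0 ltW// Ap// tp andbT.
    rewrite (@bump_out _ (p - d)); last by right; exact: ltW.
    rewrite mulr0 sub0r; have [qt|tq] := leP (q - d) t; last first.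
      by rewrite bump_out ?mulr0 ?oppr0 ?mulr0//; left; exact: ltW.
    rewrite mulrN -mulNr mulr_ge0//; last by rewrite mulr_ge0 ?bump_ge0// invr_ge0 ltW.
    by rewrite oppr_ge0 subr_le0 ltW// Aq// qt.
  - by rewrite /P /Q; apply/andP; split; lra.
  - rewrite (max_idPl _); last by rewrite /P; lra.
    rewrite /eta (@bump_out _ (q - d)); last by left; lra.
    rewrite mulr0 subr0 mulr_gt0//; first by rewrite subr_gt0 Ap//; apply/andP; split; lra.
    by rewrite mulr_gt0 ?invr_gt0// bump_gt0//; lra.
suff -> : \int[leb]_(t in `[P, Q]) ((A (Num.max t P) - m) * eta t) = 0 by rewrite ltxx.
have cBm : continuous (fun t => B (Num.max t P)).
  move=> t; apply: (@cvg_comp _ _ _ (fun t => Num.max t P) B _ (nbhs (Num.max t P))).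
    exact: continuous_maxr.
  have cm : c < Num.max t P by rewrite lt_max cP orbT.
  by apply/differentiable_continuous/derivable1_diffP; have [] := dB _ cm.
pose k t := b t * theta t + (B (Num.max t P) + m) * eta t.
have ck : continuous k.
  move=> t; apply: cvgD; first by apply: cvgM; [exact: cb|exact: cth].
  by apply: cvgM; [apply: cvgD; [exact: cBm|exact: cvg_cst]|exact: ceta].
have k0 : \int[leb]_(t in `[P, Q]) k t = 0.
  pose K t := (B t + m) * theta t.
  have dK t : c < t -> is_derive t (1 : R) K (b t * theta t + (B t + m) * eta t).
    move=> ct; have d1 := dB t ct; have d2 : is_derive t (1 : R) theta (eta t) := dth t.
    have d3 : is_derive t (1 : R) (fun t => B t + m) (b t).
      by apply: is_derive_eq; rewrite addr0.
    by apply: (is_derive_eq (is_deriveM d3 d2)); rewrite /GRing.scale /=; ring.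
  have cK t : c < t -> {for t, continuous K}.
    by move=> ct; apply/differentiable_continuous/derivable1_diffP; have [] := dK t ct.
  rewrite /Rintegral (@continuous_FTC2 _ k K)//.
  - by rewrite /K thP thQ !mulr0 subee.
  - exact/continuous_subspaceT.
  - split.
    + move=> t; rewrite in_itv /= => /andP[Pt _].
      by have [] := dK t (lt_trans cP Pt).
    + by apply: cvg_at_right_filter; exact: cK.
    + by apply: cvg_at_left_filter; apply: cK; exact: lt_trans PQ.
  - move=> t; rewrite in_itv /= => /andP[Pt _].
    rewrite derive1E; have [_ ->] := dK t (lt_trans cP Pt).
    by rewrite /k (max_idPl (ltW Pt)).
have cak : continuous (fun t => a t * eta t + b t * theta t).
  move=> t; apply: cvgD; first by apply: cvgM; [exact: ca|exact: ceta].
  by apply: cvgM; [exact: cb|exact: cth].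
rewrite -[RHS](subrr 0) -[in X in _ = X - _]E1 -[in X in _ = _ - X]k0.
rewrite -RintegralB//; [|exact: continuous_integrable_itv..].
apply: eq_Rintegral => t /set_mem /=; rewrite in_itv /= => /andP[Pt _].
by rewrite /k (max_idPl Pt) /A; ring.
Qed.

Lemma weak_ode_opp a b c : weak_ode a b c -> weak_ode (\- a) (\- b) c.
Proof.
move=> H theta sth p q cp pq th0.
have := H (fun t => - theta t) _ p q cp pq _.
under eq_Rintegral => t _.
  rewrite (_ : 'D_1 (fun t => - theta t) t = - 'D_1 theta t); last first.
    by rewrite (_ : (fun t => _) = - theta)// deriveN//; exact: smooth_derivable.
  rewrite !mulrN -!mulNr.
  over.
apply; last by move=> t /th0 ->; rewrite oppr0.
by have := smooth_scale (-1) sth; under eq_fun do rewrite mulN1r.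
Qed.

Lemma du_bois_reymond a b c : continuous a -> continuous b -> weak_ode a b c ->
  forall t, c < t -> is_derive t (1 : R) a (b t).
Proof.
move=> ca cb H.
have eqA p q : c < p -> p < q ->
    a p - \int[leb]_(x in `[c, p]) b x = a q - \int[leb]_(x in `[c, q]) b x.
  move=> cp pq; apply/eqP; rewrite eq_le (weak_ode_le ca cb H cp pq)/=.
  have can : continuous (\- a) by move=> x; apply: cvgN; exact: ca.
  have cbn : continuous (\- b) by move=> x; apply: cvgN; exact: cb.
  have := weak_ode_le can cbn (weak_ode_opp H) cp pq.
  have N u : \int[leb]_(x in `[c, u]) (\- b) x = - \int[leb]_(x in `[c, u]) b x.
    rewrite -mulN1r -RintegralZl//; last exact: continuous_integrable_itv.
    by apply: eq_Rintegral => x _; rewrite mulN1r.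
  by rewrite !N /=; lra.
move=> t ct; pose c' := (c + t) / 2.
have cc' : c < c' by rewrite /c'; lra.
have c't : c' < t by rewrite /c'; lra.
pose K := a c' - \int[leb]_(x in `[c, c']) b x.
apply: (@near_eq_is_derive _ _ _ (fun s => K + \int[leb]_(x in `[c, s]) b x)).
  near=> s; have c's : c' < s by near: s; exact: lt_nbhsr.
  by rewrite /K (eqA _ s)// subrK.
have d := is_derive_primitive cb ct.
by apply: (is_derive_eq (is_deriveD (is_derive_cst K t 1) d)); rewrite add0r.
Unshelve. all: by end_near. Qed.

End DuBoisReymond.

(** * The velocity and the electric field as functions of the concentrations *)

Section Multipliers.
Context {R : realType}.
Implicit Types (k l : int * int * int) (n : nat).

Lemma sqnorm_flip j k : sqnorm (flip j k) = sqnorm k :> R.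
Proof.
apply: eq_bigr => i _.
rewrite -(real_normK (num_real (coord (flip j k) i)%:~R)) -intr_norm norm_coord_flip.
by rewrite intr_norm real_normK ?num_real.
Qed.

Lemma sqnorm_ge0 k : 0 <= sqnorm k :> R.
Proof. by apply: sumr_ge0 => i _; rewrite sqr_ge0. Qed.

Lemma sqr_coord_le j k : (coord k j)%:~R ^+ 2 <= sqnorm k :> R.
Proof.
by rewrite /sqnorm (bigD1 j)//= lerDl sumr_ge0// => i _; rewrite sqr_ge0.
Qed.

Lemma norm_coord_le_sqr j k : `|(coord k j)%:~R| <= (coord k j)%:~R ^+ 2 :> R.
Proof.
rewrite -(real_normK (num_real (coord k j)%:~R)) -intr_norm.
set m := `|coord k j|; have m0 : 0 <= m by exact: normr_ge0.
rewrite expr2 -intrM ler_int; nia.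
Qed.

Lemma gradient_multiplier j k (p r : R) : sqnorm k * p = r -> `|(coord k j)%:~R * p| <= `|r|.
Proof.
move=> <-; rewrite !normrM ler_wpM2r// (ger0_norm (sqnorm_ge0 k)).
exact: le_trans (norm_coord_le_sqr j k) (sqr_coord_le j k).
Qed.

Lemma norm_coord_mul_le i j k :
  `|(coord k i)%:~R| * `|(coord k j)%:~R| <= sqnorm k :> R.
Proof.
have := sqr_coord_le i k; have := sqr_coord_le j k.
rewrite -(real_normK (num_real (coord k i)%:~R)) -(real_normK (num_real (coord k j)%:~R)).
set x := `|_|; set y := `|_|; have := sqr_ge0 (x - y); nra.
Qed.

Lemma leray_multiplier j k (p : R) (r : 'I_3 -> R) :
  sqnorm k * p = \sum_(l < 3) (coord k l)%:~R * r l ->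
  `|(coord k j)%:~R * p| <= \sum_(l < 3) `|r l|.
Proof.
move=> E; have [s0|s0] := eqVneq (sqnorm k : R) 0.
  have : `|(coord k j)%:~R| <= 0 :> R.
    by rewrite -s0 (le_trans (norm_coord_le_sqr j k))// sqr_coord_le.
  by rewrite normrM normr_le0 => /eqP ->; rewrite normr0 mul0r sumr_ge0.
have sp : 0 < sqnorm k :> R by rewrite lt0r s0 sqnorm_ge0.
rewrite -(ler_pM2l sp) -{1}(gtr0_norm sp) -normrM mulrCA E normrM mulr_sumr.
apply: (le_trans (ler_wpM2l (normr_ge0 _) (ler_norm_sum _ _ _))).
rewrite mulr_sumr; apply: ler_sum => l _.
by rewrite normrM mulrA ler_wpM2r// norm_coord_mul_le.
Qed.

Lemma nrm2_coef_le (f g : R * R * R -> R) : L2 f -> L2 g ->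
  (forall n, \sum_(k <- cube n) coef k f ^+ 2 <= \sum_(k <- cube n) coef k g ^+ 2) ->
  nrm2 f <= nrm2 g.
Proof.
move=> sf sg H; rewrite -(ler_pM2l (@vol_gt0 R)); apply: nrm2_le_coef => // n.
exact: le_trans (H n) (bessel n sg).
Qed.

Lemma nrm2_add_le (f g : R * R * R -> R) : L2 f -> L2 g ->
  nrm2 (fun x => f x + g x) <= 2 * nrm2 f + 2 * nrm2 g.
Proof. exact: (ipDD_le (@measurable_box R)). Qed.

Lemma nrm2Z (a : R) (f : R * R * R -> R) : L2 f -> nrm2 (fun x => a * f x) = a ^+ 2 * nrm2 f.
Proof.
move=> sf; rewrite /nrm2 intT_mulZl//; last exact: L2_scale.
by rewrite intT_mulC intT_mulZl// mulrA expr2.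
Qed.

Lemma nrm2N (f : R * R * R -> R) : nrm2 (fun x => - f x) = nrm2 f.
Proof. by apply: eq_intT => x; rewrite mulrNN. Qed.

Lemma wiener_add (f g : R * R * R -> R) Bf Bg : L2 f -> L2 g -> wiener f Bf -> wiener g Bg ->
  wiener (fun x => f x + g x) (Bf + Bg).
Proof.
move=> sf sg wf wg n; apply: le_trans (lerD (wf n) (wg n)); rewrite -big_split /=.
by apply: ler_sum => k _; rewrite coefD// ler_normD.
Qed.

Lemma wiener_scale a (f : R * R * R -> R) B : L2 f -> wiener f B ->
  wiener (fun x => a * f x) (`|a| * B).
Proof.
move=> sf wf n; under eq_bigr do rewrite coefZ// normrM.
by rewrite -mulr_sumr ler_wpM2l.
Qed.

Lemma wiener_sum (I : Type) (s : seq I) (F : I -> R * R * R -> R) (B : I -> R) :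
  (forall i, L2 (F i)) -> (forall i, wiener (F i) (B i)) ->
  wiener (fun x => \sum_(i <- s) F i x) (\sum_(i <- s) B i).
Proof.
move=> sF wF; elim: s => [|i s IH].
  rewrite big_nil; under eq_fun do rewrite big_nil; move=> n.
  rewrite big1// => k _; rewrite (_ : coef k _ = 0) ?normr0//.
  rewrite /coef (_ : intT _ = intT (fun=> 0)); last by apply: eq_intT => x; rewrite mul0r.
  by rewrite /intT Rintegral_cst ?mul0r//; exact: measurable_box.
rewrite big_cons; under eq_fun do rewrite big_cons.
by apply: wiener_add => //; exact: L2_sum.
Qed.

Lemma nrm2_mul_sub (f f' g g' : R * R * R -> R) Bg Bf' : L2 f -> L2 f' -> L2 g -> L2 g' ->
  wiener g Bg -> wiener f' Bf' -> L2 (fun x => f' x * g' x) ->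
  nrm2 (fun x => f x * g x - f' x * g' x) <=
  2 * (Bg ^+ 2 * nrm2 (fun x => f x - f' x)) + 2 * (Bf' ^+ 2 * nrm2 (fun x => g x - g' x)).
Proof.
move=> sf sf' sg sg' wg wf' sfg'.
have [s1 n1] := L2_mul_wiener (L2_sub sf sf') sg wg.
have [s2 n2] := L2_mul_wiener (L2_sub sg sg') sf' wf'.
have := nrm2_add_le s1 s2.
rewrite (_ : (fun x => _) = (fun x => f x * g x - f' x * g' x)); last by apply/funext => x; ring.
by move=> /le_trans; apply; rewrite lerD// ler_pM2l.
Qed.

End Multipliers.

Section Potential.
Context {R : realType}.
Implicit Types (k : int * int * int) (n : nat) (f g rho q Phi : R * R * R -> R).

Lemma coef_inv_lap T q k : inv_lap T q -> sqnorm k * coef k q = T (hartley k).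
Proof.
move=> [/inH_L2 sq _ /(_ _ (smooth_periodic_hartley k)) <-].
rewrite lap_hartley /coef -intT_mulZl//; last exact: L2_hartley.
by apply: eq_intT => x; ring.
Qed.

Lemma coef_grad_potential rho Phi j k : potential rho Phi ->
  coef k (wderiv j Phi) = - (coord k j)%:~R * coef (flip j k) Phi /\
  sqnorm k * coef (flip j k) Phi = coef (flip j k) rho.
Proof.
move=> pot; split; first by apply: (coef_wderiv (n := 0)); case: pot.
by rewrite -(sqnorm_flip j) (coef_inv_lap _ pot).
Qed.

Lemma L2_grad_potential rho Phi j : potential rho Phi -> L2 (wderiv j Phi).
Proof. by case=> + _ _ => /(inH_weak_deriv j) []. Qed.

Lemma wiener_grad_potential rho Phi j B : potential rho Phi -> wiener rho B ->
  wiener (wderiv j Phi) B.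
Proof.
move=> pot wr n; apply: le_trans (wr n); rewrite -[leRHS](big_flip_cube _ n j) /=.
apply: ler_sum => k _; have [-> E] := coef_grad_potential j k pot.
by rewrite mulNr normrN; exact: gradient_multiplier.
Qed.

Lemma nrm2_grad_potential_sub rho rho' Phi Phi' j : L2 rho -> L2 rho' ->
  potential rho Phi -> potential rho' Phi' ->
  nrm2 (fun x => wderiv j Phi x - wderiv j Phi' x) <= nrm2 (fun x => rho x - rho' x).
Proof.
move=> sr sr' pot pot'.
have s1 := L2_grad_potential j pot; have s2 := L2_grad_potential j pot'.
apply: nrm2_coef_le; [exact: L2_sub|exact: L2_sub|move=> n].
rewrite -[leRHS](big_flip_cube _ n j) /=.
apply: ler_sum => k _; rewrite !coefB//.
have [-> E] := coef_grad_potential j k pot; have [-> E'] := coef_grad_potential j k pot'.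
rewrite -E -E' -mulrBr -mulrBr mulNr sqrrN.
rewrite -(real_normK (num_real (_ * _))) -[leRHS](real_normK (num_real (_ * _))).
by rewrite lerXn2r ?nnegrE// gradient_multiplier.
Qed.

Section Leray.
Variables (F v : 'I_3 -> R * R * R -> R) (q : R * R * R -> R).
Hypotheses (sF : forall j, L2 (F j)) (sv : forall j, L2 (v j)).
Hypothesis Hq : inv_lap (fun phi => - intT (fun x => \sum_(j < 3) F j x * pd j phi x)) q.
Hypothesis Hv : forall j, {ae leb3, forall x, box x -> v j x = F j x + wderiv j q x}.

Lemma intT_pd_hartley f j k : L2 f ->
  intT (fun x => f x * pd j (hartley k) x) = (coord k j)%:~R * coef (flip j k) f.
Proof.
move=> sf; rewrite pd_hartley intT_mulC intT_mulZl//; last exact: L2_hartley.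
by rewrite intT_mulC.
Qed.

Lemma L2_mul_pd_hartley f j k : L2 f -> L2 (fun x => f x * pd j (hartley k) x).
Proof.
move=> sf; rewrite pd_hartley; have := L2_scale (coord k j)%:~R (L2_mul_hartley (flip j k) sf).
by congr L2; apply/funext => x; ring.
Qed.

Lemma intT_sum (I : Type) (s : seq I) (f : I -> R * R * R -> R) :
  (forall i, L2 (f i)) ->
  intT (fun x => \sum_(i <- s) f i x) = \sum_(i <- s) intT (f i).
Proof.
move=> sf; have := @intT_mul_suml R I s f (fun=> 1) sf (L2_cst 1).
have E g : intT (fun x => g x * 1) = intT g :> R by apply: eq_intT => x; rewrite mulr1.
by rewrite E => ->; apply: eq_bigr => i _; rewrite E.
Qed.

Lemma coef_leray_pressure k :
  sqnorm k * coef k q = - \sum_(l < 3) (coord k l)%:~R * coef (flip l k) (F l).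
Proof.
rewrite (coef_inv_lap _ Hq); congr (- _); rewrite intT_sum.
  by apply: eq_bigr => l _; rewrite intT_pd_hartley.
by move=> l; exact: L2_mul_pd_hartley.
Qed.

Lemma L2_wderiv_pressure j : L2 (wderiv j q).
Proof. by case: Hq => /(inH_weak_deriv j) []. Qed.

Lemma coef_leray j k : coef k (v j) = coef k (F j) - (coord k j)%:~R * coef (flip j k) q.
Proof.
have -> : coef k (v j) = coef k (fun x => F j x + wderiv j q x).
  apply: eq_ae_Rintegral.
  - exact: measurable_box.
  - exact: (L2_mul_hartley k (sv j)).1.
  - exact: (L2_mul_hartley k (L2_add (sF j) (L2_wderiv_pressure j))).1.
  - have [A [mA A0 HA]] := Hv j; exists A; split => // x /= Hx.
    by apply: HA => /= H; apply: Hx => Bx; rewrite H.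
rewrite coefD//; last exact: L2_wderiv_pressure.
by rewrite (coef_wderiv (n := 0)); [rewrite mulNr|case: Hq].
Qed.

Lemma leray_remainder j k :
  sqnorm k * coef (flip j k) q =
    \sum_(l < 3) (coord k l)%:~R *
       (if l == j then coef (flip l (flip j k)) (F l) else - coef (flip l (flip j k)) (F l)).
Proof.
rewrite -(sqnorm_flip j) coef_leray_pressure -sumrN; apply: eq_bigr => l _.
have [->|lj] := eqVneq l j; first by rewrite coord_flip mulrNz; ring.
have -> : coord (flip j k) l = coord k l; last by ring.
by move: lj; case: j l => -[|[|[|j]]] Hj [[|[|[|l]]] Hl].
Qed.

End Leray.

End Potential.

Section LeraySub.
Context {R : realType}.
Implicit Types (k : int * int * int) (n : nat).
Variables (F v : 'I_3 -> R * R * R -> R).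
Hypotheses (sF : forall j, L2 (F j)) (lFv : leray F v).

Lemma wiener_leray B j : (forall l, wiener (F l) B) -> wiener (v j) (4 * B).
Proof.
move=> wF n; have [sv [q Hq Hv]] := lFv.
apply: (@le_trans _ _ (\sum_(k <- cube n) (`|coef k (F j)| +
   \sum_(l < 3) `|coef (flip l (flip j k)) (F l)|))).
  apply: ler_sum => k _; rewrite (coef_leray sF sv Hq Hv).
  apply: (le_trans (ler_normB _ _)); rewrite lerD2l.
  apply: (le_trans (leray_multiplier j (leray_remainder sF Hq j k))).
  by apply: ler_sum => l _; case: ifP => // _; rewrite normrN.
rewrite big_split /= exchange_big /= (_ : 4 * B = B + \sum_(l < 3) B); last first.
  by rewrite sumr_const card_ord; ring.
apply: lerD; first exact: wF.
apply: ler_sum => l _; rewrite (big_flip_cube _ n j (fun k => `|coef (flip l k) (F l)|)) /=.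
by rewrite (big_flip_cube _ n l (fun k => `|coef k (F l)|)) /=; exact: wF.
Qed.

End LeraySub.

Section LeraySub2.
Context {R : realType}.
Variables (F v F' v' : 'I_3 -> R * R * R -> R).
Hypotheses (sF : forall j, L2 (F j)) (lFv : leray F v).
Hypotheses (sF' : forall j, L2 (F' j)) (lFv' : leray F' v').

Lemma sqr_sum3_le (a : 'I_3 -> R) : (\sum_(l < 3) a l) ^+ 2 <= 3 * \sum_(l < 3) a l ^+ 2.
Proof.
rewrite !big_ord_recl !big_ord0; set a0 := a _; set a1 := a _; set a2 := a _.
have := sqr_ge0 (a0 - a1); have := sqr_ge0 (a0 - a2); have := sqr_ge0 (a1 - a2); nra.
Qed.

Lemma nrm2_leray_sub j C : (forall l, nrm2 (fun x => F l x - F' l x) <= C) ->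
  nrm2 (fun x => v j x - v' j x) <= 20 * C.
Proof.
move=> FC; have [sv [q Hq Hv]] := lFv; have [sv' [q' Hq' Hv']] := lFv'.
have v0 := @vol_gt0 R.
pose d l k := coef k (fun x => F l x - F' l x).
have dC l n : \sum_(k <- cube n) d l k ^+ 2 <= vol * C.
  apply: (le_trans (bessel n (L2_sub (sF l) (sF' l)))).
  by rewrite ler_pM2l.
rewrite -(ler_pM2l v0); apply: nrm2_le_coef => [|n]; first exact: L2_sub.
apply: (@le_trans _ _ (\sum_(k <- cube n) (2 * d j k ^+ 2 +
   6 * \sum_(l < 3) d l (flip l (flip j k)) ^+ 2))).
  apply: ler_sum => k _; rewrite coefB// (coef_leray sF sv Hq Hv) (coef_leray sF' sv' Hq' Hv').
  set p := coef (flip j k) q; set p' := coef (flip j k) q'.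
  have E : sqnorm k * (p - p') = \sum_(l < 3) (coord k l)%:~R *
      (if l == j then d l (flip l (flip j k)) else - d l (flip l (flip j k))).
    rewrite mulrBr (leray_remainder sF Hq) (leray_remainder sF' Hq') -sumrB.
    apply: eq_bigr => l _; rewrite -mulrBr; congr (_ * _).
    by case: ifP => _; rewrite /d coefB//; ring.
  have H := leray_multiplier j E.
  have {}H : ((coord k j)%:~R * (p - p')) ^+ 2 <= 3 * \sum_(l < 3) d l (flip l (flip j k)) ^+ 2.
    rewrite -(real_normK (num_real _)).
    apply: (@le_trans _ _ ((\sum_(l < 3) `|d l (flip l (flip j k))|) ^+ 2)).
      rewrite lerXn2r ?nnegrE ?sumr_ge0//; apply: (le_trans H).
      by apply: ler_sum => l _; case: ifP => // _; rewrite normrN.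
    apply: (le_trans (sqr_sum3_le _)); rewrite ler_pM2l//.
    by apply: ler_sum => l _; rewrite real_normK ?num_real.
  have <- : coef k (F j) - coef k (F' j) = d j k by rewrite /d coefB.
  set f := coef k (F j); set f' := coef k (F' j); set c := (coord k j)%:~R.
  have := sqr_ge0 ((f - f') + c * (p - p')).
  rewrite -/c in H; nra.
rewrite big_split /= -!mulr_sumr exchange_big /=.
have S : \sum_(l < 3) \sum_(k <- cube n) d l (flip l (flip j k)) ^+ 2 <= \sum_(l < 3) vol * C.
  apply: ler_sum => l _; rewrite (big_flip_cube _ n j (fun k => d l (flip l k) ^+ 2)) /=.
  by rewrite (big_flip_cube _ n l (fun k => d l k ^+ 2)) /=; exact: dC.
rewrite sumr_const card_ord -mulr_natl in S.
by have := dC j n; move: S; set X := \sum_(_ < _) _; set Y := \sum_(_ <- _) _; lra.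
Qed.

End LeraySub2.

Section Static.
Context {R : realType}.
Variables (N : nat) (D : R) (z : 'I_N -> R) (rhot : R * R * R -> R) (B Brho : R).
Hypotheses (spr : smooth_periodic rhot) (wrho : wiener rhot Brho).
Implicit Types (w : 'I_N -> R * R * R -> R).

Definition admissible w (Phi : R * R * R -> R) (u : 'I_3 -> R * R * R -> R) : Prop :=
  [/\ forall i, L2 (w i), forall i, wiener (w i) B,
      potential (total_charge z rhot w) Phi &
      leray (fun j x => total_charge z rhot w x * wderiv j Phi x) (fun j x => - u j x)].

Definition charge_bound : R := \sum_(i < N) `|z i| * B + Brho.

Definition dist2 w w' : R := \sum_(i < N) nrm2 (fun x => w i x - w' i x).

Lemma dist2_ge0 w w' : 0 <= dist2 w w'.
Proof. by apply: sumr_ge0 => i _; exact: nrm2_ge0. Qed.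

Definition charge_lip : R := 2 ^+ N * \sum_(i < N) z i ^+ 2.

Definition flux w (Phi : R * R * R -> R) (u : 'I_3 -> R * R * R -> R) i j x : R :=
  w i x * u j x - z i * D * (w i x * wderiv j Phi x).

Section OneState.
Variables (w : 'I_N -> R * R * R -> R) (Phi : R * R * R -> R) (u : 'I_3 -> R * R * R -> R).
Hypothesis adm : admissible w Phi u.

Lemma L2_total_charge : L2 (total_charge z rhot w).
Proof.
case: adm => sw _ _ _; apply: L2_add; last exact: smooth_periodic_L2.
by apply: L2_sum => i; exact: L2_scale.
Qed.

Lemma wiener_total_charge : wiener (total_charge z rhot w) charge_bound.
Proof.
case: adm => sw ww _ _; apply: wiener_add => //.
- by apply: L2_sum => i; exact: L2_scale.
- exact: smooth_periodic_L2.
- by apply: wiener_sum => i; [exact: L2_scale|exact: wiener_scale].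
Qed.

Lemma L2_force j : L2 (fun x => total_charge z rhot w x * wderiv j Phi x).
Proof.
case: adm => _ _ pot _.
have [H _] := L2_mul_wiener L2_total_charge (L2_grad_potential j pot)
  (wiener_grad_potential j pot wiener_total_charge).
exact: H.
Qed.

Lemma wiener_force j :
  wiener (fun x => total_charge z rhot w x * wderiv j Phi x) (charge_bound * charge_bound).
Proof.
case: adm => _ _ pot _; apply: wiener_mul; [exact: L2_total_charge| |exact: wiener_total_charge|].
  exact: L2_grad_potential pot.
exact: (wiener_grad_potential j pot wiener_total_charge).
Qed.

Lemma L2_velocity j : L2 (u j).
Proof.
case: adm => _ _ _ [/(_ j) /L2_opp su _]; move: su.
by under eq_fun do rewrite opprK.
Qed.

Lemma wiener_velocity j : wiener (u j) (4 * (charge_bound * charge_bound)).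
Proof.
case: adm => _ _ _ lr; have := wiener_leray L2_force lr j wiener_force.
move=> H n; apply: le_trans (H n); apply: ler_sum => k _.
by rewrite coefN ?normrN//; exact: L2_velocity.
Qed.

Lemma L2_convection i j : L2 (fun x => w i x * u j x).
Proof.
case: adm => sw _ _ _.
by have [H _] := L2_mul_wiener (sw i) (L2_velocity j) (@wiener_velocity j); exact: H.
Qed.

Lemma L2_drift i j : L2 (fun x => w i x * wderiv j Phi x).
Proof.
case: adm => sw _ pot _.
have [H _] := L2_mul_wiener (sw i) (L2_grad_potential j pot)
  (wiener_grad_potential j pot wiener_total_charge).
exact: H.
Qed.

Lemma L2_flux i j : L2 (flux w Phi u i j).
Proof. by apply: L2_sub; [exact: L2_convection|apply: L2_scale; exact: L2_drift]. Qed.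

End OneState.

Lemma flux_lipschitz : exists2 L, 0 <= L & forall w Phi u w' Phi' u',
  admissible w Phi u -> admissible w' Phi' u' -> forall i j,
  nrm2 (fun x => flux w Phi u i j x - flux w' Phi' u' i j x) <= L * dist2 w w'.
Proof.
pose M := charge_bound; pose K := charge_lip.
have K0 : 0 <= K.
  by rewrite mulr_ge0 ?exprn_ge0// sumr_ge0// => i _; rewrite sqr_ge0.
pose LF := 4 * M ^+ 2 * K; have LF0 : 0 <= LF by rewrite /LF; have := mulr_ge0 (sqr_ge0 M) K0; lra.
pose L1 := 2 * ((4 * (M * M)) ^+ 2) + 2 * (B ^+ 2 * (20 * LF)).
pose L2' := 2 * M ^+ 2 + 2 * (B ^+ 2 * K).
pose zD := \sum_(i < N) (z i * D) ^+ 2.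
have zD0 : 0 <= zD by apply: sumr_ge0 => i _; exact: sqr_ge0.
have L10 : 0 <= L1 by rewrite /L1; have := sqr_ge0 (4 * (M * M)); have := mulr_ge0 (sqr_ge0 B) LF0; lra.
have L20 : 0 <= L2' by rewrite /L2'; have := sqr_ge0 M; have := mulr_ge0 (sqr_ge0 B) K0; lra.
exists (2 * L1 + 2 * (zD * L2')); first by have := mulr_ge0 zD0 L20; lra.
move=> w Phi u w' Phi' u' adm adm' i j.
have sr := L2_total_charge adm; have sr' := L2_total_charge adm'.
have wr := wiener_total_charge adm; have wr' := wiener_total_charge adm'.
have [sw ww pot lr] := adm; have [sw' ww' pot' lr'] := adm'.
pose d := dist2 w w'; have d0 : 0 <= d := dist2_ge0 w w'.
have nrho : nrm2 (fun x => total_charge z rhot w x - total_charge z rhot w' x) <= K * d.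
  have -> : nrm2 (fun x => total_charge z rhot w x - total_charge z rhot w' x) =
      nrm2 (fun x => \sum_(i < N) z i * (w i x - w' i x)).
    congr nrm2; apply/funext => x; rewrite /total_charge opprD addrACA subrr addr0 -sumrB.
    by apply: eq_bigr => l _; rewrite mulrBr.
  have := @ip_sum_le _ _ R leb3 (@box R) (@measurable_box R) _ (index_enum 'I_N)
    (fun l x => z l * (w l x - w' l x)) (fun l => L2_scale (z l) (L2_sub (sw l) (sw' l))).
  move=> /le_trans; apply; rewrite /K /charge_lip -mulrA.
  rewrite (_ : size _ = N); last by rewrite /index_enum -enumT size_enum_ord.
  rewrite ler_wpM2l ?exprn_ge0// mulr_suml; apply: ler_sum => l _.
  have -> : ip leb3 (@box R) (fun x => z l * (w l x - w' l x)) (fun x => z l * (w l x - w' l x)) =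
    nrm2 (fun x => z l * (w l x - w' l x)) by [].
  rewrite nrm2Z; last exact: L2_sub.
  rewrite ler_wpM2l ?sqr_ge0// /d /dist2 (bigD1 l)//= lerDl.
  by apply: sumr_ge0 => m _; exact: nrm2_ge0.
have ngrad l : nrm2 (fun x => wderiv l Phi x - wderiv l Phi' x) <= K * d.
  exact: le_trans (nrm2_grad_potential_sub l sr sr' pot pot') nrho.
have sg l := L2_grad_potential l pot; have sg' l := L2_grad_potential l pot'.
have wg l : wiener (wderiv l Phi) M := wiener_grad_potential l pot wr.
have nF l : nrm2 (fun x => total_charge z rhot w x * wderiv l Phi x -
    total_charge z rhot w' x * wderiv l Phi' x) <= LF * d.
  have := nrm2_mul_sub sr sr' (sg l) (sg' l) (wg l) wr' (L2_force adm' l).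
  move=> /le_trans; apply.
  have := ler_wpM2l (sqr_ge0 M) nrho; have := ler_wpM2l (sqr_ge0 M) (ngrad l).
  by rewrite /LF -/M; lra.
have nu : nrm2 (fun x => u j x - u' j x) <= 20 * LF * d.
  have := nrm2_leray_sub (L2_force adm) lr (L2_force adm') lr' j nF.
  rewrite -mulrA; apply: le_trans; rewrite -nrm2N le_eqVlt; apply/orP; left; apply/eqP.
  by congr nrm2; apply/funext => x; ring.
have nw : nrm2 (fun x => w i x - w' i x) <= d.
  by rewrite /d /dist2 (bigD1 i)//= lerDl sumr_ge0// => m _; exact: nrm2_ge0.
have nconv : nrm2 (fun x => w i x * u j x - w' i x * u' j x) <= L1 * d.
  have := nrm2_mul_sub (sw i) (sw' i) (L2_velocity adm j) (L2_velocity adm' j)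
    (wiener_velocity adm j) (ww' i) (L2_convection adm' i j).
  move=> /le_trans; apply.
  have := ler_wpM2l (sqr_ge0 (4 * (M * M))) nw; have := ler_wpM2l (sqr_ge0 B) nu.
  by rewrite /L1 -/M; lra.
have ndrift : nrm2 (fun x => w i x * wderiv j Phi x - w' i x * wderiv j Phi' x) <= L2' * d.
  have := nrm2_mul_sub (sw i) (sw' i) (sg j) (sg' j) (wg j) (ww' i) (L2_drift adm' i j).
  move=> /le_trans; apply.
  have := ler_wpM2l (sqr_ge0 M) nw; have := ler_wpM2l (sqr_ge0 B) (ngrad j).
  by rewrite /L2'; lra.
have sc := L2_sub (L2_convection adm i j) (L2_convection adm' i j).
have sd := L2_sub (L2_drift adm i j) (L2_drift adm' i j).
have := nrm2_add_le sc (L2_scale (- (z i * D)) sd).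
rewrite (_ : (fun x => _) = (fun x => flux w Phi u i j x - flux w' Phi' u' i j x)); last first.
  by apply/funext => x; rewrite /flux; ring.
move=> /le_trans; apply; rewrite nrm2Z// sqrrN.
have zz : (z i * D) ^+ 2 * nrm2 (fun x => w i x * wderiv j Phi x - w' i x * wderiv j Phi' x) <=
    zD * (L2' * d).
  apply: ler_pM => //; [exact: sqr_ge0|exact: nrm2_ge0|].
  by rewrite /zD (bigD1 i)//= lerDl sumr_ge0// => m _; exact: sqr_ge0.
by move: nconv zz; rewrite -/d; lra.
Qed.

End Static.

Section DivergenceFree.
Context {R : realType}.
Implicit Types (k : int * int * int) (n : nat) (f g h : R * R * R -> R).

Lemma smooth_periodic_proj n f : smooth_periodic (proj n f).
Proof.
split.
  apply: smooth_scale; apply: smooth_sum => k; apply: smooth_scale.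
  exact: (smooth_periodic_hartley k).1.
move=> j x; rewrite /proj; congr (_ * _); apply: eq_bigr => k _.
by rewrite (smooth_periodic_hartley k).2.
Qed.

Lemma pd_sum j (I : Type) (s : seq I) (F : I -> R * R * R -> R) : (forall i, smooth (F i)) ->
  pd j (fun x => \sum_(i <- s) F i x) = (fun x => \sum_(i <- s) pd j (F i) x).
Proof.
move=> sF; elim: s => [|i s IH].
  apply/funext => x; rewrite big_nil /pd.
  rewrite (_ : (fun _ => _) = cst 0); last by apply/funext => y; rewrite big_nil.
  by rewrite derive_cst.
apply/funext => x; rewrite big_cons -[X in _ = _ + X](congr1 (@^~ x) IH) /pd.
rewrite (_ : (fun _ => _) = F i + (fun x => \sum_(i <- s) F i x)); last first.
  by apply/funext => y; rewrite big_cons.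
by rewrite deriveD//; apply: smooth_derivable => //; exact: smooth_sum.
Qed.

Lemma pd_proj j n f : inH 1 f -> pd j (proj n f) = proj n (wderiv j f).
Proof.
move=> Hf; have sh k : smooth (hartley k : R * R * R -> R) := (smooth_periodic_hartley k).1.
rewrite /proj pd_scale; last by apply: smooth_sum => k; exact: smooth_scale.
rewrite pd_sum; last by move=> k; exact: smooth_scale.
apply/funext => x; congr (_ * _); rewrite -[RHS](big_flip_cube _ n j) /=.
apply: eq_bigr => k _; rewrite pd_scale// pd_hartley (coef_wderiv (n := 0))// flipK coord_flip.
rewrite mulrNz; ring.
Qed.

Lemma intTD f g : L2 f -> L2 g -> intT (fun x => f x + g x) = intT f + intT g.
Proof.
move=> sf sg; apply: RintegralD; first exact: measurable_box.
- exact: (sqint_integrable (@measurable_box R) leb3_box_lty sf).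
- exact: (sqint_integrable (@measurable_box R) leb3_box_lty sg).
Qed.

Lemma intTZ a f : L2 f -> intT (fun x => a * f x) = a * intT f.
Proof.
move=> sf; apply: RintegralZl; first exact: measurable_box.
exact: (sqint_integrable (@measurable_box R) leb3_box_lty sf).
Qed.

Lemma L2_mul_smooth f phi : L2 f -> smooth_periodic phi -> L2 (fun x => f x * phi x).
Proof.
move=> sf sp; have [C HC] := continuous_bounded_box (smooth_continuous sp.1).
exact: (sqint_mul_bounded (@measurable_box R) sf (smooth_periodic_L2 sp).1 HC).
Qed.

Lemma leray_div_free (F v : 'I_3 -> R * R * R -> R) phi : (forall j, L2 (F j)) ->
  leray F v -> smooth_periodic phi -> \sum_(j < 3) intT (fun x => v j x * pd j phi x) = 0.
Proof.
move=> sF [sv [q [Hq q0 Tq] Hv]] sphi.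
have sp j := smooth_periodic_pd j sphi; have Lp j := smooth_periodic_L2 (sp j).
have wq j : weak_deriv j q (wderiv j q) := inH_weak_deriv j Hq.
have vE j : intT (fun x => v j x * pd j phi x) =
    intT (fun x => F j x * pd j phi x) - intT (fun x => q x * pd j (pd j phi) x).
  have [swq /(_ _ (sp j)) ->] := wq j; rewrite opprK -intT_mulDl//.
  apply: eq_ae_Rintegral.
  - exact: measurable_box.
  - by apply: measurable_funM; [exact: (sv j).1|exact: (Lp j).1].
  - by apply: measurable_funM; [exact: (L2_add (sF j) swq).1|exact: (Lp j).1].
  - have [A [mA A0 HA]] := Hv j; exists A; split => // x /= Hx.
    by apply: HA => /= H; apply: Hx => Bx; rewrite H.
have sq := inH_L2 Hq; have Lpp j := smooth_periodic_pd j (sp j).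
under eq_bigr do rewrite vE; rewrite sumrB.
have Llap : L2 (fun x => q x * - lap phi x).
  have := L2_opp (L2_sum (index_enum 'I_3) (fun j => L2_mul_smooth sq (Lpp j))).
  by congr L2; apply/funext => x; rewrite mulrN mulr_sumr.
have E1 := intT_sum (index_enum 'I_3) (fun j => L2_mul_smooth sq (Lpp j)).
have E2 := intT_sum (index_enum 'I_3) (fun j => L2_mul_smooth (sF j) (sp j)).
have E3 : intT (fun x => \sum_(j < 3) q x * pd j (pd j phi) x) =
    - intT (fun x => q x * - lap phi x).
  rewrite -mulN1r -(intTZ (-1) Llap).
  by apply: eq_intT => x; rewrite mulN1r mulrN opprK mulr_sumr.
have E4 := Tq phi sphi.
apply/eqP; rewrite subr_eq0; apply/eqP.
apply: (etrans (esym E2)); apply: (etrans _ E1).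
by apply: (etrans _ (esym E3)); rewrite E4 opprK.
Qed.

(** Integration by parts against the divergence-free velocity. *)
Lemma convection_by_parts (F v : 'I_3 -> R * R * R -> R) Bv c k : (forall j, L2 (F j)) ->
  leray F v -> (forall j, wiener (v j) Bv) -> inH 1 c ->
  \sum_(j < 3) coef k (fun x => v j x * wderiv j c x) =
  - \sum_(j < 3) (coord k j)%:~R * coef (flip j k) (fun x => c x * v j x).
Proof.
move=> sF lr wv Hc; have sc := inH_L2 Hc; have [sv _] := lr.
have swc j : L2 (wderiv j c) by case: (inH_weak_deriv j Hc).
have eq_n n : \sum_(j < 3) coef k (fun x => v j x * proj n (wderiv j c) x) =
  - \sum_(j < 3) (coord k j)%:~R * coef (flip j k) (fun x => proj n c x * v j x).
  apply/eqP; rewrite -addr_eq0 -big_split /=; apply/eqP.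
  have spc := smooth_periodic_proj n c.
  rewrite -[RHS](leray_div_free sF lr (smooth_periodic_mul spc (smooth_periodic_hartley k))).
  apply: eq_bigr => j _.
  transitivity (intT (fun x => v j x * pd j (proj n c) x * hartley k x +
      v j x * proj n c x * pd j (hartley k) x)).
    rewrite intTD.
    - congr (_ + _); first by rewrite pd_proj.
      rewrite intT_pd_hartley; last by apply: L2_mul_smooth.
      by congr (_ * _); apply: eq_intT => x; rewrite (mulrC (v j x)).
    - apply: L2_mul_hartley; apply: L2_mul_smooth => //; exact: smooth_periodic_pd.
    - by apply: L2_mul_pd_hartley; exact: L2_mul_smooth.
  apply: eq_intT => x; rewrite pd_mul; [ring|exact: spc.1|exact: smooth_hartley].
have cvg_sum (u : nat -> 'I_3 -> R) (l : 'I_3 -> R) : (forall j, (fun n => u n j) @ \oo --> l j) ->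
    (fun n => \sum_(j < 3) u n j) @ \oo --> \sum_(j < 3) l j.
  move=> H; elim: (index_enum _) => [|j s IH].
    by rewrite big_nil; under eq_fun do rewrite big_nil; exact: cvg_cst.
  rewrite big_cons; under eq_fun do rewrite big_cons.
  by apply: cvgD => //; exact: H.
have lim1 : (fun n => \sum_(j < 3) coef k (fun x => v j x * proj n (wderiv j c) x)) @ \oo -->
    \sum_(j < 3) coef k (fun x => v j x * wderiv j c x).
  apply: cvg_sum => j; rewrite /coef.
  under [X in _ --> intT X]eq_fun do rewrite (mulrC (v j _)) -mulrA.
  under [X in X @ _]eq_fun do under eq_fun do rewrite (mulrC (v j _)) -mulrA.
  by apply: proj_weak_cvg => //; exact: L2_mul_hartley.
have lim2 : (fun n => - \sum_(j < 3) (coord k j)%:~R * coef (flip j k) (fun x => proj n c x * v j x)) @ \oo -->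
    - \sum_(j < 3) (coord k j)%:~R * coef (flip j k) (fun x => c x * v j x).
  apply: cvgN; apply: cvg_sum => j; apply: cvgM; first exact: cvg_cst.
  rewrite /coef; under [X in _ --> intT X]eq_fun do rewrite -mulrA.
  under [X in X @ _]eq_fun do under eq_fun do rewrite -mulrA.
  by apply: proj_weak_cvg => //; exact: L2_mul_hartley.
rewrite (funext eq_n) in lim1.
exact: (cvg_unique _ lim1 lim2).
Qed.

End DivergenceFree.

(** * The absorbing ball *)

Section Ball.
Context {R : realType}.
Implicit Types (k : int * int * int) (n : nat) (f : R * R * R -> R).
Variables (N : nat) (z : 'I_N -> R) (rhot : R * R * R -> R) (M rad : R).
Hypothesis hM : 0 < M.

Lemma hartley0 : hartley (0, 0, 0) = (fun=> 1) :> (R * R * R -> R).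
Proof. by apply/funext => x; rewrite /hartley /cas /= !mul0r cos0 sin0 addr0 !mulr1. Qed.

Lemma coef_cst k (c : R) : coef k (fun=> c) = c * vol * (k == (0, 0, 0))%:R.
Proof.
transitivity (c * coef k (hartley (0, 0, 0))); last first.
  by rewrite coef_hartley eq_sym mulrA.
rewrite -coefZ; last exact: L2_hartley.
by congr (coef k _); apply/funext => x; rewrite hartley0 mulr1.
Qed.

Lemma wiener_cst (c : R) : wiener (fun=> c) (`|c| * vol).
Proof.
move=> n; have v0 := @vol_gt0 R.
have c0 : (0, 0, 0) \in cube n by rewrite mem_cube; apply/forallP; case=> -[|[|[|m]]].
rewrite (bigD1_seq (0, 0, 0)) ?cube_uniq//= big1 ?addr0.
  by rewrite coef_cst eqxx mulr1 normrM (gtr0_norm v0).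
by move=> k /negbTE k0; rewrite coef_cst k0 mulr0 normr0.
Qed.

Lemma intT_ge0_ae f : L2 f -> {ae leb3, forall x, box x -> 0 <= f x} -> 0 <= intT f.
Proof.
move=> sf f0; have -> : intT f = intT (fun x => `|f x|).
  apply: eq_ae_Rintegral.
  - exact: measurable_box.
  - exact: sf.1.
  - by apply: measurableT_comp; [exact: normr_measurable|exact: sf.1].
  - have [A [mA A0 HA]] := f0; exists A; split => // x /= Hx.
    by apply: HA => /= H; apply: Hx => Bx; rewrite ger0_norm// H.
by apply: Rintegral_ge0 => x _.
Qed.

Lemma quartic_flip0 : quartic (0, 0, 0) = 0 :> R.
Proof. by rewrite /quartic big1// => -[[|[|[|m]]] Hm] _ //; rewrite /coord /= expr0n. Qed.

Section Member.
Variables (w : 'I_N -> R * R * R -> R) (i : 'I_N).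
Hypothesis Bw : BM z rhot M rad w.

Let dev x := w i x - avg (w i).

Lemma BM_inH2 : inH 2 (w i). Proof. by case: Bw. Qed.

Lemma BM_L2 : L2 (w i). Proof. exact: inH_L2 BM_inH2. Qed.

Let inH2_dev : inH 2 dev. Proof. exact: inH_sub BM_inH2 (inH_cst _ _). Qed.

Let sqHnorm_dev : sqHnorm 2 dev <= rad ^+ 2.
Proof.
case: Bw => _ _ Hs; rewrite -sqr_Hnorm.
have H0 f : 0 <= Hnorm 2 f by exact: sqrtr_ge0.
have Hi : Hnorm 2 dev <= rad.
  by apply: le_trans Hs; rewrite (bigD1 i)//= lerDl sumr_ge0.
by rewrite lerXn2r ?nnegrE// (le_trans (H0 dev)).
Qed.

Let weighted_dev n :
  \sum_(k <- cube n) (1 + quartic k) * coef k dev ^+ 2 <= vol * rad ^+ 2.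
Proof.
apply: (le_trans (sqHnorm2_coef n inH2_dev)).
by rewrite ler_pM2l ?vol_gt0.
Qed.

Definition BM_bound : R := Num.sqrt (53 * (vol * rad ^+ 2)) + M.

Lemma BM_wiener : wiener (w i) BM_bound.
Proof.
have v0 := @vol_gt0 R; have sw := BM_L2.
have wd : wiener dev (Num.sqrt (53 * (vol * rad ^+ 2))) by apply: sobolev_wiener; exact: weighted_dev.
have := wiener_add (inH_L2 inH2_dev) (L2_cst (avg (w i))) wd (wiener_cst (avg (w i))).
rewrite (_ : (fun x => _) = w i); last by apply/funext => x; rewrite /dev subrK.
move=> H n; apply: (le_trans (H n)); rewrite lerD2l.
have [[[_ pos _] le_mass] _ _] := Bw.
rewrite /avg -/vol normrM normfV (gtr0_norm v0) divfK ?gt_eqF//.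
by rewrite ger0_norm// intT_ge0_ae.
Qed.

Lemma BM_quartic n : \sum_(k <- cube n) quartic k * coef k (w i) ^+ 2 <= vol * rad ^+ 2.
Proof.
apply: le_trans (weighted_dev n); apply: ler_sum => k _.
have sw := BM_L2; have [->|k0] := eqVneq k (0, 0, 0).
  by rewrite quartic_flip0 mul0r mulr_ge0 ?sqr_ge0// addr0.
have -> : coef k dev = coef k (w i).
  by rewrite coefB ?coef_cst ?(negbTE k0) ?mulr0 ?subr0//; exact: L2_cst.
by rewrite ler_wpM2r ?sqr_ge0// lerDr.
Qed.

End Member.

Lemma wiener_nrm2 f B : L2 f -> wiener f B -> nrm2 f <= B ^+ 2 * vol.
Proof.
move=> sf wf; have [_] := L2_mul_wiener (L2_cst 1) sf wf.
have -> : nrm2 (fun x => 1 * f x) = nrm2 f by apply: eq_intT => x; rewrite mul1r.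
have -> : nrm2 (fun=> 1 : R) = vol; last by [].
rewrite -{1}hartley0.
have := @coef_hartley R (0,0,0) (0,0,0); rewrite eqxx mulr1 => <-.
by [].
Qed.

Lemma BM_dist2 w w' : BM z rhot M rad w -> BM z rhot M rad w' ->
  dist2 w w' <= N%:R * (4 * (BM_bound ^+ 2 * vol)).
Proof.
move=> Bw Bw'; rewrite /dist2 (_ : N%:R * _ = \sum_(i < N) (4 * (BM_bound ^+ 2 * vol))).
  apply: ler_sum => i _; have sw := BM_L2 i Bw; have sw' := BM_L2 i Bw'.
  have := nrm2_add_le sw (L2_opp sw'); rewrite nrm2N.
  have := wiener_nrm2 sw (BM_wiener i Bw); have := wiener_nrm2 sw' (BM_wiener i Bw').
  by lra.
by rewrite sumr_const card_ord mulr_natl.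
Qed.

End Ball.

(** * The ordinary differential equations of the Fourier coefficients *)

Section Coefficients.
Context {R : realType}.
Variables (N : nat) (D : R) (z : 'I_N -> R) (rhot : R * R * R -> R) (B Brho : R).
Hypotheses (spr : smooth_periodic rhot) (wrho : wiener rhot Brho).

Definition coef_rhs (w : state N) (Phi : R * R * R -> R) (u : 'I_3 -> R * R * R -> R) i k : R :=
  - (D * sqnorm k * coef k (w i)) +
  \sum_(j < 3) (coord k j)%:~R * coef (flip j k) (flux D z w Phi u i j).

Lemma weak_form_hartley w Phi u i k (th th' : R) :
  admissible z rhot B w Phi u -> inH 1 (w i) ->
  intT (fun x => - (w i x * (th' * hartley k x))
     + (\sum_(j < 3) u j x * wderiv j (w i) x) * (th * hartley k x)
     - D * (w i x * (th * (- sqnorm k * hartley k x)))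
     + z i * D * (\sum_(j < 3) w i x * wderiv j Phi x * (th * pd j (hartley k) x))) =
  - (coef k (w i) * th' + coef_rhs w Phi u i k * th).
Proof.
move=> adm Hw; have [sw ww pot lr] := adm.
have su j : L2 (u j) := L2_velocity adm j.
have swu j : L2 (wderiv j (w i)) by case: (inH_weak_deriv j Hw).
have suw j : L2 (fun x => u j x * wderiv j (w i) x).
  have [H _] := L2_mul_wiener (swu j) (su j) (fun n => wiener_velocity spr wrho adm j n).
  by have := H; congr L2; apply/funext => x; rewrite mulrC.
have sA : L2 (fun x => w i x * hartley k x) := L2_mul_hartley k (sw i).
have sB j : L2 (fun x => u j x * wderiv j (w i) x * hartley k x) := L2_mul_hartley k (suw j).
have sd j : L2 (fun x => w i x * wderiv j Phi x) := L2_drift spr wrho adm i j.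
have sc j : L2 (fun x => w i x * u j x) := L2_convection spr wrho adm i j.
have sC j : L2 (fun x => w i x * wderiv j Phi x * pd j (hartley k) x) := L2_mul_pd_hartley j k (sd j).
have sSB := L2_sum (index_enum 'I_3) sB; have sSC := L2_sum (index_enum 'I_3) sC.
transitivity (intT (fun x => (- th' + D * th * sqnorm k) * (w i x * hartley k x) +
   (th * (\sum_(j < 3) u j x * wderiv j (w i) x * hartley k x) +
    (z i * D * th) * (\sum_(j < 3) w i x * wderiv j Phi x * pd j (hartley k) x)))).
  apply: eq_intT => x; rewrite -mulr_suml.
  under [X in _ + _ * _ * X = _]eq_bigr do rewrite mulrCA.
  by rewrite -mulr_sumr; ring.
rewrite intTD; [|exact: L2_scale|by apply: L2_add; exact: L2_scale].
rewrite intTD; [|exact: L2_scale|exact: L2_scale].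
rewrite (intTZ _ sA) (intTZ _ sSB) (intTZ _ sSC).
rewrite (intT_sum _ sB) (intT_sum _ sC).
under [X in _ + (_ + _ * X) = _]eq_bigr do rewrite intT_pd_hartley//.
have EB : \sum_(j < 3) intT (fun x => u j x * wderiv j (w i) x * hartley k x) =
    - \sum_(j < 3) (coord k j)%:~R * coef (flip j k) (fun x => w i x * u j x).
  have wv j : wiener (fun x => - u j x) (4 * (charge_bound z B Brho * charge_bound z B Brho)).
    move=> n; apply: le_trans (wiener_velocity spr wrho adm j n).
    by apply: ler_sum => l _; rewrite coefN ?normrN.
  have := convection_by_parts k (L2_force spr wrho adm) lr wv Hw.
  have E1 j : coef k (fun x => - u j x * wderiv j (w i) x) =
      - intT (fun x => u j x * wderiv j (w i) x * hartley k x).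
    rewrite -(coefN k (suw j)); congr (coef k _).
    by apply/funext => x; rewrite mulNr.
  have E2 j : coef (flip j k) (fun x => w i x * - u j x) =
      - coef (flip j k) (fun x => w i x * u j x).
    rewrite -(coefN _ (sc j)); congr (coef _ _).
    by apply/funext => x; rewrite mulrN.
  under eq_bigr do rewrite E1; under [X in _ = - X]eq_bigr do rewrite E2 mulrN.
  rewrite !sumrN => /eqP; rewrite eqr_opp => /eqP ->.
  by [].
rewrite EB /coef_rhs.
have EF j : coef (flip j k) (flux D z w Phi u i j) =
    coef (flip j k) (fun x => w i x * u j x) - z i * D * coef (flip j k) (fun x => w i x * wderiv j Phi x).
  by rewrite -(coefZ _ _ (sd j)) -coefB//; exact: L2_scale.
under [X in _ = - (_ + (_ + X) * _)]eq_bigr do rewrite EF mulrBr mulrCA.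
rewrite sumrB -mulr_sumr -/(coef k (w i)).
set X := \sum_(_ < _) _; set Y := \sum_(_ < _) _.
by rewrite /coef; ring.
Qed.

End Coefficients.

Lemma cvg_sum (R : realType) (T I : Type) (F : set_system T) (FF : Filter F) (s : seq I)
  (f : I -> T -> R) (l : I -> R) : (forall i, f i x @[x --> F] --> l i) ->
  \sum_(i <- s) f i x @[x --> F] --> \sum_(i <- s) l i.
Proof.
move=> H; elim: s => [|i s IH].
  by rewrite big_nil; under eq_fun do rewrite big_nil; exact: cvg_cst.
by rewrite big_cons; under eq_fun do rewrite big_cons; exact: cvgD.
Qed.

Section Trajectory.
Context {R : realType}.
Variables (N : nat) (D : R) (z : 'I_N -> R) (rhot : R * R * R -> R) (B Brho : R).
Hypotheses (spr : smooth_periodic rhot) (wrho : wiener rhot Brho).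
Variables (c : R -> @state R N) (Phi : R -> R * R * R -> R) (u : R -> 'I_3 -> R * R * R -> R).
Variable T0 : R.
Hypothesis T0_gt0 : 0 < T0.
Hypothesis adm : forall t, T0 <= t -> admissible z rhot B (c t) (Phi t) (u t).
Hypothesis Hc : forall t i, T0 <= t -> inH 1 (c t i).
Hypothesis c_continuous : forall t0 i, 0 <= t0 ->
  Hnorm 0 (c t i \- c t0 i) @[t --> within `[0, +oo[ (nbhs t0)] --> (0 : R).
Hypothesis c_weak : forall i phi, ttestfun phi ->
  \int[lebesgue_measure]_(t in `]0, +oo[) intT (fun x =>
      - (c t i x * 'D_1 (fun s => phi (s, x)) t)
      + (\sum_(j < 3) u t j x * wderiv j (c t i) x) * phi (t, x)
      - D * (c t i x * lap (fun y => phi (t, y)) x)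
      + z i * D * (\sum_(j < 3) c t i x * wderiv j (Phi t) x
                                * pd j (fun y => phi (t, y)) x)) = 0.

Let clamp (t : R) : R := Num.max t T0.
Let ge_clamp t : T0 <= clamp t. Proof. by rewrite /clamp le_max lexx orbT. Qed.
Let clampE t : T0 <= t -> clamp t = t. Proof. by move=> Tt; rewrite /clamp max_l. Qed.

Let cvg_dist2 t0 : dist2 (c (clamp t)) (c (clamp t0)) @[t --> t0] --> (0 : R).
Proof.
have h0 : 0 <= clamp t0 by apply: le_trans (ge_clamp t0); exact: ltW.
rewrite (_ : 0 = \sum_(i < N) 0 ^+ 2); last by rewrite big1// => i _; rewrite expr0n.
have -> : (fun t => dist2 (c (clamp t)) (c (clamp t0))) =
    (fun t => \sum_(i < N) Hnorm 0 (c (clamp t) i \- c (clamp t0) i) ^+ 2).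
  apply/funext => t; apply: eq_bigr => i _.
  by rewrite sqr_Hnorm sqHnorm0E.
apply: cvg_sum => i; suff H : Hnorm 0 (c (clamp t) i \- c (clamp t0) i) @[t --> t0] --> (0 : R).
  by rewrite expr2; under eq_fun do rewrite expr2; exact: (cvgM H H).
apply: (cvg_comp (fun t => clamp t) (fun t => Hnorm 0 (c t i \- c (clamp t0) i)) _ (c_continuous i h0)).
move=> P; rewrite /within /= => nP.
have := @continuous_maxr R T0 t0 _ nP.
move=> HH; have : nbhs t0 (fun t => (`[0, +oo[%classic : set R) (clamp t) -> P (clamp t)) by exact: HH.
move/filterS; apply => t Ht; apply: Ht; rewrite /= in_itv /= andbT.
by apply: le_trans (ge_clamp t); exact: ltW.
Qed.

(** A quantity controlled by the mean-square distance of the states inherits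
    their continuity in time. *)
Let continuous_of_dist2 (g : R -> R) C :
  (forall t s, (g t - g s) ^+ 2 <= C * dist2 (c (clamp t)) (c (clamp s))) -> continuous g.
Proof.
move=> H t0; apply/cvgrPdist_lt => e e0.
have := @cvg_dist2 t0; move/cvgrPdist_lt => /(_ (e ^+ 2 / (`|C| + 1))).
have C1 : 0 < `|C| + 1 by rewrite ltr_wpDl.
rewrite divr_gt0 ?exprn_gt0// => /(_ isT); apply: filterS => t.
rewrite sub0r normrN ger0_norm ?dist2_ge0// ltr_pdivlMr// => dlt.
rewrite -(@ltr_pXn2r _ 2)// ?nnegrE ?(ltW e0)// real_normK ?num_real// -sqrrN opprB.
apply: le_lt_trans (H t t0) _; apply: le_lt_trans dlt.
rewrite mulrC ler_wpM2l ?dist2_ge0//; have := ler_norm C; lra.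
Qed.

Let a i k t := coef k (c (clamp t) i).
Let b i k t := coef_rhs D z (c (clamp t)) (Phi (clamp t)) (u (clamp t)) i k.

Lemma sqr_coef_le k (f : R * R * R -> R) : L2 f -> coef k f ^+ 2 <= vol * nrm2 f.
Proof.
move=> sf.
have [m km] := in_some_cube k.
apply: le_trans (bessel m sf); rewrite (bigD1_seq k km (cube_uniq m)) /=.
by rewrite lerDl sumr_ge0// => l _; exact: sqr_ge0.
Qed.

Let nrm2_le_dist2 (w w' : 'I_N -> R * R * R -> R) i : nrm2 (fun x => w i x - w' i x) <= dist2 w w'.
Proof. by rewrite /dist2 (bigD1 i)//= lerDl sumr_ge0// => l _; exact: nrm2_ge0. Qed.

Let continuous_a i k : continuous (a i k).
Proof.
have v0 := @vol_gt0 R.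
apply: (@continuous_of_dist2 _ vol) => t s.
have [st _ _ _] := adm (ge_clamp t); have [ss _ _ _] := adm (ge_clamp s).
rewrite /a -coefB//; apply: (le_trans (sqr_coef_le _ (L2_sub (st i) (ss i)))).
by rewrite ler_pM2l.
Qed.

Let continuous_flux_coef i j k : continuous (fun t =>
  coef k (flux D z (c (clamp t)) (Phi (clamp t)) (u (clamp t)) i j)).
Proof.
have v0 := @vol_gt0 R.
have [L L0 HL] := flux_lipschitz D z B spr wrho.
apply: (@continuous_of_dist2 _ (vol * L)) => t s.
have at_ := adm (ge_clamp t); have as_ := adm (ge_clamp s).
have st := L2_flux D spr wrho at_ i j; have ss := L2_flux D spr wrho as_ i j.
rewrite -coefB//; apply: (le_trans (sqr_coef_le _ (L2_sub st ss))).
by rewrite -mulrA ler_pM2l//; exact: HL.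
Qed.

Let continuous_b i k : continuous (b i k).
Proof.
move=> t0; apply: cvgD.
  by apply: cvgN; apply: cvgM; [exact: cvg_cst|exact: continuous_a].
by apply: cvg_sum => j; apply: cvgM; [exact: cvg_cst|exact: continuous_flux_coef].
Qed.

Lemma coef_weak_ode i k : weak_ode (a i k) (b i k) T0.
Proof.
move=> theta stheta p q Tp pq th0.
pose phi (tx : R * (R * R * R)) := theta tx.1 * hartley k tx.2.
have dth t : (t < p) || (q < t) -> 'D_1 theta t = 0.
  move=> tpq; have -> : 'D_1 theta t = 'D_1 (cst (0 : R)) t; last exact: derive_cst.
  apply: near_eq_derive.
  have [tp|qt] := orP tpq.
    near=> s; rewrite /cst th0//; left; near: s; exact: lt_nbhsl.
  near=> s; rewrite /cst th0//; right; near: s; exact: lt_nbhsr.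
have phit : ttestfun phi.
  split.
  - apply: smooth_mul; first exact: smooth_fst.
    exact: (smooth_snd (f := hartley k)) (@smooth_hartley R k).
  - by move=> t j x; rewrite /phi /=; have [_ ->] := @smooth_periodic_hartley R k.
  - exists p, q; split => [|t x tpq]; first exact: lt_trans T0_gt0 Tp.
    by rewrite /phi /= th0 ?mul0r//; exact/orP.
have th00 t : (t < p) || (q < t) -> theta t = 0 by move=> H; apply: th0; exact/orP.
have lin : forall (r : R), smooth_periodic (fun y => r * hartley k y).
  by move=> r; split; [apply: smooth_scale; exact: smooth_hartley|
    move=> j x; have [_ ->] := @smooth_periodic_hartley R k].
have dphi t x : 'D_1 (fun s => phi (s, x)) t = 'D_1 theta t * hartley k x.
  rewrite /phi /= (_ : (fun s => _) = hartley k x *: theta); last first.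
    by apply/funext => s; rewrite mulrC.
  by rewrite deriveZ; [rewrite mulrC|exact: smooth_derivable].
have lapphi t : lap (fun y => phi (t, y)) = (fun x => theta t * (- sqnorm k * hartley k x)).
  apply/funext => x; have <- : lap (hartley k) x = - sqnorm k * hartley k x by rewrite lap_hartley.
  rewrite /phi /= /lap mulr_sumr; apply: eq_bigr => j _.
  rewrite (pd_scale (theta t) j (@smooth_hartley R k)).
  by rewrite (pd_scale (theta t) j (smooth_derive (basis_vec j) (@smooth_hartley R k))).
have pdphi t j : pd j (fun y => phi (t, y)) = (fun x => theta t * pd j (hartley k) x).
  by rewrite /phi /= pd_scale//; exact: smooth_hartley.
have eqF t : 0 < t -> intT (fun x =>
      - (c t i x * 'D_1 (fun s => phi (s, x)) t)
      + (\sum_(j < 3) u t j x * wderiv j (c t i) x) * phi (t, x)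
      - D * (c t i x * lap (fun y => phi (t, y)) x)
      + z i * D * (\sum_(j < 3) c t i x * wderiv j (Phi t) x
                                * pd j (fun y => phi (t, y)) x)) =
   - (a i k t * 'D_1 theta t + b i k t * theta t).
  move=> t_gt0; rewrite lapphi.
  have [Tt|tT] := leP T0 t.
    rewrite /a /b clampE// -(weak_form_hartley D spr wrho k _ _ (adm Tt) (Hc i Tt)).
    apply: eq_intT => x; rewrite dphi /phi /=; congr (_ + _ * _).
    by apply: eq_bigr => j _; rewrite pdphi.
  have tp : (t < p) || (q < t) by rewrite (lt_trans tT Tp).
  rewrite dth// th00// !mulr0 addr0 oppr0 -[RHS](_ : intT (fun=> 0) = 0); last first.
    by rewrite /intT Rintegral_cst ?mul0r//; exact: measurable_box.
  apply: eq_intT => x; rewrite dphi dth// /phi /= th00// !mul0r !mulr0 !oppr0 !add0r.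
  by rewrite big1 ?mulr0// => j _; rewrite (pd_scale 0 j (@smooth_hartley R k)) mul0r mulr0.
have E : \int[lebesgue_measure]_(t in `[p, q]) - (a i k t * 'D_1 theta t + b i k t * theta t) = 0.
  rewrite -[RHS](c_weak i phit) [LHS]Rintegral_mkcond [RHS]Rintegral_mkcond.
  apply: eq_Rintegral => t _; rewrite /patch; case: ifPn => tpq; case: ifPn => t0.
  - by rewrite eqF//; move: t0; rewrite inE /= in_itv /= andbT.
  - move: t0 tpq; rewrite notin_setE inE /= !in_itv /= andbT => t0 /andP[pt _].
    by case: t0; apply: lt_le_trans pt; exact: lt_trans T0_gt0 Tp.
  - move: t0 tpq; rewrite notin_setE inE /= !in_itv /= andbT => t0 /negP; rewrite negb_and -!ltNge => tpq.
    by rewrite eqF// dth// th00// !mulr0 addr0 oppr0.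
  - by [].
apply: oppr_inj; rewrite oppr0 -mulN1r -RintegralZl//; last first.
  apply: continuous_integrable_itv => t.
  apply: cvgD; apply: cvgM; first exact: continuous_a.
  - apply: (@smooth_continuous R R (fun y => 'D_1 theta y)); exact: smooth_derive.
  - exact: continuous_b.
  - by apply: (@smooth_continuous R R theta).
by under eq_Rintegral do rewrite mulN1r; exact: E.
Unshelve. all: by end_near.
Qed.

Lemma coef_ode i k t : T0 < t -> is_derive t (1 : R) (a i k) (b i k t).
Proof.
exact: du_bois_reymond (@continuous_a i k) (@continuous_b i k) (coef_weak_ode i k) t.
Qed.

End Trajectory.

Definition tail_ode (R : realType) (N : nat) (D : R) (z : 'I_N -> R) (rhot : R * R * R -> R) B T0
    (c : R -> @state R N) := exists Phi u,
  (forall t, T0 <= t -> admissible z rhot B (c t) (Phi t) (u t)) /\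
  forall i k t, T0 < t -> is_derive t (1 : R) (fun s => coef k (c s i))
    (coef_rhs D z (c t) (Phi t) (u t) i k).

Lemma NPD_tail_ode (R : realType) (N : nat) (D : R) (z : 'I_N -> R) (rhot : R * R * R -> R)
    (M rad T : R) (c : R -> state N) : 0 < T -> smooth_periodic rhot ->
  NPD_solution D z rhot c -> (forall t, T <= t -> BM z rhot M rad (c t)) ->
  tail_ode D z rhot (BM_bound M rad) T c.
Proof.
move=> T_gt0 spr [_ c_cont _ _ [Phi [u [pot lr weak]]]] inB; exists Phi, u.
have [Brho wrho] := smooth_periodic_wiener spr.
have adm t : T <= t -> admissible z rhot (BM_bound M rad) (c t) (Phi t) (u t).
  move=> Tt; have t0 : 0 < t by exact: lt_le_trans Tt.
  split; [by move=> i; exact: BM_L2 (inB _ Tt)| |exact: pot|exact: lr].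
  by move=> i n; exact: (BM_wiener i (inB _ Tt)).
split=> // i k t Tt.
have H1 s l : T <= s -> inH 1 (c s l).
  by move=> Ts; exact: inH_le (BM_inH2 l (inB _ Ts)).
have := coef_ode spr wrho T_gt0 adm H1 c_cont weak i k Tt.
rewrite /= max_l; last exact: ltW.
apply: near_eq_is_derive.
near=> s; rewrite max_l//; near: s.
exact: lt_le_nbhsr.
Unshelve. all: by end_near.
Qed.

(** * Differential inequalities *)

Section Inequalities.
Context {R : realType}.

Lemma is_derive_bigsum (I : Type) (r : seq I) (f : I -> R -> R) (df : I -> R) (t : R) :
  (forall i, is_derive t 1 (f i) (df i)) ->
  is_derive t 1 (fun s => \sum_(i <- r) f i s) (\sum_(i <- r) df i).
Proof.
move=> H; elim: r => [|i r IH].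
  by rewrite big_nil; under eq_fun do rewrite big_nil; exact: is_derive_cst.
by rewrite big_cons; under eq_fun do rewrite big_cons; exact: is_deriveD.
Qed.

Lemma nonincreasing_of_deriv (F dF : R -> R) (s t : R) : s <= t ->
  (forall x, s <= x -> x <= t -> is_derive x 1 F (dF x)) ->
  (forall x, s <= x -> x <= t -> dF x <= 0) -> F t <= F s.
Proof.
rewrite le_eqVlt => /predU1P[-> //|st] H1 H2.
have cF : {within `[s, t], continuous F}.
  apply: derivable_within_continuous => x; rewrite in_itv /= => /andP[sx xt].
  by have [] := H1 _ sx xt.
have H3 x : x \in `]s, t[%R -> is_derive x 1 F (dF x).
  by rewrite in_itv /= => /andP[/ltW sx /ltW xt]; exact: H1.
have [x] := MVT st H3 cF.
rewrite in_itv /= => /andP[/ltW sx /ltW xt] E.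
by rewrite -subr_le0 E mulr_le0_ge0 ?subr_ge0 ?(ltW st) ?H2.
Qed.

Lemma growth_bound (F dF : R -> R) (s t q : R) : s <= t ->
  (forall x, s <= x -> x <= t -> is_derive x 1 F (dF x)) ->
  (forall x, s <= x -> x <= t -> dF x <= q) -> F t <= F s + q * (t - s).
Proof.
move=> st H1 H2.
have := @nonincreasing_of_deriv (fun x => F x - q * x) (fun x => dF x - q) s t st.
move=> H; suff : F t - q * t <= F s - q * s by lra.
apply: H => x sx xt; last by rewrite subr_le0 H2.
have HF := H1 _ sx xt.
have HI : is_derive x 1 (fun y : R => q * y) (q * 1) by exact: is_deriveZ.
by have := is_deriveB HF HI; rewrite mulr1.
Qed.

Lemma decay_bound (F dF : R -> R) (s t beta q : R) : s <= t -> 0 < beta -> 0 <= q -> 0 <= F s ->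
  (forall x, s <= x -> x <= t -> is_derive x 1 F (dF x)) ->
  (forall x, s <= x -> x <= t -> dF x <= - beta * F x + q) ->
  F t <= F s / (1 + beta * (t - s)) + q / beta.
Proof.
move=> st b0 q0 Fs H1 H2; set e := expR (- (beta * (t - s))).
have e0 : 0 < e by exact: expR_gt0.
have bt : 0 < 1 + beta * (t - s).
  have H : 0 <= beta * (t - s) by rewrite mulr_ge0 ?subr_ge0// ltW.
  lra.
have e1 : e <= (1 + beta * (t - s))^-1.
  by rewrite /e expRN lef_pV2 ?posrE ?expR_gt0//; exact: expR_ge1Dx.
pose G x := expR (beta * (x - s)) * (F x - q / beta).
have Gts : G t <= G s.
  apply: (@nonincreasing_of_deriv _ (fun x => expR (beta * (x - s)) * dF x +
    (F x - q / beta) * (expR (beta * (x - s)) * beta)) s t st) => x sx xt.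
    have HF := H1 _ sx xt.
    have HI : is_derive x 1 (fun y : R => beta * (y - s)) beta.
      have := @is_deriveZ R R R (fun y => y - s) beta x 1 1.
      rewrite /GRing.scale /= mulr1; apply.
      by rewrite -[X in is_derive _ _ _ X]subr0; exact: is_deriveB.
    have HE : is_derive x 1 (fun y : R => expR (beta * (y - s))) (expR (beta * (x - s)) * beta).
      exact: is_derive1_comp.
    have HB : is_derive x 1 (fun y => F y - q / beta) (dF x).
      by rewrite -[X in is_derive _ _ _ X]subr0; exact: is_deriveB.
    exact: is_deriveM HE HB.
  have -> : expR (beta * (x - s)) * dF x + (F x - q / beta) * (expR (beta * (x - s)) * beta) =
     expR (beta * (x - s)) * (dF x - (- beta * F x + q)).
    by field; exact: lt0r_neq0.
  by rewrite mulr_ge0_le0 ?expR_ge0// subr_le0 H2.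
have E : F t - q / beta <= e * (F s - q / beta).
  rewrite -(ler_pM2l (expR_gt0 (beta * (t - s)))) mulrA -expRD addrN expR0 mul1r.
  by move: Gts; rewrite /G subrr mulr0 expR0 mul1r.
have qb : 0 <= q / beta by rewrite divr_ge0// ltW.
have := ler_wpM2l Fs e1; have := mulr_ge0 (ltW e0) qb.
by move: E; set X := _^-1; set Y := q / beta; lra.
Qed.

End Inequalities.

(** * Squeezing *)

Section Energy.
Context {R : realType}.
Variable N : nat.
Implicit Types (w : 'I_N -> R * R * R -> R) (S : seq (int * int * int)).

Definition energy S w w' : R :=
  \sum_(i < N) \sum_(k <- S) (coef k (w i) - coef k (w' i)) ^+ 2.

Lemma energy_ge0 S w w' : 0 <= energy S w w'.
Proof. by apply: sumr_ge0 => i _; apply: sumr_ge0 => k _; exact: sqr_ge0. Qed.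

Lemma ler_sum_filter (I : eqType) (s : seq I) (P : pred I) (F : I -> R) :
  (forall i, 0 <= F i) -> \sum_(i <- [seq x <- s | P x]) F i <= \sum_(i <- s) F i.
Proof.
move=> F0; rewrite big_filter [leRHS](bigID P) /= lerDl.
by apply: sumr_ge0 => i _.
Qed.

Lemma energy_split n (P : pred (int * int * int)) w w' :
  energy (cube n) w w' =
  energy [seq k <- cube n | P k] w w' + energy [seq k <- cube n | ~~ P k] w w'.
Proof.
rewrite /energy -big_split; apply: eq_bigr => i _.
by rewrite (bigID P); congr (_ + _); rewrite big_filter.
Qed.

Section L2.
Variables (w w' : 'I_N -> R * R * R -> R).
Hypotheses (sw : forall i, L2 (w i)) (sw' : forall i, L2 (w' i)).

Lemma energy_le_dist2 n (P : pred (int * int * int)) :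
  energy [seq k <- cube n | P k] w w' <= vol * dist2 w w'.
Proof.
rewrite /dist2 mulr_sumr; apply: ler_sum => i _.
apply: le_trans (bessel n (L2_sub (sw i) (sw' i))).
apply: (le_trans (ler_sum_filter _ _ _)) => [k|]; first exact: sqr_ge0.
by apply: ler_sum => k _; rewrite coefB.
Qed.

Lemma dist2_le_energy C : (forall n, energy (cube n) w w' <= C) -> vol * dist2 w w' <= C.
Proof.
move=> H; have : energy (cube n) w w' @[n --> \oo] --> vol * dist2 w w'.
  rewrite /dist2 mulr_sumr; apply: cvg_sum => i.
  have := parseval (L2_sub (sw i) (sw' i)).
  by under eq_fun do under eq_bigr do rewrite coefB//.
move=> cv; rewrite -(cvg_lim _ cv)//.
by apply: limr_le; [apply: cvgP cv|near=> n; exact: H].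
Unshelve. all: by end_near.
Qed.

End L2.
End Energy.

Section Dissipation.
Context {R : realType}.
Variables (N : nat) (D : R) (z : 'I_N -> R) (rhot : R * R * R -> R) (B Brho : R).
Hypotheses (D_gt0 : 0 < D) (spr : smooth_periodic rhot) (wrho : wiener rhot Brho).

Definition denergy (S : seq (int * int * int)) w Phi u w' Phi' u' : R :=
  \sum_(i < N) \sum_(k <- S) (2 * (coef k (w i) - coef k (w' i)) *
    (coef_rhs D z w Phi u i k - coef_rhs D z w' Phi' u' i k)).

(** Young's inequality lets half of the diffusion absorb the derivative that
    falls on the flux. *)
Lemma mode_dissipation (a r : R) (x g : 'I_3 -> R) : 
  r = - (D * (\sum_(j < 3) x j ^+ 2) * a) + \sum_(j < 3) x j * g j ->
  2 * a * r <= - (D * (\sum_(j < 3) x j ^+ 2) * a ^+ 2) + D^-1 * \sum_(j < 3) g j ^+ 2.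
Proof.
move=> ->.
have young j : 2 * a * (x j * g j) <= D * x j ^+ 2 * a ^+ 2 + D^-1 * g j ^+ 2.
  rewrite -subr_ge0 (_ : _ - _ = D^-1 * (D * x j * a - g j) ^+ 2).
    by rewrite mulr_ge0 ?sqr_ge0// invr_ge0 ltW.
  by field; exact: lt0r_neq0.
have : \sum_(j < 3) 2 * a * (x j * g j) <=
    \sum_(j < 3) (D * x j ^+ 2 * a ^+ 2 + D^-1 * g j ^+ 2) by exact: ler_sum.
rewrite big_split /= -!mulr_sumr -mulr_suml -mulr_sumr.
set X := \sum_(_ < _) _; set Y := \sum_(_ < _) _; set Z := \sum_(_ < _) _.
move=> H; rewrite [leLHS](_ : _ = - (2 * (D * Y * a ^+ 2)) + 2 * a * X); last by ring.
lra.
Qed.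

Lemma dissipation : exists2 C, 0 <= C & forall w Phi u w' Phi' u',
  admissible z rhot B w Phi u -> admissible z rhot B w' Phi' u' ->
  forall n (P : pred (int * int * int)) kappa, (forall k, P k -> kappa <= sqnorm k) ->
  denergy [seq k <- cube n | P k] w Phi u w' Phi' u' <=
  - (D * kappa) * energy [seq k <- cube n | P k] w w' + C * dist2 w w'.
Proof.
have [L L0 HL] := flux_lipschitz D z B spr wrho.
have v0 := @vol_gt0 R; have D0 : 0 <= D^-1 by rewrite invr_ge0 ltW.
exists (\sum_(i < N) (D^-1 * \sum_(j < 3) (vol * L))).
  apply: sumr_ge0 => i _; rewrite mulr_ge0// sumr_ge0// => j _; apply: mulr_ge0 => //; exact: ltW.
move=> w Phi u w' Phi' u' adm adm' n P kappa HP.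
have [sw _ _ _] := adm; have [sw' _ _ _] := adm'.
set S := [seq k <- cube n | P k].
rewrite /denergy /energy mulr_sumr mulr_suml -big_split; apply: ler_sum => i _ /=.
pose g j x := flux D z w Phi u i j x - flux D z w' Phi' u' i j x.
have sF j := L2_flux D spr wrho adm i j; have sF' j := L2_flux D spr wrho adm' i j.
have sg j : L2 (g j) := L2_sub (sF j) (sF' j).
apply: (@le_trans _ _ (\sum_(k <- S)
   (- (D * kappa) * (coef k (w i) - coef k (w' i)) ^+ 2 +
    D^-1 * \sum_(j < 3) coef (flip j k) (g j) ^+ 2))).
  rewrite big_seq [leRHS]big_seq; apply: ler_sum => k; rewrite mem_filter => /andP[Pk _].
  set a := _ - _.
  have := @mode_dissipation a (coef_rhs D z w Phi u i k - coef_rhs D z w' Phi' u' i k)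
    (fun j => (coord k j)%:~R) (fun j => coef (flip j k) (g j)).
  rewrite -/(sqnorm k) => H; apply: (le_trans (H _)).
    have -> : \sum_(j < 3) (coord k j)%:~R * coef (flip j k) (g j) =
        \sum_(j < 3) (coord k j)%:~R * coef (flip j k) (flux D z w Phi u i j) -
        \sum_(j < 3) (coord k j)%:~R * coef (flip j k) (flux D z w' Phi' u' i j).
      by rewrite -sumrB; apply: eq_bigr => j _; rewrite -mulrBr -coefB.
    have aux (X Y x y q : R) :
        - (D * q * x) + X - (- (D * q * y) + Y) = - (D * q * (x - y)) + (X - Y) by ring.
    exact: aux.
  rewrite lerD2r !mulNr lerN2 ler_wpM2r ?sqr_ge0//.
  by rewrite ler_pM2l//; exact: HP.
rewrite big_split /= -mulr_sumr lerD2l -mulr_sumr exchange_big /= -mulrA ler_wpM2l// mulr_suml.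
apply: ler_sum => j _.
apply: (le_trans (@ler_sum_filter R _ (cube n) P (fun k => coef (flip j k) (g j) ^+ 2) _)).
  by move=> k; exact: sqr_ge0.
rewrite (big_flip_cube _ n j (fun k => coef k (g j) ^+ 2)) /=.
apply: (le_trans (bessel n (sg j))).
apply: (le_trans (ler_wpM2l (ltW v0) (HL _ _ _ _ _ _ adm adm' i j))).
by rewrite mulrA.
Qed.

Lemma energy_derive (T0 : R) (c : R -> @state R N) Phi u (c' : R -> @state R N) Phi' u' :
  (forall i k t, T0 < t -> is_derive t (1 : R) (fun s => coef k (c s i))
    (coef_rhs D z (c t) (Phi t) (u t) i k)) ->
  (forall i k t, T0 < t -> is_derive t (1 : R) (fun s => coef k (c' s i))
    (coef_rhs D z (c' t) (Phi' t) (u' t) i k)) ->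
  forall S (t : R), T0 < t -> is_derive t (1 : R) (fun s => energy S (c s) (c' s))
    (denergy S (c t) (Phi t) (u t) (c' t) (Phi' t) (u' t)).
Proof.
move=> H H' S t Tt; apply: is_derive_bigsum => i; apply: is_derive_bigsum => k.
pose f s := coef k (c s i) - coef k (c' s i).
have HB : is_derive t (1 : R) f _ := is_deriveB (H i k t Tt) (H' i k t Tt).
have := is_deriveM HB HB; rewrite (_ : f * f = (fun s => f s ^+ 2)); last first.
  by apply/funext => s; rewrite expr2.
have aux (x y : R) : x *: y + x *: y = 2 * x * y by rewrite /GRing.scale /=; ring.
by move=> HM; apply: (is_derive_eq HM); exact: aux.
Qed.

End Dissipation.

Section Squeezing.
Context {R : realType}.
Variables (N : nat) (D : R) (z : 'I_N -> R) (rhot : R * R * R -> R) (B T0 : R).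
Hypotheses (D_gt0 : 0 < D) (spr : smooth_periodic rhot).

Let high K k := k \notin cube K.

Lemma sqnorm_high K k : high K k -> K%:R ^+ 2 <= sqnorm k :> R.
Proof.
rewrite /high mem_cube negb_forall => /existsP[j]; rewrite -ltNge => kj.
apply: le_trans (sqr_coord_le j k).
rewrite -(@real_normK _ (coord k j)%:~R) ?num_real// lerXn2r ?nnegrE//.
rewrite -intr_norm pmulrn ler_int; exact: ltW.
Qed.

Lemma sqnorm_ge0' k : true -> 0 <= sqnorm k :> R.
Proof. by move=> _; exact: sqnorm_ge0. Qed.

Lemma squeezing : exists (tau : R) (K : nat), 0 < tau /\ forall (c c' : R -> @state R N),
  tail_ode D z rhot B T0 c -> tail_ode D z rhot B T0 c' ->
  (exists E0, forall t, T0 <= t -> dist2 (c t) (c' t) <= E0) ->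
  forall s, T0 < s ->
    dist2 (c (s + tau)) (c' (s + tau)) <= 2 * dist2 (c s) (c' s) /\
    vol * dist2 (c (s + tau)) (c' (s + tau)) <=
      energy (cube K) (c (s + tau)) (c' (s + tau)) + vol / 4 * dist2 (c s) (c' s).
Proof.
have v0 := @vol_gt0 R.
have [Brho wrho] := smooth_periodic_wiener spr.
have [C C0 HC] := dissipation z B D_gt0 spr wrho.
pose tau := vol / (2 * (C + 1)).
have tau0 : 0 < tau by rewrite divr_gt0// mulr_gt0// ltr_wpDl.
have Ctau : C * tau <= vol / 2.
  rewrite /tau mulrA ler_pdivrMr; last by rewrite mulr_gt0// ltr_wpDl.
  by have := mulr_ge0 C0 (ltW v0); lra.
have [K HK] : exists K : nat, 8 / tau + 16 * C / vol + 1 <= D * K%:R ^+ 2.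
  pose x := (8 / tau + 16 * C / vol + 1) / D.
  have x0 : 0 <= x.
    have t1 : 0 <= 8 / tau by exact: divr_ge0 (ltW tau0).
    have t2 : 0 <= 16 * C / vol by apply: divr_ge0 (ltW v0); exact: mulr_ge0.
    by apply: divr_ge0 (ltW D_gt0); exact: addr_ge0 (addr_ge0 t1 t2) ler01.
  exists (Num.Def.truncn x).+1.
  have := truncnS_gt x; set n := _.+1 => xn.
  have n1 : 1 <= n%:R :> R by rewrite ler1n.
  have -> : 8 / tau + 16 * C / vol + 1 = D * x by rewrite /x [RHS]mulrC divfK// lt0r_neq0.
  apply: ler_wpM2l; first exact: ltW.
  have : n%:R * 1 <= n%:R * n%:R :> R by rewrite ler_wpM2l.
  by rewrite mulr1 -expr2; apply: le_trans; exact: ltW.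
exists tau, K; split=> // c c' [Phi [u [adm ode]]] [Phi' [u' [adm' ode']]] [E0 HE0] s Ts.
pose d t := dist2 (c t) (c' t).
have d0 t : 0 <= d t by exact: dist2_ge0.
have T0s t : s <= t -> T0 < t by exact: lt_le_trans.
have sw t i : s <= t -> L2 (c t i).
  by move=> /T0s /ltW /adm [].
have sw' t i : s <= t -> L2 (c' t i).
  by move=> /T0s /ltW /adm' [].
have der (P : pred (int * int * int)) n t : s <= t -> is_derive t (1 : R)
    (fun x => energy [seq k <- cube n | P k] (c x) (c' x)) _ :=
  fun st => energy_derive ode ode' [seq k <- cube n | P k] (T0s t st).
have dis (P : pred (int * int * int)) n kappa t : (forall k, P k -> kappa <= sqnorm k) -> s <= t -> _ :=
  fun HP st => HC _ _ _ _ _ _ (adm t (ltW (T0s t st))) (adm' t (ltW (T0s t st))) n P kappa HP.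
have all_n n (w w' : @state R N) : energy [seq k <- cube n | predT k] w w' = energy (cube n) w w'.
  by rewrite filter_predT.
have step A t : (forall x, s <= x -> x <= s + tau -> d x <= A) -> s <= t -> t <= s + tau ->
    d t <= d s + A / 2.
  move=> HA st tt; have A0 : 0 <= A by apply: le_trans (HA s _ _) => //; rewrite lerDl ltW.
  rewrite -(ler_pM2l v0); apply: dist2_le_energy => [i|i|n]; [exact: sw|exact: sw'|].
  rewrite -all_n.
  have G := @growth_bound R _ _ s t (C * A) st (fun x sx _ => der predT n x sx).
  apply: (le_trans (G _)).
    move=> x sx xt; apply: (le_trans (dis predT n 0 x sqnorm_ge0' sx)).
    rewrite mulr0 oppr0 mul0r add0r ler_wpM2l//; apply: HA => //; exact: le_trans tt.
  rewrite [leRHS]mulrDr; apply: lerD.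
    by apply: energy_le_dist2 => i; [exact: sw|exact: sw'].
  have : C * (t - s) <= C * tau by rewrite ler_wpM2l// lerBlDl.
  by move=> /le_trans /(_ Ctau) /(ler_wpM2l A0); lra.
have d2 t : s <= t -> t <= s + tau -> d t <= 2 * d s.
  move=> st tt; pose X := [set d x | x in [set x | s <= x <= s + tau]].
  have Xs : X (d s) by exists s => //=; rewrite lexx lerDl ltW.
  have ubX : has_ubound X.
    exists E0 => _ [x /= /andP[sx _] <-]; apply: HE0; apply: ltW; exact: T0s.
  have dX x : s <= x -> x <= s + tau -> d x <= sup X.
    by move=> sx xt; apply: ub_le_sup => //; exists x => //=; rewrite sx.
  have : sup X <= d s + sup X / 2.
    apply: ge_sup; first by exists (d s).
    by move=> _ [x /= /andP[sx xt] <-]; exact: step.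
  by have := dX t st tt; lra.
have st : s <= s + tau by rewrite lerDl ltW.
split; first exact: d2.
apply: dist2_le_energy => [i|i|n]; [exact: sw|exact: sw'|].
rewrite (energy_split n (fun k => k \in cube K)); apply: lerD.
  apply: ler_sum => i _.
  rewrite (perm_big [seq k <- cube K | k \in cube n]); last first.
    apply: uniq_perm => [||k]; rewrite ?filter_uniq ?cube_uniq//.
    by rewrite !mem_filter andbC.
  by apply: ler_sum_filter => k; exact: sqr_ge0.
pose beta := D * K%:R ^+ 2; rewrite -/beta in HK.
have a1 : 8 / tau + 16 * C / vol + 1 <= beta by [].
have t1 : 0 <= 8 / tau by exact: divr_ge0 (ltW tau0).
have t2 : 0 <= 16 * C / vol by apply: divr_ge0 (ltW v0); exact: mulr_ge0.
have b0 : 0 < beta by lra.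
have b1 : 8 <= beta * tau by rewrite -ler_pdivrMr//; lra.
have b2 : 16 * C <= beta * vol by rewrite -ler_pdivrMr//; lra.
have G := @decay_bound R _ _ s (s + tau) beta (C * (2 * d s)) st b0 _ _
  (fun x sx _ => der (high K) n x sx).
apply: (le_trans (G _ _ _)).
- by rewrite mulr_ge0// mulr_ge0.
- exact: energy_ge0.
- move=> x sx xt; apply: (le_trans (dis (high K) n _ x (@sqnorm_high K) sx)).
  by rewrite lerD2l ler_wpM2l//; exact: d2.
have e1 : energy [seq k <- cube n | high K k] (c s) (c' s) <= vol * d s.
  by apply: energy_le_dist2 => i; [exact: sw|exact: sw'].
have -> : s + tau - s = tau by ring.
apply: (@le_trans _ _ (vol / 8 * d s + vol / 8 * d s)); last by rewrite -/(d s); lra.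
apply: lerD.
  rewrite ler_pdivrMr; last by lra.
  have vd := mulr_ge0 (ltW v0) (d0 s); have := ler_wpM2l vd b1; lra.
rewrite ler_pdivrMr//; have := ler_wpM2l (d0 s) b2; lra.
Qed.

End Squeezing.

(** * Coding trajectories by finitely many symbols *)

Section Labels.
Context {R : realType}.

Definition residue (q : nat) (x : R) : 'I_q.+1 := inord (absz (Num.floor x %% (q.+1)%:Z)%Z).

(** Two reals at distance at most q whose integer parts agree modulo q + 1 have
    the same integer part. *)
Lemma residue_inj q (x y : R) : `|x - y| <= q%:R -> residue q x = residue q y -> `|x - y| <= 1.
Proof.
move=> xyq E.
have Em : (Num.floor x = Num.floor y %[mod (q.+1)%:Z])%Z.
  have ge (a : int) : 0 <= (a %% (q.+1)%:Z)%Z by rewrite modz_ge0.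
  have lt (a : int) : (absz (a %% (q.+1)%:Z)%Z < q.+1)%N.
    by have := ltz_pmod a (ltn0Sn q : 0 < (q.+1)%:Z); have := ge a; lia.
  have := congr1 val E; rewrite /residue /= !inordK//.
  by have := ge (Num.floor x); have := ge (Num.floor y); lia.
move/eqP: Em; rewrite eqz_mod_dvd => dv.
have lx := floor_le x; have ly := floor_le y.
have ux := floorD1_gt x; have uy := floorD1_gt y.
have fq : (absz (Num.floor x - Num.floor y)%R < q.+1)%N.
  suff : `|Num.floor x - Num.floor y| < (q.+1)%:Z by lia.
  rewrite -(ltr_int R) intr_norm rmorphB /= -pmulrn -natr1 ltr_norml.
  move: ux uy xyq; rewrite !rmorphD /= ler_norml => ux uy /andP[]; move: lx ly ux uy.
  set a := (Num.floor x)%:~R; set b := (Num.floor y)%:~R => ? ? ? ? ? ?; apply/andP; split; lra.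
have f0 : Num.floor x = Num.floor y.
  have [/eqP|] := posnP (absz (Num.floor x - Num.floor y)%R); first by lia.
  by move=> /dvdn_leq /(_ dv); lia.
move: ux uy; rewrite !rmorphD /= -f0 => ux uy; rewrite f0 in lx; move: lx ly ux uy.
rewrite -f0; set a := (Num.floor x)%:~R => ? ? ? ?.
by rewrite ler_norml; apply/andP; split; lra.
Qed.

Variables (N : nat) (D : R) (z : 'I_N -> R) (rhot : R * R * R -> R) (B T0 r0 : R).
Hypotheses (D_gt0 : 0 < D) (spr : smooth_periodic rhot) (r0_gt0 : 0 < r0).
Variable good : (R -> @state R N) -> Prop.
Hypothesis good_ode : forall c, good c -> tail_ode D z rhot B T0 c.
Hypothesis good_bound : forall c c', good c -> good c' ->
  forall t, T0 <= t -> dist2 (c t) (c' t) <= r0.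

Lemma labels : exists (L : finType) (lab : nat -> (R -> @state R N) -> L) (tau : R),
  0 < tau /\ forall n c c', good c -> good c' -> (forall m, (m < n)%N -> lab m c = lab m c') ->
    dist2 (c (T0 + 1 + n%:R * tau)) (c' (T0 + 1 + n%:R * tau)) <= r0 / 2 ^+ n.
Proof.
have v0 := @vol_gt0 R.
have [tau [K [tau0 Hsq]]] := squeezing (N := N) z B T0 D_gt0 spr.
pose mt := (N * size (cube K))%N; pose q := (8 * mt.+1)%N.
pose e m := r0 / 2 ^+ m; have e0 m : 0 < e m by rewrite divr_gt0// exprn_gt0.
pose eta2 m := vol * e m / (4 * (mt.+1)%:R); pose eta m := Num.sqrt (eta2 m).
have M0 : 0 < (mt.+1)%:R :> R by rewrite ltr0n.
have eta20 m : 0 < eta2 m.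
  by apply: divr_gt0; [exact: mulr_gt0|rewrite mulr_gt0].
have eta0 m : 0 < eta m by rewrite sqrtr_gt0.
have etaE m : eta m ^+ 2 = eta2 m by rewrite sqr_sqrtr// ltW.
pose time m := T0 + 1 + m%:R * tau.
have timeS m : time m.+1 = time m + tau by rewrite /time -natr1; ring.
have timeT m : T0 < time m.
  by have := mulr_ge0 (ler0n R m) (ltW tau0); rewrite /time; lra.
pose lab m (c : R -> @state R N) : {ffun 'I_N * 'I_(size (cube K)) -> 'I_q.+1} :=
  [ffun p : 'I_N * 'I_(size (cube K)) => residue q (coef (nth (0, 0, 0) (cube K) p.2) (c (time m.+1) p.1) / eta m)].
exists _, lab, tau; split=> // n c c' gc gc'; rewrite -/(time n).
elim: n => [_|n IH Hlab]; first by rewrite expr0 divr1; exact: (good_bound gc gc' (ltW (timeT 0%N))).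
have {IH} dn : dist2 (c (time n)) (c' (time n)) <= e n.
  by apply: IH => m mn; apply: Hlab; exact: ltnW.
have [d2 dK] := Hsq c c' (good_ode gc) (good_ode gc')
  (ex_intro _ r0 (good_bound gc gc')) (time n) (timeT n).
rewrite -timeS in d2 dK.
have [Phi [u [adm _]]] := good_ode gc; have [Phi' [u' [adm' _]]] := good_ode gc'.
have [sc _ _ _] := adm _ (ltW (timeT n.+1)); have [sc' _ _ _] := adm' _ (ltW (timeT n.+1)).
have close i k : k \in cube K ->
    (coef k (c (time n.+1) i) - coef k (c' (time n.+1) i)) ^+ 2 <= eta2 n.
  move=> kK; pose x := coef k (c (time n.+1) i) / eta n; pose y := coef k (c' (time n.+1) i) / eta n.
  have E : (coef k (c (time n.+1) i) - coef k (c' (time n.+1) i)) ^+ 2 = (x - y) ^+ 2 * eta2 n.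
    by rewrite -etaE -exprMn /x /y -mulrBl divfK ?gt_eqF.
  have xy : residue q x = residue q y.
    have kK' : (index k (cube K) < size (cube K))%N by rewrite index_mem.
    have := congr1 (fun f : {ffun 'I_N * 'I_(size (cube K)) -> 'I_q.+1} => f (i, Ordinal kK')) (Hlab n (ltnSn n)).
    by rewrite !ffunE /= nth_index.
  rewrite E; apply: ler_piMl; first exact: ltW.
  rewrite -(real_normK (num_real _)) expr_le1//; apply: residue_inj xy.
  have : (x - y) ^+ 2 * eta2 n <= 2 * (vol * e n).
    rewrite -E -coefB//; apply: (le_trans (sqr_coef_le _ (L2_sub (sc i) (sc' i)))).
    apply: (@le_trans _ _ (vol * dist2 (c (time n.+1)) (c' (time n.+1)))).
      apply: ler_wpM2l; first exact: ltW.
      by rewrite /dist2 (bigD1 i)//= lerDl sumr_ge0// => l _; exact: nrm2_ge0.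
    have := ler_wpM2l (ltW v0) d2; have := ler_wpM2l (ltW v0) dn; lra.
  rewrite (_ : 2 * (vol * e n) = q%:R * eta2 n); last first.
    by rewrite /eta2 /q natrM; field; rewrite gt_eqF.
  rewrite ler_pM2r// => xq.
  have q1 : 1 <= q%:R :> R by rewrite ler1n.
  rewrite -(@ler_pXn2r _ 2)// ?nnegrE// real_normK ?num_real//.
  by apply: (le_trans xq); rewrite expr2 ler_peMl// (le_trans ler01).
have Ele : energy (cube K) (c (time n.+1)) (c' (time n.+1)) <= vol / 4 * e n.
  apply: (@le_trans _ _ (\sum_(i < N) \sum_(k <- cube K) eta2 n)).
    apply: ler_sum => i _; rewrite big_seq [leRHS]big_seq; apply: ler_sum => k kK.
    exact: close.
  rewrite sumr_const card_ord big_const_seq count_predT iter_addr_0 -mulrnA mulnC -/mt.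
  apply: (@le_trans _ _ (eta2 n *+ mt.+1)); first by rewrite ler_wpMn2l// ltW.
  rewrite -mulr_natr /eta2 le_eqVlt; apply/orP; left; apply/eqP.
  by field; rewrite gt_eqF.
rewrite -(ler_pM2l v0); apply: (le_trans dK).
have -> : r0 / 2 ^+ n.+1 = e n / 2 by rewrite /e exprSr invfM mulrA.
have := ler_wpM2l (ltW v0) dn; lra.
Qed.

End Labels.

(** * From the mean-square distance to the H^1 distance *)

Section Interpolation.
Context {R : realType}.
Variables (N : nat) (z : 'I_N -> R) (rhot : R * R * R -> R) (M rad : R).

(** A derivative is controlled by the function itself at low frequencies and by
    its second derivatives at high ones. *)
Lemma nrm2_wderiv_interp (f f' : R * R * R -> R) Q A j : 0 < A -> inH 1 f -> inH 1 f' ->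
  (forall n, \sum_(k <- cube n) quartic k * coef k f ^+ 2 <= Q) ->
  (forall n, \sum_(k <- cube n) quartic k * coef k f' ^+ 2 <= Q) ->
  vol * nrm2 (wderiv j (fun x => f x - f' x)) <=
  A * (vol * nrm2 (fun x => f x - f' x)) + 4 * Q / A.
Proof.
move=> A0 Hf Hf' Qf Qf'; have Hd := inH_sub Hf Hf'.
have sf := inH_L2 Hf; have sf' := inH_L2 Hf'; have sd := L2_sub sf sf'.
have [swd _] := inH_weak_deriv j Hd.
apply: nrm2_le_coef => // n.
apply: (@le_trans _ _ (\sum_(k <- cube n) (A * coef k (fun x => f x - f' x) ^+ 2 +
  A^-1 * (2 * (quartic k * coef k f ^+ 2) + 2 * (quartic k * coef k f' ^+ 2))))).
  rewrite -(big_flip_cube _ n j (fun k => coef k _ ^+ 2)) /=; apply: ler_sum => k _.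
  rewrite (coef_wderiv _ _ Hd) flipK coord_flip mulrNz coefB//.
  set x := coef k f; set y := coef k f'.
  have c4 : (coord k j)%:~R ^+ 4 <= quartic k :> R.
    by rewrite /quartic (bigD1 j)//= lerDl sumr_ge0// => l _; rewrite exprn_even_ge0.
  set c := (coord k j)%:~R in c4 *.
  have q0 := @quartic_ge0 R k.
  apply: (@le_trans _ _ (A * (x - y) ^+ 2 + A^-1 * (quartic k * (x - y) ^+ 2))); last first.
    rewrite lerD2l ler_wpM2l ?invr_ge0 ?(ltW A0)//.
    have := mulr_ge0 q0 (sqr_ge0 (x + y)); nra.
  apply: (@le_trans _ _ (A * (x - y) ^+ 2 + A^-1 * (c ^+ 4 * (x - y) ^+ 2))); last first.
    rewrite lerD2l ler_wpM2l ?invr_ge0 ?(ltW A0)// ler_wpM2r// sqr_ge0//.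
  rewrite -subr_ge0.
  have -> : A * (x - y) ^+ 2 + A^-1 * (c ^+ 4 * (x - y) ^+ 2) - (- - c * (x - y)) ^+ 2 =
    A^-1 * (3 / 4 * A ^+ 2 + (c ^+ 2 - A / 2) ^+ 2) * (x - y) ^+ 2.
    by field; rewrite gt_eqF.
  apply: mulr_ge0 (sqr_ge0 _); apply: mulr_ge0; first by rewrite invr_ge0 ltW.
  by have := sqr_ge0 (c ^+ 2 - A / 2); have := sqr_ge0 A; lra.
rewrite big_split /= -!mulr_sumr big_split /= -!mulr_sumr; apply: lerD.
  by rewrite ler_pM2l//; exact: bessel.
rewrite mulrC ler_pdivrMr// divfK ?gt_eqF//.
by have := Qf n; have := Qf' n; lra.
Qed.

Lemma Vnorm_interp w w' A : 0 < A -> BM z rhot M rad w -> BM z rhot M rad w' ->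
  \sum_(i < N) Hnorm 1 (w i \- w' i) ^+ 2 <=
  (1 + 3 * A) * dist2 w w' + N%:R * (12 * rad ^+ 2 / A).
Proof.
move=> A0 Bw Bw'; have v0 := @vol_gt0 R.
rewrite (_ : N%:R * _ = \sum_(i < N) (12 * rad ^+ 2 / A)); last first.
  by rewrite sumr_const card_ord mulr_natl.
rewrite /dist2 mulr_sumr -big_split; apply: ler_sum => i _ /=.
have Hw := inH_le (BM_inH2 i Bw); have Hw' := inH_le (BM_inH2 i Bw').
rewrite sqr_Hnorm sqHnormSE.
have dj j : nrm2 (wderiv j (w i \- w' i)) <=
    A * nrm2 (fun x => w i x - w' i x) + 4 * rad ^+ 2 / A.
  rewrite -(ler_pM2l v0); apply: (le_trans (nrm2_wderiv_interp j A0 Hw Hw'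
    (BM_quartic i Bw) (BM_quartic i Bw'))).
  rewrite le_eqVlt; apply/orP; left; apply/eqP; field; exact: lt0r_neq0.
have : \sum_(j < 3) sqHnorm 0 (wderiv j (w i \- w' i)) <=
    \sum_(j < 3) (A * nrm2 (fun x => w i x - w' i x) + 4 * rad ^+ 2 / A).
  by apply: ler_sum => j _; rewrite sqHnorm0E.
rewrite sumr_const card_ord -mulr_natl.
rewrite (_ : nrm2 (w i \- w' i) = nrm2 (fun x => w i x - w' i x)); last by [].
move=> H; rewrite mulrDl mul1r -addrA lerD2l; apply: (le_trans H).
by rewrite le_eqVlt; apply/orP; left; apply/eqP; field; exact: lt0r_neq0.
Qed.

End Interpolation.

(** * Covering the attractor *)

Section Covering.
Context {R : realType}.
Variables (N : nat) (z : 'I_N -> R) (rhot : R * R * R -> R).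
Implicit Types X : set (@state R N).

(** The centres are taken in X, one for each code that occurs. *)
Lemma covering_number_le (X : set (@state R N)) (L : finType) (code : state N -> L) (r : R) :
  X `<=` Vset z rhot ->
  (forall w w', X w -> X w' -> code w = code w' -> Vnorm (fun i => w i \- w' i) < r) ->
  (covering_number z rhot X r <= #|L|%:R%:E)%E.
Proof.
move=> XV Hr; have [[w0 Xw0]|X0] := pselect (X !=set0); last first.
  apply: (@le_trans _ _ (0%N%:R%:E)); last by rewrite lee_fin ler_nat.
  apply: ereal_inf_lbound; exists 0%N => //=.
  exists (fun _ => fun=> fun=> 0); split; first by case.
  by move=> w Xw; case: X0; exists w.
pose a (k : 'I_#|L|) : state N := xget w0 [set w | X w /\ code w = enum_val k].
have aX k : X (a k) by rewrite /a; case: xgetP => [w -> []|_] //.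
apply: ereal_inf_lbound; exists #|L| => //=; exists a; split => [k|w Xw]; first exact: XV.
exists (enum_rank (code w)) => //; split; first exact: XV.
apply: Hr => //; rewrite /a; case: xgetP => [v -> [_]|/(_ w)]; first by rewrite enum_rankK.
by case; split=> //; rewrite enum_rankK.
Qed.

Lemma lne_covering_le (X : set (@state R N)) (m : nat) (r a : R) : 0 < r -> r <= expR (- 1) ->
  (0 < m)%N -> (covering_number z rhot X r <= m%:R%:E)%E -> ln m%:R <= a * ln (1 / r) ->
  (lne (covering_number z rhot X r) * ((ln (1 / r))^-1)%:E <= a%:E)%E.
Proof.
move=> r0 re m0 Hc Hm; have l0 : 0 < ln (1 / r).
  rewrite div1r lnV ?posrE// oppr_gt0 ln_lt0// r0 /=; apply: (le_lt_trans re).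
  by rewrite expR_lt1 oppr_lt0.
apply: (@le_trans _ _ ((ln m%:R)%:E * ((ln (1 / r))^-1)%:E)%E).
  apply: lee_wpmul2r; first by rewrite lee_fin invr_ge0 ltW.
  have [c0|c0] := leP (covering_number z rhot X r) 0%E; first by rewrite le0_lneNy// leNye.
  rewrite -lne_EFin ?ltr0n// lee_lne//; first by rewrite in_itv /= leey ltW.
  by rewrite in_itv /= leey lee_fin ler0n.
by rewrite -EFinM lee_fin ler_pdivrMr.
Qed.

Lemma fractal_dim_le (X : set (@state R N)) (a : R) :
  (forall r, 0 < r -> r <= expR (- 1) ->
    exists m : nat, [/\ (0 < m)%N, (covering_number z rhot X r <= m%:R%:E)%E &
      ln m%:R <= a * ln (1 / r)]) ->
  (fractal_dim z rhot X <= a%:E)%E.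
Proof.
move=> H; apply: (@le_trans _ _ (ereal_sup [set
    (lne (covering_number z rhot X r) * ((ln (1 / r))^-1)%:E)%E | r in
    [set r : R | 0 < r /\ r <= expR (- 1)]])).
  apply: ereal_inf_lbound; exists [set r : R | 0 < r /\ r <= expR (- 1)] => //.
  near=> r; split; near: r; first exact: nbhs_right_gt.
  by apply: nbhs_right_le; exact: expR_gt0.
apply: ge_ereal_sup => _ [r [r0 re] <-].
by have [m [m0 Hc Hm]] := H r r0 re; exact: lne_covering_le Hc Hm.
Unshelve. all: by end_near.
Qed.

End Covering.

Section Attractor.
Context {R : realType}.
Variables (N : nat) (D : R) (z : 'I_N -> R) (rhot : R * R * R -> R) (M rad T : R).
Hypotheses (D_gt0 : 0 < D) (spr : smooth_periodic rhot).
Hypothesis absorb : absorbing D z rhot M rad T.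

Let good (c : R -> @state R N) := NPD_solution D z rhot c /\ BM z rhot M rad (c 0).

Lemma good_BM c t : good c -> T <= t -> BM z rhot M rad (c t).
Proof. by case: absorb => _ _ H _ [sc c0] Tt; apply: (H t Tt); exists c. Qed.

Lemma attractor_BM w : attractor D z rhot M rad w -> BM z rhot M rad w.
Proof. by case: absorb => _ T0 H _ Aw; apply: (H T (lexx _)); exact: Aw. Qed.

(** Every point of the attractor is reached at any prescribed positive time, so
    that coding a long enough trajectory arriving there codes the point. *)
Lemma attractor_code : exists (L : finType) (r0 : R), [/\ (0 < #|L|)%N, 0 < r0 &
  forall n, exists code : @state R N -> {ffun 'I_n -> L}, forall w w',
    attractor D z rhot M rad w -> attractor D z rhot M rad w' -> code w = code w' ->
    dist2 w w' <= r0 / 2 ^+ n].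
Proof.
have [_ T0 _ _] := absorb.
pose r0 := N%:R * (4 * (BM_bound M rad ^+ 2 * vol)) + 1 : R.
have r00 : 0 < r0.
  rewrite ltr_wpDl// mulr_ge0// mulr_ge0// mulr_ge0 ?sqr_ge0//; exact: ltW vol_gt0.
have good_ode c : good c -> tail_ode D z rhot (BM_bound M rad) T c.
  by move=> gc; apply: (NPD_tail_ode T0 spr) => [|t]; [case: gc|exact: good_BM].
have good_bound c c' : good c -> good c' -> forall t, T <= t -> dist2 (c t) (c' t) <= r0.
  move=> gc gc' t Tt; apply: (le_trans (BM_dist2 (good_BM gc Tt) (good_BM gc' Tt))).
  by rewrite lerDl.
have [L [lab [tau [tau0 Hlab]]]] := labels D_gt0 spr r00 good_ode good_bound.
exists L, r0; split=> // [|n].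
  by apply/card_gt0P; exists (lab 0%N (fun=> fun=> fun=> 0)).
pose t := T + 1 + n%:R * tau.
have t0 : 0 < t by have := mulr_ge0 (ler0n R n) (ltW tau0); rewrite /t; lra.
pose traj (w : @state R N) := xget ((fun=> w) : R -> 'I_N -> R * R * R -> R) [set c | good c /\ c t = w].
have trajP w : attractor D z rhot M rad w -> good (traj w) /\ traj w t = w.
  move=> /(_ t t0) [c [sc c0 ct]]; rewrite /traj.
  case: xgetP => [c' _ H|nH]; first exact: H.
  by case: (nH c).
exists (fun w => [ffun m : 'I_n => lab m (traj w)]) => w w' Aw Aw' E.
have [gw tw] := trajP w Aw; have [gw' tw'] := trajP w' Aw'.
rewrite -{1}tw -{1}tw'; apply: Hlab => // m mn.
by have := congr1 (fun f : {ffun 'I_n -> L} => f (Ordinal mn)) E; rewrite !ffunE.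
Qed.

End Attractor.

Lemma pow2_ge (R : realType) (C : R) : 0 < C -> exists2 a : R, 0 <= a &
  forall r, 0 < r -> r <= expR (- 1) ->
    exists2 n : nat, C / r ^+ 4 <= 2 ^+ n & n%:R <= a * ln (1 / r).
Proof.
move=> C0; have l2 : 0 < ln 2 :> R by rewrite ln_gt0// ltr1n.
pose b := (`|ln C| + 4) / ln 2; have b0 : 0 <= b by rewrite divr_ge0 ?addr_ge0// ltW.
exists (b + 1) => [|r r0 re]; first by rewrite addr_ge0.
have l1 : 1 <= ln (1 / r).
  rewrite -[leLHS]expRK ler_ln ?posrE ?expR_gt0// ?divr_gt0// div1r -(invrK (expR 1)) -expRN.
  by rewrite lef_pV2 ?posrE ?expR_gt0.
set l := ln (1 / r) in l1 *.
have bl : 0 <= b * l by rewrite mulr_ge0// (le_trans ler01).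
exists (Num.Def.truncn (b * l)).+1; last first.
  have /andP[H _] := truncn_itv bl.
  by rewrite -natr1 mulrDl mul1r; apply: lerD.
set n := (Num.Def.truncn _).+1; have nb : b * l < n%:R by exact: truncnS_gt.
rewrite -ler_ln ?posrE ?exprn_gt0// ?divr_gt0 ?exprn_gt0//.
rewrite -exprVn lnM ?posrE ?exprn_gt0 ?invr_gt0// !lnXn ?invr_gt0//.
rewrite -div1r -/l -[l *+ 4]mulr_natr -[ln 2 *+ n]mulr_natr.
have bE : b * ln 2 = `|ln C| + 4 by rewrite /b divfK// gt_eqF.
have := ler_norm (ln C).
have h1 : b * l * ln 2 <= n%:R * ln 2 by rewrite ler_wpM2r// ltW.
have h2 : `|ln C| * 1 <= `|ln C| * l by rewrite ler_wpM2l.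
have h3 : b * l * ln 2 = (`|ln C| + 4) * l by rewrite -bE; ring.
rewrite h3 in h1; set x := n%:R in h1 *; move: h1 h2; set y := `|_|; lra.
Qed.

Theorem theorem7p2 (R : realType) (N : nat) (hN : (1 <= N)%N)
    (D : R) (hD : 0 < D) (z : 'I_N -> R)
    (hz : forall i j, `|z i| = `|z j|)
    (rhot : R * R * R -> R) (hrhot : smooth_periodic rhot)
    (M : R) (hM : 0 < M) (rad T : R)
    (habs : absorbing D z rhot M rad T) :
  exists Mt : R, 0 < Mt /\
    (fractal_dim z rhot (attractor D z rhot M rad) <= Mt%:E)%E.
Proof.
have [L [r0 [L0 r00 Hcode]]] := attractor_code hD hrhot habs.
pose Q := N%:R * (12 * rad ^+ 2); have Q0 : 0 <= Q by rewrite mulr_ge0// mulr_ge0// sqr_ge0.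
pose C := 2 * (1 + 12 * (Q + 1)) * r0.
have C0 : 0 < C by rewrite mulr_gt0//; lra.
have [a a0 Ha] := pow2_ge C0.
have lnL : 0 <= ln #|L|%:R :> R by rewrite ln_ge0// ler1n.
exists (a * ln #|L|%:R + 1); split; first by rewrite ltr_wpDl// mulr_ge0.
apply: fractal_dim_le => r r_gt0 re; have [n Hn na] := Ha r r_gt0 re.
have [code Hc] := Hcode n.
have l1 : 0 <= ln (1 / r).
  rewrite ln_ge0// div1r invf_ge1//; apply: (le_trans re).
  by rewrite expR_le1 oppr_le0.
exists #|{ffun 'I_n -> L}|; split.
- by rewrite card_ffun card_ord expn_gt0 L0.
- apply: (covering_number_le (code := code)) => [w Aw|w w' Aw Aw' E].
    by have [[]] := attractor_BM habs Aw.
  have r2 : 0 < r ^+ 2 by rewrite exprn_gt0.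
  pose A := 4 * (Q + 1) / r ^+ 2.
  have A0 : 0 < A by rewrite divr_gt0// mulr_gt0//; lra.
  have := Vnorm_interp A0 (attractor_BM habs Aw) (attractor_BM habs Aw').
  set S := \sum_(i < N) _ => HS.
  have S2 : S < r ^+ 2.
    apply: (le_lt_trans HS).
    have e1 : N%:R * (12 * rad ^+ 2 / A) <= r ^+ 2 / 4.
      rewrite mulrA -/Q ler_pdivrMr// /A.
      have -> : r ^+ 2 / 4 * (4 * (Q + 1) / r ^+ 2) = Q + 1 by field; rewrite gt_eqF.
      by rewrite lerDl.
    have e2 : (1 + 3 * A) * dist2 w w' <= r ^+ 2 / 2.
      have dw := Hc w w' Aw Aw' E.
      have p2 : 0 < 2 ^+ n :> R by rewrite exprn_gt0.
      have r1 : r ^+ 2 <= 1.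
        rewrite expr_le1// ?(ltW r_gt0)//; apply: (le_trans re).
        by rewrite expR_le1 oppr_le0.
      have A1 : 1 + 3 * A <= (1 + 12 * (Q + 1)) / r ^+ 2.
        rewrite ler_pdivlMr// mulrDl /A.
        have -> : 3 * (4 * (Q + 1) / r ^+ 2) * r ^+ 2 = 12 * (Q + 1) by field; rewrite gt_eqF.
        by rewrite lerD2r mul1r.
      apply: (@le_trans _ _ ((1 + 12 * (Q + 1)) / r ^+ 2 * (r0 / 2 ^+ n))).
        by apply: ler_pM => //; [lra|exact: dist2_ge0].
      rewrite ler_pdivrMr ?exprn_gt0// in Hn.
      rewrite mulrA ler_pdivrMr// mulrAC ler_pdivrMr//.
      have -> : r ^+ 2 / 2 * 2 ^+ n * r ^+ 2 = 2 ^+ n * r ^+ 4 / 2 by ring.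
      by rewrite ler_pdivlMr//; move: Hn; rewrite /C; lra.
    lra.
  rewrite /Vnorm -(gtr0_norm r_gt0) -sqrtr_sqr ltr_sqrt//.
- rewrite card_ffun card_ord natrX lnXn ?ltr0n// -[ln _ *+ n]mulr_natl.
  apply: (@le_trans _ _ (a * ln (1 / r) * ln #|L|%:R)); first by rewrite ler_wpM2r.
  by rewrite [leRHS]mulrDl (mul1r (ln _)) (mulrAC a) lerDl.
Qed.
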